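(* Let $X(\mathbb{R})$ be a reflexive Banach function space such that the Hardy-Littlewood maximal operator $M$ is bounded on $X(\mathbb{R})$ and on its associate space $X'(\mathbb{R})$. Then the ideal $\mathcal{K}(X(\mathbb{R}))$ of compact operators on $X(\mathbb{R})$ is contained in the Banach algebra \[ \mathcal{A}_{X(\mathbb{R})}=\operatorname{alg}\{aI,\ W^0(b)\ :\ a\in C(\dot{\mathbb{R}}),\ b\in C_X(\dot{\mathbb{R}})\}, \] the smallest closed subalgebra of $\mathcal{B}(X(\mathbb{R}))$ containing all multiplication operators $aI$ with $a\in C(\dot{\mathbb{R}})$ and all Fourier convolution operators $W^0(b)$ with $b\in C_X(\dot{\mathbb{R}})$.
   Context: A Banach function norm is a map $\rho$ from nonnegative measurable functions on $\mathbb{R}$ to $[0,\infty]$ that is a norm-like functional ($\rho(f)=0\iff f=0$ a.e., positive homogeneous, subadditive), has the lattice property ($0\le g\le f$ a.e. implies $\rho(g)\le\rho(f)$), the Fatou property ($0\le f_n\uparrow f$ a.e. implies $\rho(f_n)\uparrow\rho(f)$), satisfies $\rho(\chi_E)<\infty$ and $\int_E f\,dx\le C_E\rho(f)$ for every measurable $E$ with $|E|<\infty$. The Banach function space $X(\mathbb{R})$ is the set of measurable $f$ with $\|f\|_{X(\mathbb{R})}:=\rho(|f|)<\infty$. Its associate space $X'(\mathbb{R})$ is the Banach function space given by the norm $\rho'(g)=\sup\{\int_\mathbb{R} fg\,dx: f\ge0,\ \rho(f)\le1\}$. The Hardy-Littlewood maximal operator is $(Mf)(x)=\sup_{Q\ni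 x}\frac1{|Q|}\int_Q|f(y)|dy$, the supremum over bounded intervals $Q$ containing $x$. The Fourier transform is $(Ff)(x)=\int_\mathbb{R} f(t)e^{itx}dt$ and for $a\in L^\infty(\mathbb{R})$, $W^0(a)=F^{-1}aF$ on $L^2(\mathbb{R})$. A function $a\in L^\infty(\mathbb{R})$ is a Fourier multiplier on $X(\mathbb{R})$ if $W^0(a)$ maps $L^2(\mathbb{R})\cap X(\mathbb{R})$ into $X(\mathbb{R})$ and extends to a bounded operator on $X(\mathbb{R})$; the set $\mathcal{M}_{X(\mathbb{R})}$ of such multipliers is normed by $\|a\|_{\mathcal{M}_{X(\mathbb{R})}}=\|W^0(a)\|_{\mathcal{B}(X(\mathbb{R}))}$. $\dot{\mathbb{R}}=\mathbb{R}\cup\{\infty\}$ is the one-point compactification, $C(\dot{\mathbb{R}})$ the continuous functions on it, $V(\mathbb{R})$ the functions of finite total variation on $\mathbb{R}$, and $C_X(\dot{\mathbb{R}})$ is the closure of $C(\dot{\mathbb{R}})\cap V(\mathbb{R})$ in the norm of $\mathcal{M}_{X(\mathbb{R})}$. $\mathcal{B}(X(\mathbb{R}))$ denotes bounded linear operators on $X(\mathbb{R})$. *)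

(* Defs.v *)
From mathcomp Require Import all_boot all_order all_algebra.
From mathcomp Require Import all_classical all_reals all_analysis.
From mathcomp Require Import complex measurable_realfun.
Import Order.TTheory GRing.Theory Num.Theory numFieldNormedType.Exports.
Local Open Scope classical_set_scope.
Local Open Scope ring_scope.

Section Defs.
Context {R : realType}.
Local Notation C := (R[i]).
Local Notation mu := (@lebesgue_measure R).

Definition cRe (z : C) : R := complex.Re z.
Definition cIm (z : C) : R := complex.Im z.
Definition cnorm (z : C) : R := Num.sqrt (cRe z ^+ 2 + cIm z ^+ 2).
Definition creal (r : R) : C := Complex r 0.
Definition cexpi (s : R) : C := Complex (cos s) (sin s).

Definition cmeasurable (f : R -> C) :=
  measurable_fun setT (cRe \o f) /\ measurable_fun setT (cIm \o f).
Definition ae_eq (f g : R -> C) := {ae mu, forall x, f x = g x}.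

Definition cint (E : set R) (h : R -> C) : C :=
  Complex (Rintegral mu E (cRe \o h)) (Rintegral mu E (cIm \o h)).

Definition nonneg_mfun (f : R -> R) := measurable_fun setT f /\ (forall x, 0 <= f x).

Definition banach_function_norm (rho : (R -> R) -> \bar R) :=
  (forall f, nonneg_mfun f -> (0 <= rho f)%E) /\
  (forall f, nonneg_mfun f -> (rho f = 0%E <-> {ae mu, forall x, f x = 0})) /\
  (forall f (l : R), nonneg_mfun f -> 0 <= l ->
      rho (fun x => l * f x) = (l%:E * rho f)%E) /\
  (forall f g, nonneg_mfun f -> nonneg_mfun g ->
      (rho (fun x => (f x + g x)%R) <= rho f + rho g)%E) /\
  (forall f g, nonneg_mfun f -> nonneg_mfun g ->
      {ae mu, forall x, g x <= f x} -> (rho g <= rho f)%E) /\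
  (forall (fn : nat -> R -> R) f, (forall n, nonneg_mfun (fn n)) -> nonneg_mfun f ->
      {ae mu, forall x, nondecreasing_seq (fun n => fn n x) /\
                        (fun n => fn n x) @ \oo --> f x} ->
      rho (fn n) @[n --> \oo] --> rho f) /\
  (forall E, measurable E -> (mu E < +oo)%E -> (rho (\1_E) < +oo)%E) /\
  (forall E, measurable E -> (mu E < +oo)%E -> exists CE : R, forall f,
      nonneg_mfun f -> (\int[mu]_(x in E) (f x)%:E <= CE%:E * rho f)%E).

Definition assoc_norm (rho : (R -> R) -> \bar R) (g : R -> R) : \bar R :=
  ereal_sup [set (\int[mu]_x (f x * g x)%R%:E)%E
            | f in [set f | nonneg_mfun f /\ (rho f <= 1)%E]].

Definition inX (rho : (R -> R) -> \bar R) (f : R -> C) :=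
  cmeasurable f /\ (rho (cnorm \o f) < +oo)%E.
Definition Xnorm (rho : (R -> R) -> \bar R) (f : R -> C) : R :=
  fine (rho (cnorm \o f)).

Definition maximal (f : R -> C) (x : R) : \bar R :=
  ereal_sup [set (((ab.2 - ab.1)^-1)%R%:E *
                   \int[mu]_(y in `[ab.1, ab.2]) (cnorm (f y))%:E)%E
            | ab in [set ab : R * R | ab.1 < ab.2 /\ ab.1 <= x <= ab.2]].

Definition maximal_bounded (rho : (R -> R) -> \bar R) :=
  exists c : R, forall f, inX rho f ->
    (@measurable_fun _ _ R (\bar R) setT (maximal f)) /\
    {ae mu, forall x, (maximal f x < +oo)%E} /\
    (rho (fun x => fine (maximal f x)) <= c%:E * rho (cnorm \o f))%E.

Definition op := (R -> C) -> (R -> C).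

Definition bounded_op (rho : (R -> R) -> \bar R) (T : op) :=
  (forall f, inX rho f -> inX rho (T f)) /\
  (forall (al : C) f g, inX rho f -> inX rho g ->
      ae_eq (T (fun x => al * f x + g x)) (fun x => al * T f x + T g x)) /\
  exists c : R, forall f, inX rho f -> Xnorm rho (T f) <= c * Xnorm rho f.

Definition op_cvg (rho : (R -> R) -> \bar R) (Tn : nat -> op) (T : op) :=
  forall e : R, 0 < e -> exists N, forall n, (N <= n)%N -> forall f, inX rho f ->
     Xnorm rho (fun x => Tn n f x - T f x) <= e * Xnorm rho f.

Definition compact_op (rho : (R -> R) -> \bar R) (T : op) :=
  bounded_op rho T /\
  forall fn : nat -> R -> C, (forall n, inX rho (fn n) /\ Xnorm rho (fn n) <= 1) ->
    exists (s : nat -> nat) (g : R -> C),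
      (forall n, (s n < s n.+1)%N) /\ inX rho g /\
      (fun k => Xnorm rho (fun x => T (fn (s k)) x - g x)) @ \oo --> (0 : R).

Definition dual_elt (rho : (R -> R) -> \bar R) (phi : (R -> C) -> C) :=
  (forall (al : C) f g, inX rho f -> inX rho g ->
      phi (fun x => al * f x + g x) = al * phi f + phi g) /\
  exists c : R, forall f, inX rho f -> cnorm (phi f) <= c * Xnorm rho f.

Definition bidual_elt (rho : (R -> R) -> \bar R) (Phi : ((R -> C) -> C) -> C) :=
  (forall (al : C) phi psi, dual_elt rho phi -> dual_elt rho psi ->
      Phi (fun f => al * phi f + psi f) = al * Phi phi + Phi psi) /\
  exists c : R, forall phi (K : R), dual_elt rho phi -> 0 <= K ->
      (forall f, inX rho f -> cnorm (phi f) <= K * Xnorm rho f) ->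
      cnorm (Phi phi) <= c * K.

Definition reflexive_space (rho : (R -> R) -> \bar R) :=
  forall Phi, bidual_elt rho Phi ->
    exists f, inX rho f /\ forall phi, dual_elt rho phi -> Phi phi = phi f.

Definition inL2 (f : R -> C) :=
  cmeasurable f /\ (\int[mu]_x ((cnorm (f x)) ^+ 2)%R%:E < +oo)%E.
Definition inLinfty (a : R -> C) :=
  cmeasurable a /\ exists c : R, {ae mu, forall x, cnorm (a x) <= c}.

(** Fourier transform on L^2 (Plancherel): L^2-limit of truncated integrals
    (Ff)(x) = int f(t) e^{itx} dt,  (F^{-1}g)(x) = (2 pi)^{-1} int g(t) e^{-itx} dt *)
Definition fourier_trunc (f : R -> C) (N : nat) (x : R) : C :=
  cint `[- (N%:R), N%:R] (fun t => f t * cexpi (t * x)).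
Definition invfourier_trunc (g : R -> C) (N : nat) (x : R) : C :=
  creal ((2 * pi)^-1) * cint `[- (N%:R), N%:R] (fun t => g t * cexpi (- (t * x))).
Definition L2_lim (hN : nat -> R -> C) (h : R -> C) :=
  cmeasurable h /\
  (fun N => (\int[mu]_x ((cnorm (hN N x - h x)) ^+ 2)%R%:E)%E) @ \oo --> 0%E.

(** W0 a f g  :<->  g = W^0(a) f = F^{-1} a F f  (for f in L^2) *)
Definition W0 (a : R -> C) (f g : R -> C) :=
  exists h, L2_lim (fourier_trunc f) h /\
            L2_lim (invfourier_trunc (fun x => a x * h x)) g.

Definition mult_norm_le (rho : (R -> R) -> \bar R) (a : R -> C) (e : R) :=
  forall f g, inL2 f -> inX rho f -> W0 a f g -> Xnorm rho g <= e * Xnorm rho f.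

Definition multiplier (rho : (R -> R) -> \bar R) (a : R -> C) :=
  inLinfty a /\
  (forall f g, inL2 f -> inX rho f -> W0 a f g -> inX rho g) /\
  exists c : R, mult_norm_le rho a c.

Definition Cdot (a : R -> C) :=
  continuous (cRe \o a) /\ continuous (cIm \o a) /\
  exists l : C,
    cRe (a x) @[x --> +oo%R] --> cRe l /\ cIm (a x) @[x --> +oo%R] --> cIm l /\
    cRe (a x) @[x --> -oo%R] --> cRe l /\ cIm (a x) @[x --> -oo%R] --> cIm l.

Definition bounded_variation (a : R -> C) :=
  exists V : R, forall s : seq R, sorted <=%R s ->
    \sum_(i < (size s).-1) cnorm (a (nth 0 s i.+1) - a (nth 0 s i)) <= V.

Definition CX (rho : (R -> R) -> \bar R) (b : R -> C) :=
  multiplier rho b /\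
  forall e : R, 0 < e -> exists c, Cdot c /\ bounded_variation c /\
    multiplier rho c /\ mult_norm_le rho (fun x => b x - c x) e.

Definition mulop (a : R -> C) : op := fun f x => a x * f x.

Definition alg_generator (rho : (R -> R) -> \bar R) (T : op) :=
  (exists a, Cdot a /\ T = mulop a) \/
  (exists b, CX rho b /\ bounded_op rho T /\
     forall f g, inL2 f -> inX rho f -> W0 b f g -> ae_eq (T f) g).

Definition alg_closed (rho : (R -> R) -> \bar R) (S : set op) :=
  (forall T1 T2, S T1 -> S T2 -> S (fun f x => T1 f x + T2 f x)) /\
  (forall (al : C) T, S T -> S (fun f x => al * T f x)) /\
  (forall T1 T2, S T1 -> S T2 -> S (fun f => T1 (T2 f))) /\
  (forall Tn T, (forall n, S (Tn n)) -> bounded_op rho T -> op_cvg rho Tn T -> S T).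

Definition A_X (rho : (R -> R) -> \bar R) (T : op) :=
  bounded_op rho T /\
  forall S : set op, alg_generator rho `<=` S -> alg_closed rho S -> S T.

End Defs.

(* Main.v *)
Require Import Defs.
From mathcomp Require Import all_boot all_order all_algebra.
From mathcomp Require Import all_classical all_reals all_analysis.
From mathcomp Require Import complex measurable_realfun.
From mathcomp Require Import zify ring lra.
Set Implicit Arguments.
Unset Strict Implicit.
Unset Printing Implicit Defensive.
Import Order.TTheory GRing.Theory Num.Theory numFieldNormedType.Exports.
Local Open Scope classical_set_scope.
Local Open Scope ring_scope.

(* Two families of operators in the algebra S generated by the a I and the W^0(b)
   suffice: multiplications by compactly supported continuous
   functions, and the convolutions K_d with the Fejer-type kernel
   2 (1 - cos (d u)) / (d u)^2, whose symbol is a triangle function on [-d, d].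
   The kernel is dominated by dyadic annuli, so |K_d f| <= A_d M f and K_d is
   bounded on X.  As d -> 0 the kernel tends to 1 on bounded sets, hence
   a K_d b I -> a (x) int b in operator norm: S contains the rank one operators
   f |-> (int b f) a.

   Reflexivity is used through one principle.  Let P_n be uniformly bounded
   operators on X with P_m P_n = P_n P_m = P_n for m > n, such that
   int_J P_n f -> int_J f for every dyadic interval J.  Then P_n f -> f in X and
   phi o P_n -> phi in norm for every functional phi.  Indeed a limit of P_n f
   along an ultrafilter, taken in the bidual, is an element of X, and it equals f
   almost everywhere because its dyadic integrals are those of f; Hahn-Banach
   then turns weak convergence into density of the ranges, and the same argument
   applies in the dual.  It is applied to
   - multiplications by 1 - chi_I + t_n with t_n continuous tents increasing to
     chi_I, which puts chi_I (x) int_J into S for intervals I and J;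
   - the dyadic conditional expectations E_n (|E_n f| <= 2 M f), which puts
     chi_I (x) phi into S for every functional phi, hence E_n T for every bounded
     T; for T compact, E_n T -> T in norm. *)

(** * Complex numbers and the Hahn-Banach theorem *)

(** Nothing is known of the norm beyond its axioms: the dual is not described by integrals, and
    density of continuous functions in X is not given. So convergence in X and in its dual is
    extracted from reflexivity and tested only on integrals over dyadic intervals, which determine a
    locally integrable function by Lebesgue differentiation.

    The kernels are normalised by their value 1 at the origin, not by their mass. This reverses the
    usual role of the Fejer kernel: as d -> 0 it does not concentrate but flattens to the constant
    1, so that cut off on both sides it becomes the kernel of a rank one operator. The constant
    obtained for A_d blows up in this limit, but it only serves to put each K_d into the algebra;
    the limit itself is estimated directly on a bounded square.

    The multipliers 1 - chi_I + t_n, unlike t_n, have the identity as their limit, as the principle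
    demands; applied to chi_I they give back t_n. The averages E_n are restricted to a window of
    finite length to have finite rank: phi o E_n is then a finite combination of integrals over
    intervals, and E_n T a finite sum of rank one operators. *)

Section cnorm_theory.
Context {R : realType}.
Local Notation C := (R[i]).
Implicit Types (z w : C) (r s : R).

Lemma cnormE z : cnorm z = ComplexField.Normc.normc z.
Proof. by case: z. Qed.

Lemma cnorm_ge0 z : 0 <= cnorm z.
Proof. exact: sqrtr_ge0. Qed.

Lemma cnormD z w : cnorm (z + w) <= cnorm z + cnorm w.
Proof. by rewrite !cnormE; exact: (@complex.le_normcD R z w). Qed.

Lemma cnormM z w : cnorm (z * w) = cnorm z * cnorm w.
Proof. by rewrite !cnormE ComplexField.Normc.normcM. Qed.

Lemma cnormN z : cnorm (- z) = cnorm z.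
Proof. by rewrite !cnormE; exact: (@complex.normcN R z). Qed.

Lemma cnormB z w : cnorm (z - w) = cnorm (w - z).
Proof. by rewrite -cnormN opprB. Qed.

Lemma cnorm0 : cnorm (0 : C) = 0.
Proof. by rewrite cnormE ComplexField.Normc.normc0. Qed.

Lemma cnorm0_eq0 z : cnorm z = 0 -> z = 0.
Proof. by rewrite cnormE => /ComplexField.Normc.eq0_normc. Qed.

Lemma cnorm_creal r : cnorm (creal r) = `|r|.
Proof. by rewrite /cnorm /= expr0n /= addr0 sqrtr_sqr. Qed.

Lemma normr_cRe z : `|cRe z| <= cnorm z.
Proof.
by rewrite -sqrtr_sqr /cnorm ler_sqrt ?addr_ge0 ?sqr_ge0// lerDl sqr_ge0.
Qed.

Lemma normr_cIm z : `|cIm z| <= cnorm z.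
Proof.
by rewrite -sqrtr_sqr /cnorm ler_sqrt ?addr_ge0 ?sqr_ge0// lerDr sqr_ge0.
Qed.

Lemma cnorm_le z : cnorm z <= `|cRe z| + `|cIm z|.
Proof.
rewrite -[leRHS]ger0_norm ?addr_ge0// -sqrtr_sqr /cnorm ler_sqrt ?sqr_ge0//.
rewrite sqrrD !real_normK ?num_real// lerD2r lerDl mulrn_wge0//.
Qed.

Lemma cReD z w : cRe (z + w) = cRe z + cRe w. Proof. by case: z; case: w. Qed.
Lemma cImD z w : cIm (z + w) = cIm z + cIm w. Proof. by case: z; case: w. Qed.
Lemma cReN z : cRe (- z) = - cRe z. Proof. by case: z. Qed.
Lemma cImN z : cIm (- z) = - cIm z. Proof. by case: z. Qed.
Lemma cReM z w : cRe (z * w) = cRe z * cRe w - cIm z * cIm w.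
Proof. by case: z; case: w. Qed.
Lemma cImM z w : cIm (z * w) = cRe z * cIm w + cIm z * cRe w.
Proof. by case: z; case: w. Qed.

Lemma cReMr r z : cRe (creal r * z) = r * cRe z.
Proof. by rewrite cReM /= mul0r subr0. Qed.
Lemma cImMr r z : cIm (creal r * z) = r * cIm z.
Proof. by rewrite cImM /= mul0r addr0. Qed.

Lemma complex_ext z w : cRe z = cRe w -> cIm z = cIm w -> z = w.
Proof. by case: z => a b; case: w => c d /= -> ->. Qed.

Lemma crealD r s : creal (r + s) = creal r + creal s.
Proof. by apply: complex_ext; rewrite ?cReD ?cImD /= ?addr0. Qed.
Lemma crealM r s : creal (r * s) = creal r * creal s.
Proof. by apply: complex_ext; rewrite ?cReMr ?cImMr /= ?mulr0. Qed.
Lemma creal0 : creal 0 = 0 :> C. Proof. exact: complex_ext. Qed.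
Lemma creal1 : creal 1 = 1 :> C. Proof. exact: complex_ext. Qed.
Lemma crealN r : creal (- r) = - creal r.
Proof. by apply: complex_ext; rewrite ?cReN ?cImN /= ?oppr0. Qed.

End cnorm_theory.

(** * Hahn-Banach separation for a seminorm given on a subspace *)

Section hahn_banach.
Context {R : realType} (E : lmodType R[i]) (D V : set E) (p : E -> R).
Hypothesis Dlin : forall a f g, D f -> D g -> D (a *: f + g).
Hypothesis plin : forall a f g, D f -> D g ->
  p (a *: f + g) <= cnorm a * p f + p g.
Hypothesis p0 : p 0 = 0.
Hypothesis D0 : D 0.
Hypothesis V0 : V 0.
Hypothesis VD : V `<=` D.
Hypothesis Vlin : forall a f g, V f -> V g -> V (a *: f + g).
Variables (f0 : E) (d : R).
Hypothesis Df0 : D f0.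
Hypothesis d0 : 0 < d.
Hypothesis f0V : forall v, V v -> d <= p (f0 - v).

Local Notation rs t f := (creal t *: f).

(* Graphs of real-linear functionals dominated by [p] and extending
   [v + t f0 |-> t d]. *)
Let good (G : set (E * R)) :=
  [/\ forall v t, V v -> G (v + rs t f0, t * d),
      forall x, G x -> D x.1 /\ x.2 <= p x.1 &
      forall t x y, G x -> G y -> G (rs t x.1 + y.1, t * x.2 + y.2)].

Let DZ a f : D f -> D (a *: f).
Proof. by move=> Df; rewrite -[_ *: _]addr0; exact: Dlin. Qed.

Let DD f g : D f -> D g -> D (f + g).
Proof. by move=> Df Dg; rewrite -[f]scale1r; exact: Dlin. Qed.

Let VZ a f : V f -> V (a *: f).
Proof. by move=> Df; rewrite -[_ *: _]addr0; exact: Vlin. Qed.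

Let pZ t f : 0 <= t -> D f -> p (rs t f) <= t * p f.
Proof.
move=> t0 Df; have := plin (creal t) Df D0.
by rewrite !addr0 p0 addr0 cnorm_creal ger0_norm.
Qed.

Let pD f g : D f -> D g -> p (f + g) <= p f + p g.
Proof.
move=> Df Dg; have := plin 1 Df Dg.
by rewrite scale1r -creal1 cnorm_creal normr1 mul1r.
Qed.

Let pN f : D f -> p (- f) <= p f.
Proof.
move=> Df; have := plin (-1) Df D0.
by rewrite scaleN1r !addr0 p0 addr0 cnormN -creal1 cnorm_creal normr1 mul1r.
Qed.

Let p_ge0 f : D f -> 0 <= p f.
Proof.
move=> Df; have DN : D (- f) by rewrite -scaleN1r; exact: DZ.
have := pD Df DN; rewrite subrr p0 => h.
have := pN Df; lra.
Qed.

Let good0 : good [set x | exists v t, V v /\ x = (v + rs t f0, t * d)].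
Proof.
split.
- by move=> v t Vv; exists v, t.
- move=> _ [v [t [Vv ->]]] /=; split; first by apply: DD; [exact: VD|exact: DZ].
  (* For [t <= 0] domination holds because [p] is nonnegative; for [t > 0] it is [f0V] at the vector
     [- v / t], scaled by [t]. *)
  have [t0|t0] := leP t 0.
    apply: (@le_trans _ _ 0); first by rewrite mulr_le0_ge0// ltW.
    by apply: p_ge0; apply: DD; [exact: VD|exact: DZ].
  have DD' : D (v + rs t f0) by apply: DD; [exact: VD|exact: DZ].
  have := pZ (ltW (_ : 0 < t^-1)) DD'; rewrite invr_gt0 => /(_ t0).
  rewrite scalerDr scalerA -crealM mulVf ?gt_eqF// creal1 scale1r.
  have -> : rs t^-1 v + f0 = f0 - (- rs t^-1 v) by rewrite opprK addrC.
  have VV : V (- rs t^-1 v) by rewrite -scalerN -scaleN1r; do 2 apply: VZ.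
  have := f0V VV => h1 h2; have {h1 h2} := le_trans h1 h2.
  by rewrite -ler_pdivrMl ?invr_gt0// invrK.
- move=> t _ _ [v [s [Vv ->]]] [w [r [Vw ->]]] /=.
  exists (rs t v + w), (t * s + r); split; first exact: Vlin.
  congr (_, _); last by ring.
  by rewrite scalerDr scalerA -crealM crealD scalerDl addrACA.
Qed.

Let good_maximal : exists G, good G /\ forall G', G `<` G' -> ~ good G'.
Proof.
have [|G [PG Gmax]] := @Zorn_bigcup (E * R)%type
    [set G | G = set0 \/ good G].
  move=> F FP Ftot.
  have [[G [FG gG]]|noF] := pselect (exists G, F G /\ good G); last first.
    left; rewrite -subset0 => x [G FG Gx].
    have [G0|gG] := FP _ FG; first by rewrite G0 in Gx.
    by apply: noF; exists G.
  right; split.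
  - by move=> v t Vv; exists G => //; case: gG => + _ _; apply.
  - move=> x [H FH Hx]; have [H0|[_ + _]] := FP _ FH; last exact.
    by rewrite H0 in Hx.
  - move=> t x y [H FH Hx] [K FK Ky].
    have [HK|KH] := Ftot _ _ FH FK.
    + exists K => //; have [K0|[_ _ +]] := FP _ FK; first by rewrite K0 in Ky.
      by apply => //; exact: HK.
    + exists H => //; have [K0|[_ _ +]] := FP _ FH; first by rewrite K0 in Hx.
      by apply => //; exact: KH.
exists G; split.
  case: PG => // G0; exfalso; apply: (Gmax _ _ (or_intror good0)).
  rewrite G0; split; first exact: sub0set.
  by move=> /(_ (0 + rs 0 f0, 0 * d)); apply; exists 0, 0.
by move=> G' GG' gG'; apply: (Gmax _ GG'); right.
Qed.

(** A maximal dominated graph is defined on all of [D] and gives a real functional [u], which is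
    then complexified. The factor 2 comes from bounding real and imaginary parts separately. Domains
    are predicates because X is a set of functions inside [R -> C]. *)
Lemma hahn_banach_separation : exists phi : E -> R[i],
  [/\ forall a f g, D f -> D g -> phi (a *: f + g) = a * phi f + phi g,
      forall f, D f -> cnorm (phi f) <= 2 * p f,
      forall v, V v -> phi v = 0 & phi f0 != 0].
Proof.
have [G [[G0 Gp Glin] Gmax]] := good_maximal.
have GZ t x : G x -> G (rs t x.1, t * x.2).
  move=> Gx; have := Glin t _ _ Gx (G0 0 0 V0).
  by rewrite /= creal0 scale0r !addr0 mul0r addr0.
have Gfun f r s : G (f, r) -> G (f, s) -> r = s.
  move=> Gr Gs; have le a b : G (f, a) -> G (f, b) -> b <= a.
    move=> Ga Gb; have := Glin (-1) _ _ Ga Gb.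
    move=> /Gp [_] /=; rewrite crealN creal1 scaleN1r addNr p0 mulN1r; lra.
  by apply/eqP; rewrite eq_le !le.
have Gtot f1 : D f1 -> exists r, G (f1, r).
  move=> Df1; apply: contrapT => nG.
  (* One-dimensional extension: the value [a] at [f1] must lie above all of [A] and below every
     [p (x.1 + f1) - x.2]; subadditivity puts the former below the latter, so [sup A] will do. *)
  pose A := [set y | exists2 x, G x & y = x.2 - p (x.1 - f1)].
  have G00 : G (0, 0).
    by have := G0 0 0 V0; rewrite creal0 scale0r addr0 mul0r.
  have DN f : D f -> D (- f) by move=> Df; rewrite -scaleN1r; exact: DZ.
  have Aub x : G x -> ubound A (p (x.1 + f1) - x.2).
    move=> Gx _ [y Gy ->].
    have := Glin 1 _ _ Gx Gy; rewrite creal1 scale1r mul1r => /Gp[_ /= h].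
    have := pD (DD (Gp _ Gx).1 Df1) (DD (Gp _ Gy).1 (DN _ Df1)).
    by rewrite addrACA subrr addr0; lra.
  have hsA : has_sup A.
    split; first by exists (0 - p (0 - f1)); exists (0, 0).
    by exists (p (0 + f1) - 0); exact: (Aub _ G00).
  pose a := sup A.
  have a1 x : G x -> x.2 + a <= p (x.1 + f1).
    move=> Gx; rewrite -lerBrDl; apply: ge_sup; first exact: hsA.1.
    exact: Aub.
  have a2 x : G x -> x.2 - a <= p (x.1 - f1).
    move=> Gx; rewrite lerBlDr -lerBlDl; apply: ub_le_sup; first exact: hsA.2.
    by exists x.
  pose G' := [set y | exists x t, G x /\ y = (x.1 + rs t f1, x.2 + t * a)].
  apply: (Gmax G').
    split.
      move=> x Gx; exists x, 0; split => //.
      by rewrite creal0 scale0r mul0r !addr0; case: (x).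
    move=> /(_ (f1, a)) h; apply: nG; exists a; apply: h.
    by exists (0, 0), 1; rewrite creal1 scale1r mul1r !add0r.
  split.
  - move=> v t Vv; exists (v + rs t f0, t * d), 0; split; first exact: G0.
    by rewrite creal0 scale0r mul0r !addr0.
  - move=> _ [x [t [Gx ->]]] /=.
    have Dx := (Gp _ Gx).1.
    have Dxt : D (x.1 + rs t f1) by apply: DD => //; exact: DZ.
    split => //.
    (* Dividing by [- t] or [t] reduces domination to [a2] or [a1]. *)
    have [t0|t0|->] := ltgtP t 0.
    + have t0' : 0 < - t^-1 by rewrite oppr_gt0 invr_lt0.
      have := a2 _ (GZ (- t^-1) _ Gx).
      have := pZ (ltW t0') Dxt.
      rewrite /= scalerDr scalerA -crealM mulNr mulVf ?lt_eqF//.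
      rewrite (crealN 1) creal1 scaleN1r => h1 h2; have := le_trans h2 h1.
      rewrite (_ : _ - a = - t^-1 * (x.2 + t * a)); first by rewrite ler_pM2l.
      by rewrite mulrDr [in RHS]mulrA [- t^-1 * t]mulNr mulVf ?lt_eqF// mulN1r.
    + have t0' : 0 < t^-1 by rewrite invr_gt0.
      have := a1 _ (GZ t^-1 _ Gx).
      have := pZ (ltW t0') Dxt.
      rewrite /= scalerDr scalerA -crealM mulVf ?gt_eqF//.
      rewrite creal1 scale1r => h1 h2; have := le_trans h2 h1.
      rewrite (_ : _ + a = t^-1 * (x.2 + t * a)); first by rewrite ler_pM2l.
      by rewrite mulrDr [in RHS]mulrA mulVf ?gt_eqF// mul1r.
    + by rewrite creal0 scale0r mul0r !addr0; exact: (Gp _ Gx).2.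
  - move=> t _ _ [x [s [Gx ->]]] [y [r [Gy ->]]] /=.
    exists (rs t x.1 + y.1, t * x.2 + y.2), (t * s + r); split; first exact: Glin.
    congr (_, _) => /=; last by ring.
    by rewrite scalerDr scalerA -crealM crealD scalerDl addrACA.
pose u f := xget 0 [set r | G (f, r)].
have Gu f : D f -> G (f, u f).
  move=> Df; have [r Gr] := Gtot _ Df.
  exact: (@xgetPex _ 0 [set r | G (f, r)] (ex_intro _ r Gr)).
have uE f r : G (f, r) -> u f = r.
  by move=> Gr; apply: (Gfun f) => //; apply: Gu; exact: (Gp _ Gr).1.
have ulin t f g : D f -> D g -> u (rs t f + g) = t * u f + u g.
  by move=> Df Dg; apply: uE; exact: (Glin t _ _ (Gu _ Df) (Gu _ Dg)).
have up f : D f -> u f <= p f by move=> Df; exact: (Gp _ (Gu _ Df)).2.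
have uV v : V v -> u v = 0.
  by move=> Vv; apply: uE; have := G0 v 0 Vv; rewrite creal0 scale0r mul0r addr0.
have uf0 : u f0 = d.
  by apply: uE; have := G0 0 1 V0; rewrite creal1 scale1r mul1r add0r.
have u0 : u 0 = 0 by exact: uV.
have uD f g : D f -> D g -> u (f + g) = u f + u g.
  by move=> Df Dg; have := ulin 1 _ _ Df Dg; rewrite creal1 scale1r mul1r.
have uZ t f : D f -> u (rs t f) = t * u f.
  by move=> Df; have := ulin t _ _ Df D0; rewrite u0 !addr0.
have un f : D f -> `|u f| <= p f.
  move=> Df; rewrite ler_norml up// andbT.
  have := uZ (-1) _ Df; rewrite crealN creal1 scaleN1r mulN1r => h.
  have DN : D (- f) by rewrite -scaleN1r; exact: DZ.
  have := up _ DN; rewrite h; have := pN Df; lra.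
(* The complex functional with real part [u] is f |-> u f - i u (i f). *)
pose I : R[i] := Complex 0 1.
exists (fun f => Complex (u f) (- u (I *: f))); split.
- move=> a f g Df Dg.
  have aE : a = creal (cRe a) + creal (cIm a) * I.
    by apply: complex_ext; rewrite ?cReD ?cImD ?cReMr ?cImMr /= ?mulr0 ?mulr1 ?addr0 ?add0r.
  have II : I * I = - creal 1 by apply: complex_ext; rewrite ?cReM ?cImM ?cReN ?cImN /=; lra.
  have e1 : a *: f + g = rs (cRe a) f + (rs (cIm a) (I *: f) + g).
    by rewrite [in LHS]aE scalerDl -scalerA addrA.
  have e2 : I *: (a *: f + g) = rs (cRe a) (I *: f) + (rs (- cIm a) f + I *: g).
    rewrite e1 !scalerDr !scalerA; congr (_ *: _ + (_ *: _ + _)); first exact: mulrC.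
    by rewrite mulrCA II mulrN -crealM mulr1 crealN.
  rewrite e2 e1 !ulin//; try by repeat (apply: DD || apply: DZ || assumption).
  apply: complex_ext; rewrite ?cReD ?cImD ?cReM ?cImM /=; ring.
- move=> f Df; apply: le_trans (cnorm_le _) _ => /=.
  rewrite normrN mulr2n mulrDl mul1r lerD// ?un//.
  apply: le_trans (un _ (DZ _ Df)) _.
  have := plin I Df D0; rewrite !addr0 p0 addr0 => /le_trans; apply.
  by rewrite /cnorm /= expr0n expr1n /= add0r sqrtr1 mul1r.
- by move=> v Vv; rewrite uV// uV ?oppr0//; exact: VZ.
- by apply/eqP => /(congr1 (@cRe R)) /=; rewrite uf0 => d00; move: d0; rewrite d00 ltxx.
Qed.

End hahn_banach.

(** * Complex integrals and Banach function spaces *)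

Section lebesgue_real.
Context {R : realType}.
Local Notation mu := (@lebesgue_measure R).

Lemma aeS (P Q : R -> Prop) : (forall x, P x -> Q x) ->
  {ae mu, forall x, P x} -> {ae mu, forall x, Q x}.
Proof. by move=> PQ; exact: (@filterS _ _ (ae_filter_ringOfSetsType mu) P Q PQ). Qed.

Lemma aeS2 (P Q S : R -> Prop) : (forall x, P x -> Q x -> S x) ->
  {ae mu, forall x, P x} -> {ae mu, forall x, Q x} -> {ae mu, forall x, S x}.
Proof. move=> PQS hP hQ.
exact: (@filterS2 _ _ (ae_filter_ringOfSetsType mu) P Q S PQS hP hQ). Qed.

Lemma integrable_lin (E : set R) (a b : R) (f g : R -> R) : measurable E ->
  mu.-integrable E (EFin \o f) -> mu.-integrable E (EFin \o g) ->
  mu.-integrable E (EFin \o (fun x => a * f x + b * g x)).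
Proof.
move=> mE fi gi.
exact: (integrableD (mu := mu) mE (integrableZl (mu := mu) mE a fi)
  (integrableZl (mu := mu) mE b gi)).
Qed.

Lemma Rintegral_lin (E : set R) (a b : R) (f g : R -> R) : measurable E ->
  mu.-integrable E (EFin \o f) -> mu.-integrable E (EFin \o g) ->
  Rintegral mu E (fun x => a * f x + b * g x) =
  a * Rintegral mu E f + b * Rintegral mu E g.
Proof.
move=> mE fi gi; rewrite -!RintegralZl//.
exact: (@RintegralD _ _ _ mu E (fun x => a * f x) (fun x => b * g x) mE
  (integrableZl (mu := mu) mE a fi)
  (integrableZl (mu := mu) mE b gi)).
Qed.

Lemma integrable_le (E : set R) (f g : R -> R) : measurable E ->
  measurable_fun setT f -> mu.-integrable E (EFin \o g) ->
  (forall x, E x -> `|f x| <= g x) -> mu.-integrable E (EFin \o f).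
Proof.
move=> mE mf gi fg; apply: le_integrable gi => //.
  by apply/measurable_EFinP; exact: measurable_funTS.
move=> x Ex /=; rewrite lee_fin; apply: le_trans (fg _ Ex) _; exact: ler_norm.
Qed.

End lebesgue_real.

Section cmeasurable_theory.
Context {R : realType}.
Local Notation C := (R[i]).

Lemma continuous_measurable (f : R -> R) : continuous f -> measurable_fun setT f.
Proof. by move=> /continuous_measurable_fun. Qed.

Lemma cmeasurable_lin (al : C) (f g : R -> C) :
  cmeasurable f -> cmeasurable g -> cmeasurable (fun x => al * f x + g x).
Proof.
move=> [fr fi] [gr gi]; split.
  rewrite (_ : _ \o _ = (fun x => (cRe al * (cRe \o f) x - cIm al * (cIm \o f) x)
    + (cRe \o g) x)); last by apply/funext => x /=; rewrite cReD cReM.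
  by apply: measurable_funD => //; apply: measurable_funB; apply: measurable_funM.
rewrite (_ : _ \o _ = (fun x => (cRe al * (cIm \o f) x + cIm al * (cRe \o f) x)
    + (cIm \o g) x)); last by apply/funext => x /=; rewrite cImD cImM.
by apply: measurable_funD => //; apply: measurable_funD; apply: measurable_funM.
Qed.

Lemma cmeasurableM (f g : R -> C) :
  cmeasurable f -> cmeasurable g -> cmeasurable (fun x => f x * g x).
Proof.
move=> [fr fi] [gr gi]; split.
  rewrite (_ : _ \o _ = (fun x => (cRe \o f) x * (cRe \o g) x
    - (cIm \o f) x * (cIm \o g) x)); last by apply/funext => x /=; rewrite cReM.
  by apply: measurable_funB; apply: measurable_funM.
rewrite (_ : _ \o _ = (fun x => (cRe \o f) x * (cIm \o g) x
    + (cIm \o f) x * (cRe \o g) x)); last by apply/funext => x /=; rewrite cImM.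
by apply: measurable_funD; apply: measurable_funM.
Qed.

Lemma cmeasurable_cst (z : C) : cmeasurable (fun=> z).
Proof. by split; exact: measurable_cst. Qed.

Lemma cmeasurable_creal (f : R -> R) : measurable_fun setT f ->
  cmeasurable (fun x => creal (f x)).
Proof. by move=> mf; split => //; exact: measurable_cst. Qed.

Lemma cmeasurableB (f g : R -> C) :
  cmeasurable f -> cmeasurable g -> cmeasurable (fun x => f x - g x).
Proof.
move=> mf mg; rewrite (_ : (fun _ => _) = fun x => (-1) * g x + f x).
  exact: cmeasurable_lin.
by apply/funext => x; rewrite mulN1r addrC.
Qed.

Lemma nonneg_mfun_cnorm (f : R -> C) : cmeasurable f -> nonneg_mfun (cnorm \o f).
Proof.
move=> [fr fi]; split; last by move=> x; exact: cnorm_ge0.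
rewrite (_ : _ \o _ = @Num.sqrt R \o (fun x => (cRe \o f) x ^+ 2 + (cIm \o f) x ^+ 2)) //.
apply: measurableT_comp.
  by apply: continuous_measurable => x; exact: sqrt_continuous.
by apply: measurable_funD; apply: measurable_funX.
Qed.

End cmeasurable_theory.

Section complex_integral.
Context {R : realType}.
Local Notation C := (R[i]).
Local Notation mu := (@lebesgue_measure R).
Implicit Types (E F : set R) (f g : R -> C).

Definition cintegrable E f := mu.-integrable E (EFin \o (cRe \o f)) /\
  mu.-integrable E (EFin \o (cIm \o f)).

Lemma cintegrable_le E f (g : R -> R) : measurable E -> cmeasurable f ->
  mu.-integrable E (EFin \o g) -> (forall x, E x -> cnorm (f x) <= g x) ->
  cintegrable E f.
Proof.
move=> mE [fr fi] gi fg; split.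
  refine (integrable_le mE fr gi _) => x Ex.
  exact: le_trans (normr_cRe _) (fg _ Ex).
refine (integrable_le mE fi gi _) => x Ex.
exact: le_trans (normr_cIm _) (fg _ Ex).
Qed.

Lemma cint_linear E (al : C) f g : measurable E ->
  cintegrable E f -> cintegrable E g ->
  cint E (fun x => al * f x + g x) = al * cint E f + cint E g.
Proof.
move=> mE [fr fi] [gr gi]; apply: complex_ext.
  rewrite cReD cReM; transitivity (Rintegral mu E (fun x =>
    1 * (cRe al * (cRe \o f) x + - cIm al * (cIm \o f) x) + 1 * (cRe \o g) x)).
    by apply: eq_Rintegral => x _ /=; rewrite cReD cReM !mul1r mulNr.
  rewrite (Rintegral_lin 1 1 mE (integrable_lin _ _ mE fr fi) gr).
  by rewrite (Rintegral_lin _ _ mE fr fi) !mul1r mulNr.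
rewrite cImD cImM; transitivity (Rintegral mu E (fun x =>
  1 * (cRe al * (cIm \o f) x + cIm al * (cRe \o f) x) + 1 * (cIm \o g) x)).
  by apply: eq_Rintegral => x _ /=; rewrite cImD cImM !mul1r.
rewrite (Rintegral_lin 1 1 mE (integrable_lin _ _ mE fi fr) gi).
by rewrite (Rintegral_lin _ _ mE fi fr) !mul1r.
Qed.

Lemma cintegrable0 E : measurable E -> cintegrable E (fun=> 0).
Proof. by move=> mE; split; exact: (integrable0 mu). Qed.

Lemma cint0 E : cint E (fun=> 0) = 0 :> C.
Proof. by apply: complex_ext; rewrite /= /Rintegral integral0. Qed.

Lemma cintZ E (al : C) f : measurable E -> cintegrable E f ->
  cint E (fun x => al * f x) = al * cint E f.
Proof.
move=> mE fi; have := cint_linear al mE fi (cintegrable0 mE).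
rewrite cint0 addr0 => <-; congr cint.
by apply/funext => x; rewrite addr0.
Qed.

Lemma cintB E f g : measurable E -> cintegrable E f -> cintegrable E g ->
  cint E (fun x => f x - g x) = cint E f - cint E g.
Proof.
move=> mE fi gi; have := cint_linear (-1) mE gi fi.
rewrite mulN1r addrC => <-; congr cint.
by apply/funext => x; rewrite mulN1r addrC.
Qed.

Lemma eq_cint E f g : (forall x, E x -> f x = g x) -> cint E f = cint E g.
Proof.
by move=> fg; congr Complex; apply: eq_Rintegral => x /[!inE] Ex /=; rewrite fg.
Qed.

Lemma cint_support E F f : E `<=` F -> (forall x, F x -> ~ E x -> f x = 0) ->
  cint F f = cint E f.
Proof.
have h (g : R -> R) : E `<=` F -> (forall x, F x -> ~ E x -> g x = 0) ->
    Rintegral mu F g = Rintegral mu E g.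
  move=> EF g0; rewrite Rintegral_mkcond [RHS]Rintegral_mkcond.
  apply: eq_Rintegral => x _; rewrite !patchE.
  have [Ex|nEx] := pselect (E x); first by rewrite !mem_set//; exact: EF.
  rewrite (memNset nEx); have [Fx|nFx] := pselect (F x); last by rewrite memNset.
  by rewrite mem_set// g0.
move=> EF f0; congr Complex; apply: h => // x Fx nEx /=; by rewrite f0.
Qed.

(** The factor 2 arises from estimating real and imaginary parts separately; it is the source of
    most factors 2 in the operator bounds below. *)
Lemma cnorm_cint_le E f : measurable E -> cmeasurable f ->
  mu.-integrable E (EFin \o (cnorm \o f)) ->
  cnorm (cint E f) <= 2 * Rintegral mu E (cnorm \o f).
Proof.
move=> mE mf fi; have [ir ii] := cintegrable_le mE mf fi (fun x _ => lexx _).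
apply: le_trans (cnorm_le _) _; rewrite mulr2n mulrDl mul1r /=.
apply: lerD; apply: le_trans (le_normr_Rintegral _ _) _ => //.
  apply: le_Rintegral => //; first exact: integrable_norm ir.
  by move=> x _; exact: normr_cRe.
apply: le_Rintegral => //; first exact: integrable_norm ii.
by move=> x _; exact: normr_cIm.
Qed.

End complex_integral.

Section banach_function_space.
Context {R : realType} (rho : (R -> R) -> \bar R).
Hypothesis rhoP : banach_function_norm rho.
Local Notation C := (R[i]).
Local Notation mu := (@lebesgue_measure R).
Local Notation inX := (inX rho).
Local Notation Xnorm := (Xnorm rho).
Local Notation ae_eq := (@Defs.ae_eq R).

Lemma rho_ge0 f : nonneg_mfun f -> (0 <= rho f)%E.
Proof. by case: rhoP => + _; apply. Qed.

Lemma rho_le f g : nonneg_mfun f -> nonneg_mfun g ->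
  {ae mu, forall x, g x <= f x} -> (rho g <= rho f)%E.
Proof. by case: rhoP => _ [_ [_ [_ [+ _]]]]; apply. Qed.

Lemma rhoZ (l : R) f : nonneg_mfun f -> 0 <= l ->
  rho (fun x => l * f x) = (l%:E * rho f)%E.
Proof. by case: rhoP => _ [_ [+ _]] => h nf l0; exact: h. Qed.

Lemma rhoD f g : nonneg_mfun f -> nonneg_mfun g ->
  (rho (fun x => f x + g x)%R <= rho f + rho g)%E.
Proof. by case: rhoP => _ [_ [_ [+ _]]] => h nf ng; exact: h. Qed.

Lemma rho_ae0 f : nonneg_mfun f -> {ae mu, forall x, f x = 0} -> rho f = 0%E.
Proof. by case: rhoP => _ [+ _] => h nf f0; apply/(h _ nf). Qed.

Lemma nonneg_mfunZ (l : R) f : nonneg_mfun f -> 0 <= l ->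
  nonneg_mfun (fun x => l * f x).
Proof.
move=> [mf f0] l0; split; last by move=> x; rewrite mulr_ge0.
by apply: measurable_funM => //; exact: measurable_cst.
Qed.

Lemma Xnorm_ge0 f : cmeasurable f -> 0 <= Xnorm f.
Proof. by move=> mf; rewrite fine_ge0// rho_ge0//; exact: nonneg_mfun_cnorm. Qed.

Lemma XnormK f : inX f -> (Xnorm f)%:E = rho (cnorm \o f).
Proof.
move=> [mf ff]; rewrite fineK// ge0_fin_numE//.
by apply: rho_ge0; exact: nonneg_mfun_cnorm.
Qed.

Lemma inX_dominated f h : cmeasurable f -> nonneg_mfun h -> (rho h < +oo)%E ->
  {ae mu, forall x, cnorm (f x) <= h x} -> inX f /\ Xnorm f <= fine (rho h).
Proof.
move=> mf nh hfin fh.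
have le : (rho (cnorm \o f) <= rho h)%E.
  by apply: rho_le => //; exact: nonneg_mfun_cnorm.
have fX : inX f by split => //; exact: le_lt_trans hfin.
split => //; rewrite -lee_fin XnormK// fineK// ge0_fin_numE//.
exact: rho_ge0.
Qed.

Lemma inX_le (c : R) f g : cmeasurable f -> inX g -> 0 <= c ->
  {ae mu, forall x, cnorm (f x) <= c * cnorm (g x)} ->
  inX f /\ Xnorm f <= c * Xnorm g.
Proof.
move=> mf [mg gfin] c0 fg.
have hfin : (rho (fun x => (c * cnorm (g x))%R) < +oo)%E.
  rewrite (@rhoZ c (cnorm \o g))//; last exact: nonneg_mfun_cnorm.
  by apply: lte_mul_pinfty => //; exact: rho_ge0 (nonneg_mfun_cnorm mg).
have [fX fle] := inX_dominated mf (nonneg_mfunZ (nonneg_mfun_cnorm mg) c0) hfin fg.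
split => //; apply: le_trans fle _.
rewrite (@rhoZ c (cnorm \o g))//; last exact: nonneg_mfun_cnorm.
by rewrite -XnormK// -EFinM.
Qed.

Lemma inX_ae_eq f g : cmeasurable f -> inX g -> ae_eq f g ->
  inX f /\ Xnorm f = Xnorm g.
Proof.
move=> mf gX fg.
have [fX fle] : inX f /\ Xnorm f <= 1 * Xnorm g.
  by apply: inX_le => //; move: fg; apply: aeS => x ->; rewrite mul1r.
have [_ gle] : inX g /\ Xnorm g <= 1 * Xnorm f.
  apply: inX_le => //; first by case: gX.
  by move: fg; apply: aeS => x ->; rewrite mul1r.
by split => //; apply/eqP; rewrite eq_le; move: fle gle; rewrite !mul1r => -> ->.
Qed.

Lemma inX_lin (al : C) f g : inX f -> inX g ->
  inX (fun x => al * f x + g x) /\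
  Xnorm (fun x => al * f x + g x) <= cnorm al * Xnorm f + Xnorm g.
Proof.
move=> fX gX; have [mf ff] := fX; have [mg gf] := gX.
have nf := nonneg_mfunZ (nonneg_mfun_cnorm mf) (cnorm_ge0 al).
have ng := nonneg_mfun_cnorm mg.
pose h x := cnorm al * (cnorm \o f) x + (cnorm \o g) x.
have nh : nonneg_mfun h.
  split; last by move=> x; rewrite addr_ge0 ?mulr_ge0 ?cnorm_ge0.
  by apply: measurable_funD; [case: nf|case: ng].
have rhoh : (rho h <= (cnorm al * Xnorm f + Xnorm g)%:E)%E.
  apply: le_trans (rhoD nf ng) _.
  by rewrite rhoZ ?cnorm_ge0//; [rewrite -!XnormK|exact: nonneg_mfun_cnorm].
have hfin : (rho h < +oo)%E by apply: le_lt_trans rhoh _; rewrite ltry.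
have [||X le] := @inX_dominated (fun x => al * f x + g x) h _ nh hfin.
- exact: cmeasurable_lin.
- by apply: aeW => x; rewrite /h /= -cnormM; exact: cnormD.
- split => //; apply: le_trans le _; rewrite -lee_fin fineK//.
  by rewrite ge0_fin_numE// rho_ge0.
Qed.

Lemma inX0 : inX (fun=> 0) /\ Xnorm (fun=> 0) = 0.
Proof.
have m0 : cmeasurable (fun=> 0 : C) by exact: cmeasurable_cst.
have r0 : rho (cnorm \o (fun=> 0 : C)) = 0%E.
  apply: rho_ae0; first exact: nonneg_mfun_cnorm.
  by apply: aeW => x /=; rewrite cnorm0.
by split; [split => //; rewrite r0|rewrite /Defs.Xnorm r0].
Qed.

Lemma inXZ (al : C) f : inX f ->
  inX (fun x => al * f x) /\ Xnorm (fun x => al * f x) <= cnorm al * Xnorm f.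
Proof.
move=> fX; have [zX z0] := inX0.
have := inX_lin al fX zX; rewrite z0 addr0.
by rewrite (_ : (fun x => _ + 0) = fun x => al * f x)//; apply/funext => x; rewrite addr0.
Qed.

Lemma inXD f g : inX f -> inX g ->
  inX (fun x => f x + g x) /\ Xnorm (fun x => f x + g x) <= Xnorm f + Xnorm g.
Proof.
move=> fX gX; have := inX_lin 1 fX gX; rewrite -creal1 cnorm_creal normr1 mul1r.
rewrite (_ : (fun x => _ * _ + _) = fun x => f x + g x)//.
by apply/funext => x; rewrite creal1 mul1r.
Qed.

Lemma inXB f g : inX f -> inX g ->
  inX (fun x => f x - g x) /\ Xnorm (fun x => f x - g x) <= Xnorm f + Xnorm g.
Proof.
move=> fX gX; have := inX_lin (-1) gX fX.
rewrite -creal1 -crealN cnorm_creal normrN normr1 mul1r [X in _ <= X]addrC.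
rewrite (_ : (fun x => _ * _ + _) = fun x => f x - g x)//.
by apply/funext => x; rewrite crealN creal1 mulN1r addrC.
Qed.

Lemma XnormBC f g : Xnorm (fun x => f x - g x) = Xnorm (fun x => g x - f x).
Proof.
by rewrite /Defs.Xnorm; congr (fine (rho _)); apply/funext => x /=; rewrite cnormB.
Qed.

Lemma Xnorm_triangle f g h : inX f -> inX g -> inX h ->
  Xnorm (fun x => f x - h x) <= Xnorm (fun x => f x - g x) + Xnorm (fun x => g x - h x).
Proof.
move=> fX gX hX; have [_] := inXD (inXB fX gX).1 (inXB gX hX).1.
rewrite (_ : (fun x => _ + _) = fun x => f x - h x)//.
by apply/funext => x; rewrite addrA subrK.
Qed.

Lemma inX_sum (I : Type) (s : seq I) (F : I -> R -> C) :
  (forall i, inX (F i)) -> inX (fun x => \sum_(i <- s) F i x).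
Proof.
move=> FX; elim: s => [|i s ih].
  rewrite (_ : (fun _ => _) = fun=> 0); first by case: inX0.
  by apply/funext => x; rewrite big_nil.
rewrite (_ : (fun _ => _) = fun x => F i x + \sum_(i <- s) F i x).
  by case: (inXD (FX i) ih).
by apply/funext => x; rewrite big_cons.
Qed.

Lemma inX_indic (E : set R) : measurable E -> (mu E < +oo)%E ->
  inX (fun x => creal (\1_E x)).
Proof.
move=> mE Efin.
have mE1 : measurable_fun setT (\1_E : R -> R) by exact: measurable_indic.
have nE : nonneg_mfun (\1_E : R -> R) by split => // x; rewrite indicE ler0n.
have [] // := @inX_dominated (fun x => creal (\1_E x)) (\1_E) _ nE.
- exact: cmeasurable_creal.
- by case: rhoP => _ [_ [_ [_ [_ [_ [+ _]]]]]]; apply.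
- by apply: aeW => x; rewrite cnorm_creal indicE ger0_norm ?ler0n.
Qed.

Lemma inX_integral_le (E : set R) : measurable E -> (mu E < +oo)%E ->
  exists2 c : R, 0 <= c & forall f, inX f ->
    (\int[mu]_(x in E) (cnorm (f x))%:E <= (c * Xnorm f)%:E)%E.
Proof.
move=> mE Efin; case: rhoP => _ [_ [_ [_ [_ [_ [_ h]]]]]].
have [c cP] := h _ mE Efin; exists `|c| => // f fX; have [mf _] := fX.
apply: le_trans (cP _ (nonneg_mfun_cnorm mf)) _.
rewrite -XnormK// -EFinM lee_fin ler_wpM2r ?ler_norm//.
exact: Xnorm_ge0.
Qed.

Lemma inX_integrable (E : set R) f : measurable E -> (mu E < +oo)%E -> inX f ->
  [/\ mu.-integrable E (EFin \o (cRe \o f)), mu.-integrable E (EFin \o (cIm \o f))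
    & mu.-integrable E (EFin \o (cnorm \o f))].
Proof.
move=> mE Efin fX; have [c c0 /(_ _ fX) cP] := inX_integral_le mE Efin.
have [mf _] := fX; have [mr mi] := mf; have [mn _] := nonneg_mfun_cnorm mf.
have ifn : mu.-integrable E (EFin \o (cnorm \o f)).
  apply/integrableP; split; first by apply/measurable_EFinP; exact: measurable_funTS.
  under eq_integral => x _ do rewrite /= ger0_norm ?cnorm_ge0//.
  by apply: le_lt_trans cP _; rewrite ltry.
split => //.
  by refine (integrable_le mE _ ifn _) => // x _; exact: normr_cRe.
by refine (integrable_le mE _ ifn _) => // x _; exact: normr_cIm.
Qed.

Lemma inX_Rintegral_le (E : set R) : measurable E -> (mu E < +oo)%E ->
  exists2 c : R, 0 <= c & forall f, inX f ->
    Rintegral mu E (cnorm \o f) <= c * Xnorm f.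
Proof.
move=> mE Efin; have [c c0 cP] := inX_integral_le mE Efin; exists c => // f fX.
have [_ _ fi] := inX_integrable mE Efin fX.
by rewrite -lee_fin fineK; [exact: cP|exact: integrable_fin_num].
Qed.

Lemma cint_lin (E : set R) (al : C) f g : measurable E -> (mu E < +oo)%E ->
  inX f -> inX g ->
  cint E (fun x => al * f x + g x) = al * cint E f + cint E g.
Proof.
move=> mE Efin fX gX; apply: cint_linear => //.
  by have [fr fi _] := inX_integrable mE Efin fX.
by have [gr gi _] := inX_integrable mE Efin gX.
Qed.

Lemma dual_cint (E : set R) : measurable E -> (mu E < +oo)%E ->
  dual_elt rho (cint E).
Proof.
move=> mE Efin; split; first by move=> *; exact: cint_lin.
have [c c0 cP] := inX_Rintegral_le mE Efin.
exists (2 * c) => f fX; have [_ _ fi] := inX_integrable mE Efin fX.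
have [mf _] := fX.
by rewrite -mulrA; apply: le_trans (cnorm_cint_le mE mf fi) _; rewrite ler_pM2l ?cP.
Qed.

End banach_function_space.

Lemma divr2_gt0 (R : realFieldType) (e : R) : 0 < e -> 0 < e / 2.
Proof. by move=> e0; rewrite divr_gt0. Qed.

(** * Strong convergence in reflexive spaces *)

Section ultralimit.
Context {R : realType} (U : set_system nat) (UU : UltraFilter U).
Local Notation C := (R[i]).

Lemma ultra_fmap (T : Type) (f : nat -> T) : UltraFilter (f @ U).
Proof.
split; first exact: fmap_proper_filter.
move=> G PG fUG; apply/seteqP; split => // A GA.
have [//|nA] := in_ultra_setVsetC (f @^-1` A) UU.
have GnA : G (~` A) by apply: fUG.
have : G (A `&` ~` A) by exact: filterI.
by rewrite setICr => /filter_not_empty.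
Qed.

(** The image ultrafilter lives on the compact segment from [- B] to [B], hence converges. *)
Lemma bounded_ultra_cvg (u : nat -> R) (B : R) : (forall n, `|u n| <= B) ->
  cvg (u @ U).
Proof.
move=> uB; have Uu := ultra_fmap u.
have cS := @segment_compact R (- B) B.
rewrite compact_ultra in cS.
have /(_ _)[|l [_ ul]] := cS _ Uu.
  have PU := @ultra_proper _ _ UU.
  rewrite /= (_ : _ @^-1` _ = setT); first exact: filterT.
  by apply/seteqP; split => // n _ /=; rewrite in_itv /= -ler_norml.
by apply: cvgP ul.
Qed.

(** One ultrafilter serves all bounded sequences at once and the limit is linear in the sequence, so
    that psi |-> lim psi (P n f) is an element of the bidual. *)
Definition ultralim (u : nat -> C) : C :=
  Complex (lim ((cRe \o u) @ U)) (lim ((cIm \o u) @ U)).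

Lemma bounded_ultralim (u : nat -> C) (B : R) : (forall n, cnorm (u n) <= B) ->
  (cRe \o u) @ U --> cRe (ultralim u) /\ (cIm \o u) @ U --> cIm (ultralim u).
Proof.
move=> uB; split; apply: (@bounded_ultra_cvg _ B) => n.
  by apply: le_trans (normr_cRe _) (uB n).
by apply: le_trans (normr_cIm _) (uB n).
Qed.

Lemma ultralimP (u : nat -> C) l : (cRe \o u) @ U --> cRe l ->
  (cIm \o u) @ U --> cIm l -> ultralim u = l.
Proof.
by move=> h1 h2; apply: complex_ext; apply: (@cvg_lim R^o) => //; exact: norm_hausdorff.
Qed.

Lemma ultralim_lin (u v : nat -> C) (B B' : R) (al : C) :
  (forall n, cnorm (u n) <= B) -> (forall n, cnorm (v n) <= B') ->
  ultralim (fun n => al * u n + v n) = al * ultralim u + ultralim v.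
Proof.
move=> /bounded_ultralim[ur ui] /bounded_ultralim[vr vi]; apply: ultralimP.
  rewrite cReD cReM (_ : _ \o _ = (fun n => cRe al * (cRe \o u) n
    - cIm al * (cIm \o u) n + (cRe \o v) n)); last first.
    by apply/funext => n /=; rewrite cReD cReM.
  by apply: cvgD => //; apply: cvgB; apply: cvgM => //; exact: cvg_cst.
rewrite cImD cImM (_ : _ \o _ = (fun n => cRe al * (cIm \o u) n
    + cIm al * (cRe \o u) n + (cIm \o v) n)); last first.
  by apply/funext => n /=; rewrite cImD cImM.
by apply: cvgD => //; apply: cvgD; apply: cvgM => //; exact: cvg_cst.
Qed.

Lemma ultralim_le (u : nat -> C) (B : R) : (forall n, cnorm (u n) <= B) ->
  cnorm (ultralim u) <= 2 * B.
Proof.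
move=> uB; have [ur ui] := bounded_ultralim uB.
have cl (w : nat -> R) l : w @ U --> l -> (forall n, `|w n| <= B) -> `|l| <= B.
  move=> wl wB; have PU := @ultra_proper _ _ UU.
  rewrite ler_norml; apply/andP; split.
    by apply: (cvgr_to_ge wl); apply: nearW => n; have := wB n; rewrite ler_norml => /andP[].
  by apply: (cvgr_to_le wl); apply: nearW => n; have := wB n; rewrite ler_norml => /andP[].
apply: le_trans (cnorm_le _) _; rewrite mulr2n mulrDl mul1r; apply: lerD.
  by apply: cl ur _ => n; apply: le_trans (normr_cRe _) (uB n).
by apply: cl ui _ => n; apply: le_trans (normr_cIm _) (uB n).
Qed.

Lemma ultralim_cvg (u : nat -> C) l : \oo `<=` U ->
  (forall e, 0 < e -> exists N, forall n, (N <= n)%N -> cnorm (u n - l) <= e) ->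
  ultralim u = l.
Proof.
move=> ooU ul; apply: ultralimP; apply/cvgrPdist_le => e /ul[N NP]; apply: ooU;
  exists N => // n /= /NP; apply: le_trans.
  by rewrite cnormB; have := normr_cRe (l - u n); rewrite cReD cReN.
by rewrite cnormB; have := normr_cIm (l - u n); rewrite cImD cImN.
Qed.

End ultralimit.

(** * The dual space and its norm *)

Section dual.
Context {R : realType} (rho : (R -> R) -> \bar R).
Hypothesis rhoP : banach_function_norm rho.
Local Notation C := (R[i]).
Local Notation inX := (inX rho).
Local Notation Xnorm := (Xnorm rho).
Local Notation ae_eq := (@Defs.ae_eq R).
Local Notation dual := (dual_elt rho).

(** Functionals act on functions, not on classes; they respect equality almost everywhere because
    they are bounded by a seminorm that vanishes on null functions. *)
Lemma dual_ae_eq phi f g : dual phi -> inX f -> inX g -> ae_eq f g ->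
  phi f = phi g.
Proof.
move=> [lin [c cP]] fX gX fg; apply/eqP; rewrite -subr_eq0; apply/eqP.
have [dX _] := inX_lin rhoP (-1) gX fX; have := cP _ dX.
have [|_ ->] := inX_ae_eq rhoP (g := fun=> 0) dX.1 (inX0 rhoP).1.
  by move: fg; apply: aeS => x ->; rewrite mulN1r addNr.
rewrite (inX0 rhoP).2 mulr0 lin// mulN1r addrC => h.
by apply: cnorm0_eq0; apply/eqP; rewrite eq_le h cnorm_ge0.
Qed.

Lemma dual0 phi : dual phi -> phi (fun=> 0) = 0.
Proof.
move=> [lin _]; have [zX _] := inX0 rhoP; have h := lin (-1) _ _ zX zX.
rewrite [_ * phi _]mulN1r addNr in h; rewrite -[RHS]h; congr phi.
by apply/funext => x; rewrite mulr0 addr0.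
Qed.

Lemma dualZ phi al f : dual phi -> inX f -> phi (fun x => al * f x) = al * phi f.
Proof.
move=> dphi fX; have := dphi.1 al _ _ fX (inX0 rhoP).1; rewrite dual0// addr0 => <-.
by congr phi; apply/funext => x; rewrite addr0.
Qed.

Lemma dualB phi f g : dual phi -> inX f -> inX g ->
  phi (fun x => f x - g x) = phi f - phi g.
Proof.
move=> dphi fX gX; have := dphi.1 (-1) _ _ gX fX.
rewrite mulN1r addrC => <-; congr phi.
by apply/funext => x; rewrite mulN1r addrC.
Qed.

Definition dual_norm (phi : (R -> C) -> C) : R :=
  sup [set y | exists2 f, inX f /\ Xnorm f <= 1 & y = cnorm (phi f)].

Let dset_has_sup phi : dual phi ->
  has_sup [set y | exists2 f, inX f /\ Xnorm f <= 1 & y = cnorm (phi f)].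
Proof.
move=> [lin [c cP]]; split.
  by exists (cnorm (phi (fun=> 0))); exists (fun=> 0) => //; rewrite (inX0 rhoP).2; split => //; exact: (inX0 rhoP).1.
exists `|c| => _ [f [fX f1] ->]; apply: le_trans (cP _ fX) _.
have f0 := Xnorm_ge0 rhoP fX.1.
apply: (@le_trans _ _ (`|c| * Xnorm f)); first by rewrite ler_wpM2r// ler_norm.
by rewrite ler_piMr.
Qed.

Lemma dual_norm_ge0 phi : dual phi -> 0 <= dual_norm phi.
Proof.
move=> dphi; have [+ h] := dset_has_sup dphi => -[y [f fP yE]].
apply: (@le_trans _ _ y); first by rewrite yE cnorm_ge0.
by apply: ub_le_sup => //; exists f.
Qed.

Lemma dual_normP phi f : dual phi -> inX f -> cnorm (phi f) <= dual_norm phi * Xnorm f.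
Proof.
move=> dphi fX; have f0 := Xnorm_ge0 rhoP fX.1.
have [f1|f1] := eqVneq (Xnorm f) 0.
  by have [_ [c /(_ _ fX)]] := dphi; rewrite f1 !mulr0.
have fgt : 0 < Xnorm f by rewrite lt_def f1.
have [gX gle] := inXZ rhoP (creal (Xnorm f)^-1) fX.
rewrite -ler_pdivrMr//; apply: ub_le_sup; first exact: (dset_has_sup dphi).2.
exists (fun x => creal (Xnorm f)^-1 * f x).
  split => //; apply: le_trans gle _.
  by rewrite cnorm_creal ger0_norm ?invr_ge0// mulVf.
by rewrite dualZ// cnormM cnorm_creal ger0_norm ?invr_ge0// mulrC.
Qed.

Lemma dual_norm_le phi K : dual phi -> 0 <= K ->
  (forall f, inX f -> cnorm (phi f) <= K * Xnorm f) -> dual_norm phi <= K.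
Proof.
move=> dphi K0 phiK; apply: ge_sup; first exact: (dset_has_sup dphi).1.
by move=> _ [f [fX f1] ->]; apply: le_trans (phiK _ fX) _; rewrite ler_piMr.
Qed.

Lemma dual_lin al phi psi : dual phi -> dual psi ->
  dual (fun f => al * phi f + psi f) /\
  dual_norm (fun f => al * phi f + psi f) <= cnorm al * dual_norm phi + dual_norm psi.
Proof.
move=> dphi dpsi.
have le f : inX f -> cnorm (al * phi f + psi f) <=
    (cnorm al * dual_norm phi + dual_norm psi) * Xnorm f.
  move=> fX; apply: le_trans (cnormD _ _) _; rewrite cnormM mulrDl -mulrA.
  by rewrite lerD ?ler_wpM2l ?cnorm_ge0 ?dual_normP.
have d : dual (fun f => al * phi f + psi f).
  split; last by eexists; exact: le.
  by move=> b f g fX gX; rewrite dphi.1// dpsi.1//; ring.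
by split => //; apply: dual_norm_le => //; rewrite addr_ge0 ?mulr_ge0 ?cnorm_ge0 ?dual_norm_ge0.
Qed.

Lemma dual_cst0 : dual (fun=> 0) /\ dual_norm (fun=> 0) = 0.
Proof.
have d : dual (fun=> 0).
  split; first by move=> *; rewrite mulr0 addr0.
  by exists 0 => f _; rewrite cnorm0 mul0r.
split => //; apply/eqP; rewrite eq_le dual_norm_ge0// andbT.
by apply: dual_norm_le => // f _; rewrite cnorm0 mul0r.
Qed.

End dual.

(** * The approximation principle in X and in its dual *)

Section strong_approximation.
Context {R : realType} (rho : (R -> R) -> \bar R).
Hypothesis rhoP : banach_function_norm rho.
Hypothesis rho_reflexive : reflexive_space rho.
Local Notation C := (R[i]).
Local Notation inX := (inX rho).
Local Notation Xnorm := (Xnorm rho).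
Local Notation ae_eq := (@Defs.ae_eq R).
Local Notation dual := (dual_elt rho).
Local Notation dual_norm := (dual_norm rho).

Variables (P : nat -> op (R := R)) (c : R) (Psi : set ((R -> C) -> C)).
Hypothesis PX : forall n f, inX f -> inX (P n f).
Hypothesis c0 : 0 <= c.
Hypothesis Pc : forall n f, inX f -> Xnorm (P n f) <= c * Xnorm f.
Hypothesis Plin : forall n al f g, inX f -> inX g ->
  P n (fun x => al * f x + g x) = (fun x => al * P n f x + P n g x).
Hypothesis PPl : forall n m f, (n < m)%N -> inX f -> ae_eq (P m (P n f)) (P n f).
Hypothesis PPr : forall n m f, (n < m)%N -> inX f -> ae_eq (P n (P m f)) (P n f).
Hypothesis Psi_dual : Psi `<=` dual.
Hypothesis Psi_sep : forall f g, inX f -> inX g ->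
  (forall psi, Psi psi -> psi f = psi g) -> ae_eq f g.
Hypothesis Psi_cvg : forall psi f, Psi psi -> inX f ->
  forall e, 0 < e -> exists N, forall n, (N <= n)%N -> cnorm (psi (P n f) - psi f) <= e.

Let PB n f g : inX f -> inX g ->
  P n (fun x => f x - g x) = (fun x => P n f x - P n g x).
Proof.
move=> fX gX; rewrite (_ : (fun x => _) = fun x => (-1) * g x + f x); last first.
  by apply/funext => x; rewrite mulN1r addrC.
by rewrite Plin//; apply/funext => x; rewrite mulN1r addrC.
Qed.

(** The subspace of strong convergence. It is closed and contains the ranges of all [P n], which
    reduces convergence everywhere to a density question. *)
Let V : set (R -> C) := [set f | inX f /\ forall e, 0 < e -> exists N,
  forall n, (N <= n)%N -> Xnorm (fun x => P n f x - f x) <= e].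

Let PBX n f : inX f -> inX (fun x => P n f x - f x).
Proof. by move=> fX; case: (inXB rhoP (PX n fX) fX). Qed.

Let V_lin al f g : V f -> V g -> V (fun x => al * f x + g x).
Proof.
move=> [fX fV] [gX gV]; split; first by case: (inX_lin rhoP al fX gX).
move=> e e0.
have a0 : 0 < cnorm al + 1 by rewrite ltr_wpDl ?cnorm_ge0.
have [N1 h1] := fV (e / 2 / (cnorm al + 1)) (divr_gt0 (divr2_gt0 e0) a0).
have [N2 h2] := gV (e / 2) (divr2_gt0 e0).
exists (maxn N1 N2) => n; rewrite geq_max => /andP[/h1 {}h1 /h2 {}h2].
rewrite Plin// (_ : (fun x => _) = (fun x => al * (P n f x - f x) + (P n g x - g x))).
  have [_ /le_trans] := inX_lin rhoP al (PBX n fX) (PBX n gX); apply.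
  rewrite [leRHS](splitr e); apply: lerD => //.
  apply: (@le_trans _ _ ((cnorm al + 1) * Xnorm (fun x => P n f x - f x))).
    by rewrite ler_wpM2r ?lerDl// Xnorm_ge0//; exact: (PBX _ _).1.
  by rewrite mulrC -ler_pdivlMr.
by apply/funext => x; ring.
Qed.

(** The uniform bound gives |P_n f - f| <= (c + 1) |f - v| + |P_n v - v| in norm. *)
Let V_closed f : inX f ->
  (forall d, 0 < d -> exists2 v, V v & Xnorm (fun x => f x - v x) < d) -> V f.
Proof.
move=> fX h; split => // e e0.
have c1 : 0 < c + 1 by rewrite ltr_wpDl.
have [v [vX vV] fv] := h (e / 2 / (c + 1)) (divr_gt0 (divr2_gt0 e0) c1).
have [N NP] := vV (e / 2) (divr2_gt0 e0); exists N => n /NP {}NP.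
have fvX := (inXB rhoP fX vX).1.
apply: le_trans (Xnorm_triangle rhoP (PX n fX) (PX n vX) fX) _.
apply: le_trans (lerD (lexx _) (Xnorm_triangle rhoP (PX n vX) vX fX)) _.
rewrite -PB// (XnormBC _ v f) addrCA addrC [leRHS](splitr e); apply: lerD => //.
rewrite addrC; apply: (@le_trans _ _ ((c + 1) * Xnorm (fun x => f x - v x))).
  by rewrite mulrDl mul1r [leRHS]addrC lerD// Pc.
by rewrite mulrC -ler_pdivlMr// ltW.
Qed.

(** By [PPl] the sequence [P m (P n f)] is stationary from [m = n.+1] on. *)
Let PV n f : inX f -> V (P n f).
Proof.
move=> fX; split; first exact: PX.
move=> e e0; exists n.+1 => m nm; have PnX := PX n fX.
have [|_ ->] := inX_ae_eq rhoP (g := fun=> 0) (PBX m PnX).1 (inX0 rhoP).1.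
  by move: (PPl nm fX); apply: aeS => x ->; rewrite subrr.
by rewrite (inX0 rhoP).2 ltW.
Qed.

Let dual_bound phi f : dual phi -> inX f ->
  forall n, cnorm (phi (P n f)) <= dual_norm phi * (c * Xnorm f).
Proof.
move=> dphi fX n; apply: le_trans (dual_normP rhoP dphi (PX n fX)) _.
by rewrite ler_wpM2l ?Pc// dual_norm_ge0.
Qed.

(* A weak limit of [P n f] along an ultrafilter is an element of the bidual,
   hence is represented in X, and the functionals [Psi] identify it with [f]. *)
Let weak_limit phi f : dual phi -> inX f -> (forall v, V v -> phi v = 0) -> phi f = 0.
Proof.
move=> dphi fX phiV.
have [U [UU ooU]] := @ultraFilterLemma nat \oo _.
pose Phi (psi : (R -> C) -> C) : C := @ultralim R U (fun n => psi (P n f)).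
have bPhi : bidual_elt rho Phi.
  split.
    move=> al psi1 psi2 d1 d2; apply: ultralim_lin (dual_bound d1 fX) (dual_bound d2 fX).
  exists (2 * (c * Xnorm f)) => psi K dpsi K0 psiK.
  rewrite -mulrA [_ * K]mulrC; apply: ultralim_le => n.
  by apply: le_trans (psiK _ (PX n fX)) _; rewrite ler_wpM2l// Pc.
have [f1 [f1X f1P]] := rho_reflexive bPhi.
have f1f : ae_eq f1 f.
  apply: Psi_sep => // psi Ppsi; rewrite -f1P; last exact: Psi_dual.
  by apply: ultralim_cvg => //; exact: Psi_cvg.
rewrite -(dual_ae_eq rhoP dphi f1X fX f1f) -f1P//.
apply: ultralim_cvg => // e e0; exists 0%N => n _.
by rewrite (phiV _ (PV n fX)) subrr cnorm0 ltW.
Qed.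

(** A point at positive distance from [V] would be separated from it by a bounded functional
    vanishing on [V]; [weak_limit] makes that functional vanish at the point as well. *)
Lemma strong_cvg f : inX f -> forall e, 0 < e -> exists N,
  forall n, (N <= n)%N -> Xnorm (fun x => P n f x - f x) <= e.
Proof.
move=> fX; suff [] : V f by [].
apply: V_closed => //; apply: contrapT => nV.
have [d [d0 dV]] : exists d, 0 < d /\ forall v, V v -> d <= Xnorm (fun x => f x - v x).
  apply: contrapT => h; apply: nV => d d0; apply: contrapT => h'.
  apply: h; exists d; split => // v Vv; rewrite leNgt; apply/negP => lt.
  by apply: h'; exists v.
have V0 : V (fun=> 0).
  split; first exact: (inX0 rhoP).1.
  move=> e e0; exists 0%N => n _.
  rewrite (_ : (fun x => _) = fun=> 0); first by rewrite (inX0 rhoP).2 ltW.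
  apply/funext => x; rewrite subr0.
  have zX := (inX0 rhoP).1; have := Plin n (-1) zX zX.
  rewrite (_ : (fun=> _ : C) = fun=> 0); last by apply/funext => y; rewrite mulr0 addr0.
  by move=> /(congr1 (fun h => h x)) ->; rewrite mulN1r addNr.
(* With [C^o] the scalar action on functions is pointwise multiplication, so the linear combinations
   match definitionally. *)
have [] := @hahn_banach_separation R (R -> (C)^o) inX V Xnorm _ _ _ _ V0 _ _ f d fX d0 dV.
- by move=> al g h gX hX; exact: (inX_lin rhoP al gX hX).1.
- by move=> al g h gX hX; exact: (inX_lin rhoP al gX hX).2.
- exact: (inX0 rhoP).2.
- exact: (inX0 rhoP).1.
- by move=> v [].
- by move=> al g h; exact: V_lin.
move=> phi [lin bd phiV /eqP]; apply; apply: weak_limit => //.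
by split; [exact: lin|exists 2; exact: bd].
Qed.

Let dualP phi n : dual phi -> dual (fun f => phi (P n f)).
Proof.
move=> dphi; split.
  by move=> al f g fX gX; rewrite Plin// dphi.1//; exact: PX.
exists (dual_norm phi * c) => f fX; rewrite -mulrA; exact: dual_bound.
Qed.

(** The counterpart of [V] for the adjoints phi |-> phi o P_n in the dual norm. *)
Let W : set ((R -> C) -> C) := [set phi | dual phi /\ forall e, 0 < e -> exists N,
  forall n, (N <= n)%N -> dual_norm (fun f => phi (P n f) - phi f) <= e].

Let dualPB phi n : dual phi -> dual (fun f => phi (P n f) - phi f).
Proof.
move=> dphi; have [] := dual_lin rhoP (-1) dphi (dualP n dphi).
by rewrite (_ : (fun f => _) = fun f => phi (P n f) - phi f)//; apply/funext => f;
  rewrite mulN1r addrC.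
Qed.

Let W_lin al phi psi : W phi -> W psi -> W (fun f => al * phi f + psi f).
Proof.
move=> [dphi phiW] [dpsi psiW]; split; first by case: (dual_lin rhoP al dphi dpsi).
move=> e e0.
have a0 : 0 < cnorm al + 1 by rewrite ltr_wpDl ?cnorm_ge0.
have [N1 h1] := phiW (e / 2 / (cnorm al + 1)) (divr_gt0 (divr2_gt0 e0) a0).
have [N2 h2] := psiW (e / 2) (divr2_gt0 e0).
exists (maxn N1 N2) => n; rewrite geq_max => /andP[/h1 {}h1 /h2 {}h2].
rewrite (_ : (fun f => _) = (fun f => al * (phi (P n f) - phi f) + (psi (P n f) - psi f))).
  have [_ /le_trans] := dual_lin rhoP al (dualPB n dphi) (dualPB n dpsi); apply.
  rewrite [leRHS](splitr e); apply: lerD => //.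
  apply: (@le_trans _ _ ((cnorm al + 1) * dual_norm (fun f => phi (P n f) - phi f))).
    by rewrite ler_wpM2r ?lerDl// dual_norm_ge0//; exact: dualPB.
  by rewrite mulrC -ler_pdivlMr.
by apply/funext => x; ring.
Qed.

Let W_closed phi : dual phi ->
  (forall d, 0 < d -> exists2 v, W v & dual_norm (fun f => phi f - v f) < d) -> W phi.
Proof.
move=> dphi h; split => // e e0.
have c2 : 0 < c + 1 by rewrite ltr_wpDl.
have [v [dv vW] fv] := h (e / 2 / (c + 1)) (divr_gt0 (divr2_gt0 e0) c2).
have [N NP] := vW (e / 2) (divr2_gt0 e0); exists N => n /NP {}NP.
have dd : dual (fun f => phi f - v f).
  have [] := dual_lin rhoP (-1) dv dphi.
  by rewrite (_ : (fun f => _) = fun f => phi f - v f)//; apply/funext => f;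
    rewrite mulN1r addrC.
apply: dual_norm_le => //; [exact: dualPB|exact: ltW|] => f fX.
(* The functional [phi - v] is tested at [P n f] and at [f], which costs [c + 1] times its norm. *)
rewrite (_ : _ - _ = (phi (P n f) - v (P n f)) + (v (P n f) - v f) - (phi f - v f)); last by ring.
apply: le_trans (cnormD _ _) _; rewrite cnormN.
apply: le_trans (lerD (cnormD _ _) (lexx _)) _.
have f0 := Xnorm_ge0 rhoP fX.1.
have h1 := dual_normP rhoP dd (PX n fX).
have h2 := dual_normP rhoP dd fX.
have h3 := dual_normP rhoP (dualPB n dv) fX.
have h4 : dual_norm (fun f => phi f - v f) * Xnorm (P n f) <=
    dual_norm (fun f => phi f - v f) * (c * Xnorm f) by rewrite ler_wpM2l ?Pc// dual_norm_ge0.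
have h5 : dual_norm (fun f => v (P n f) - v f) * Xnorm f <= e / 2 * Xnorm f.
  by rewrite ler_wpM2r.
have h6 : dual_norm (fun f => phi f - v f) * (c + 1) * Xnorm f <= e / 2 * Xnorm f.
  by rewrite ler_wpM2r// -ler_pdivlMr// ltW.
rewrite (splitr e); move: h1 h2 h3 h4 h5 h6 => /=; lra.
Qed.

(** Here the order of composition is reversed, and [PPr] plays the role that [PPl] has for [V]. *)
Let PW phi n : dual phi -> W (fun f => phi (P n f)).
Proof.
move=> dphi; split; first exact: dualP.
move=> e e0; exists n.+1 => m nm.
apply: dual_norm_le => //; [exact: (dualPB m (dualP n dphi))|exact: ltW|] => f fX.
rewrite (dual_ae_eq rhoP dphi _ _ (PPr nm fX)); do ?by do ?apply: PX.
by rewrite subrr cnorm0 mulr_ge0//; [exact: ltW|exact: (Xnorm_ge0 rhoP fX.1)].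
Qed.

(* By reflexivity a functional on the dual vanishing on all [phi \o P n] is
   evaluation at some [f], and then [phi f = lim phi (P n f) = 0]. *)
Lemma dual_strong_cvg phi : dual phi -> forall e, 0 < e -> exists N,
  forall n, (N <= n)%N -> forall f, inX f ->
    cnorm (phi (P n f) - phi f) <= e * Xnorm f.
Proof.
move=> dphi.
suff [_ h] : W phi.
  move=> e /h[N NP]; exists N => n /NP {}NP f fX.
  apply: le_trans (dual_normP rhoP (dualPB n dphi) fX) _.
  by rewrite ler_wpM2r// Xnorm_ge0//; case: fX.
apply: W_closed => //; apply: contrapT => nW.
have [d [d0 dW]] : exists d, 0 < d /\ forall v, W v -> d <= dual_norm (fun f => phi f - v f).
  apply: contrapT => h; apply: nW => d d0; apply: contrapT => h'.
  apply: h; exists d; split => // v Vv; rewrite leNgt; apply/negP => lt.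
  by apply: h'; exists v.
have [dual00 dual_norm00] := dual_cst0 rhoP.
have W0 : W (fun=> 0).
  split => // e e0; exists 0%N => n _; rewrite (_ : (fun f => _) = fun=> 0).
    by rewrite dual_norm00 ltW.
  by apply/funext => f; rewrite subrr.
have [] := @hahn_banach_separation R ((R -> C) -> (C)^o) dual W dual_norm _ _ _ _ W0 _ _ phi d dphi d0 dW.
- by move=> al g h dg dh; exact: (dual_lin rhoP al dg dh).1.
- by move=> al g h dg dh; exact: (dual_lin rhoP al dg dh).2.
- exact: dual_norm00.
- exact: dual00.
- by move=> v [].
- by move=> al g h; exact: W_lin.
move=> Phi [lin bd PhiW /eqP]; apply.
have bPhi : bidual_elt rho Phi.
  split; first by move=> al p q dp dq; exact: lin.
  exists 2 => psi K dpsi K0 psiK; apply: le_trans (bd _ dpsi) _.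
  by rewrite ler_pM2l//; exact: dual_norm_le.
have [f [fX fP]] := rho_reflexive bPhi; rewrite fP//.
apply: cnorm0_eq0; apply/eqP; rewrite eq_le cnorm_ge0 andbT.
apply/ler_addgt0Pl => e e0; rewrite addr0.
have e1 : 0 < e / (dual_norm phi + 1) by rewrite divr_gt0// ltr_wpDl// dual_norm_ge0.
have [N NP] := strong_cvg fX e1.
have phiP0 : phi (P N f) = 0.
  by rewrite -(fP _ (dualP N dphi)); apply: PhiW; exact: PW.
rewrite -cnormN -[- phi f]add0r -phiP0 -(dualB dphi)//; last exact: PX.
apply: le_trans (dual_normP rhoP dphi (PBX N fX)) _.
apply: (@le_trans _ _ ((dual_norm phi + 1) * Xnorm (fun x => P N f x - f x))).
  by rewrite ler_wpM2r ?lerDl// Xnorm_ge0//; exact: (PBX N fX).1.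
by rewrite mulrC -ler_pdivlMr ?NP// ltr_wpDl// dual_norm_ge0.
Qed.

End strong_approximation.

(** * The maximal operator and dyadic averages *)

Section maximal_domination.
Context {R : realType} (rho : (R -> R) -> \bar R).
Hypothesis rhoP : banach_function_norm rho.
Local Notation C := (R[i]).
Local Notation mu := (@lebesgue_measure R).
Local Notation inX := (inX rho).
Local Notation Xnorm := (Xnorm rho).

Lemma maximal_ge (f : R -> C) a b x : a < b -> a <= x <= b ->
  ((b - a)^-1%:E * \int[mu]_(y in `[a, b]) (cnorm (f y))%:E <= maximal f x)%E.
Proof. by move=> ab xab; apply: ereal_sup_ubound; exists (a, b). Qed.

Lemma maximal_ge0 (f : R -> C) x : (0 <= maximal f x)%E.
Proof.
have x01 : x <= x <= x + 1 by rewrite lexx lerDl ler01.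
have x1 : x < x + 1 by rewrite ltrDl.
apply: le_trans (maximal_ge f x1 x01).
apply: mule_ge0; first by rewrite lee_fin invr_ge0 subr_ge0 ltW.
by apply: integral_ge0 => y _; rewrite lee_fin cnorm_ge0.
Qed.

Lemma maximal_integral_le (f : R -> C) (E : set R) a b x : measurable E ->
  cmeasurable f -> a < b -> a <= x <= b -> E `<=` `[a, b] ->
  (maximal f x < +oo)%E ->
  (\int[mu]_(y in E) (cnorm (f y))%:E <= ((b - a) * fine (maximal f x))%:E)%E.
Proof.
move=> mE mf ab xab Eab Mfin.
have Mfn : maximal f x \is a fin_num by rewrite ge0_fin_numE ?maximal_ge0.
have ba : 0 < b - a by rewrite subr_gt0.
apply: (@le_trans _ _ (\int[mu]_(y in `[a, b]) (cnorm (f y))%:E)%E).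
  apply: ge0_subset_integral => //.
    by apply/measurable_EFinP; apply: measurable_funTS; case: (nonneg_mfun_cnorm mf).
  by move=> y _; rewrite lee_fin cnorm_ge0.
rewrite EFinM fineK// -lee_pdivrMl//; exact: maximal_ge.
Qed.

Lemma maximal_avg_le (f : R -> C) (E : set R) a b x : measurable E ->
  cmeasurable f -> a < b -> a <= x <= b -> E `<=` `[a, b] ->
  (maximal f x < +oo)%E ->
  Rintegral mu E (cnorm \o f) <= (b - a) * fine (maximal f x).
Proof.
move=> mE mf ab xab Eab Mfin; have le := maximal_integral_le mE mf ab xab Eab Mfin.
rewrite -lee_fin fineK// ge0_fin_numE; first by apply: le_lt_trans le _; rewrite ltry.
by apply: integral_ge0 => y _; rewrite lee_fin cnorm_ge0.
Qed.

(** The norm inequality for M enters only here: a pointwise bound by M f, wanted only where M f is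
    finite, becomes a bound in X. The absolute value makes the given constant nonnegative. *)
Lemma maximal_dominated : maximal_bounded rho ->
  exists2 c : R, 0 <= c & forall f g (A : R), inX f -> cmeasurable g -> 0 <= A ->
    (forall x, (maximal f x < +oo)%E -> cnorm (g x) <= A * fine (maximal f x)) ->
    inX g /\ Xnorm g <= A * c * Xnorm f.
Proof.
move=> [c cP]; exists `|c| => // f g A fX mg A0 gf.
have [mM [Mfin Mle]] := cP _ fX.
have nM : nonneg_mfun (fun x => fine (maximal f x)).
  split; last by move=> x; rewrite fine_ge0// maximal_ge0.
  by apply: measurableT_comp => //; exact: fine_measurable.
have rM : (rho (fun x => fine (maximal f x)) <= (`|c| * Xnorm f)%:E)%E.
  apply: le_trans Mle _; rewrite -XnormK// -EFinM lee_fin ler_wpM2r ?ler_norm//.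
  exact: (Xnorm_ge0 rhoP fX.1).
have rAM : (rho (fun x => (A * fine (maximal f x))%R) <= (A * (`|c| * Xnorm f))%:E)%E.
  by rewrite (rhoZ rhoP)// EFinM lee_wpmul2l.
have [|gX gle] := inX_dominated rhoP mg (nonneg_mfunZ nM A0) (le_lt_trans rAM (ltry _)).
  by move: Mfin; apply: aeS => x; exact: gf.
split => //; apply: le_trans gle _; rewrite -mulrA -lee_fin fineK//.
rewrite ge0_fin_numE; first by apply: le_lt_trans rAM _; rewrite ltry.
by apply: rho_ge0 => //; exact: nonneg_mfunZ.
Qed.

End maximal_domination.

(** * Dyadic intervals and conditional expectations *)

Section dyadic.
Context {R : realType}.
Local Notation C := (R[i]).
Local Notation mu := (@lebesgue_measure R).
Implicit Types (n m : nat) (k : int) (x y : R).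

Definition dyadic n k : set R := `[k%:~R / 2 ^+ n, (k + 1)%:~R / 2 ^+ n[.
Definition dyadic_index n x : int := Num.floor (x * 2 ^+ n).
Definition window n : set R := `[- 2 ^+ n, 2 ^+ n[.

Let p2 n : 0 < 2 ^+ n :> R. Proof. by rewrite exprn_gt0. Qed.

Lemma dyadicP n k x : dyadic n k x <-> dyadic_index n x = k.
Proof.
rewrite /dyadic /= in_itv /= ler_pdivrMr// ltr_pdivlMr//; split.
  by move=> h; exact: floor_def.
by move=> <-; exact: floor_itv.
Qed.

Lemma dyadic_mem n x : dyadic n (dyadic_index n x) x.
Proof. exact/dyadicP. Qed.

Lemma measurable_dyadic n k : measurable (dyadic n k).
Proof. exact: measurable_itv. Qed.

Lemma dyadic_width n k : (k + 1)%:~R / 2 ^+ n - k%:~R / 2 ^+ n = (2 ^+ n)^-1 :> R.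
Proof. by rewrite -mulrBl rmorphD /= addrAC subrr add0r mul1r. Qed.

Lemma dyadic_lt n k : k%:~R / 2 ^+ n < (k + 1)%:~R / 2 ^+ n :> R.
Proof. by rewrite -subr_gt0 dyadic_width invr_gt0. Qed.

Lemma mu_dyadic n k : mu (dyadic n k) = ((2 ^+ n)^-1)%:E.
Proof.
by rewrite lebesgue_measure_itv /= lte_fin dyadic_lt -EFinB dyadic_width.
Qed.

Lemma mu_dyadic_fin n k : (mu (dyadic n k) < +oo)%E.
Proof. by rewrite mu_dyadic ltry. Qed.

(** Nestedness of the dyadic grids: k <= x 2^n means k 2^d <= x 2^(n+d), and k 2^d is again an
    integer, so the finer index decides the coarser one. *)
Lemma dyadic_index_le n d x y :
  dyadic_index (n + d) x = dyadic_index (n + d) y -> dyadic_index n x = dyadic_index n y.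
Proof.
move=> xy; apply/eqP; rewrite eq_le; apply/andP.
have h z w : dyadic_index (n + d) z = dyadic_index (n + d) w ->
    dyadic_index n z <= dyadic_index n w.
  move=> zw; rewrite /dyadic_index floor_ge_int -(ler_pM2r (p2 d)) -!mulrA -exprD.
  have e2 : 2 ^+ d = (2 ^ d)%N%:Z%:~R :> R by rewrite -natrX.
  rewrite e2 -intrM -floor_ge_int -[X in _ <= X]zw floor_ge_int intrM -e2.
  by rewrite exprD mulrA ler_pM2r// floor_le.
by rewrite !h.
Qed.

(** Scaling the endpoints by 2^n gives the integers -4^n and 4^n, so the window is a union of 2 *
    4^n whole cells. *)
Lemma window_index n x : window n x <->
  - (4 ^ n)%N%:Z <= dyadic_index n x < (4 ^ n)%N%:Z.
Proof.
rewrite /window /= in_itv /= floor_ge_int floor_lt_int rmorphN /=.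
have -> : (4 ^ n)%N%:~R = 2 ^+ n * 2 ^+ n :> R.
  by rewrite -exprMn -natrM -natrX.
by rewrite -mulNr ler_pM2r// ltr_pM2r.
Qed.

Lemma window_dyadic n x y : dyadic_index n x = dyadic_index n y -> window n x -> window n y.
Proof. by rewrite !window_index => ->. Qed.

Lemma window_le n m : (n <= m)%N -> window n `<=` window m.
Proof.
move=> nm x; rewrite /window /= !in_itv /= => /andP[h1 h2].
have le : 2 ^+ n <= 2 ^+ m :> R by rewrite ler_eXn2l ?ltr1n.
by rewrite (le_trans _ h1) ?lerN2// (lt_le_trans h2).
Qed.

Lemma dyadic_window n k : exists m, forall m', (m <= m')%N -> dyadic n k `<=` window m'.
Proof.
have lt2 m : m%:R < 2 ^+ m :> R by rewrite -natrX ltr_nat ltn_expl.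
pose m := Num.bound (`|k%:~R / 2 ^+ n| + `|(k + 1)%:~R / 2 ^+ n| : R).
have mP : `|k%:~R / 2 ^+ n| + `|(k + 1)%:~R / 2 ^+ n| < m%:R :> R.
  by apply: archi_boundP; rewrite addr_ge0.
exists m => m' mm'; apply: subset_trans (window_le mm') => x.
rewrite /dyadic /window /= !in_itv /= => /andP[h1 h2]; apply/andP.
have := ler_norm (- (k%:~R / 2 ^+ n) : R); have := ler_norm ((k + 1)%:~R / 2 ^+ n : R).
have := lt2 m; have := normr_ge0 (k%:~R / 2 ^+ n : R).
have := normr_ge0 ((k + 1)%:~R / 2 ^+ n : R).
rewrite normrN; move: mP h1 h2; lra.
Qed.

Lemma dyadic_split n k :
  dyadic n k = dyadic n.+1 (2 * k) `|` dyadic n.+1 (2 * k + 1).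
Proof.
have e (j : int) : (2 * j)%:~R / 2 ^+ n.+1 = j%:~R / 2 ^+ n :> R.
  by rewrite intrM exprS invfM mulrACA mulfV// mul1r.
have h1 := dyadic_lt n.+1 (2 * k); have h2 := dyadic_lt n.+1 (2 * k + 1).
move: h1 h2; rewrite /dyadic.
have -> : 2 * k + 1 + 1 = 2 * (k + 1) :> int by ring.
rewrite !e => h1 h2; apply/seteqP; split => x; rewrite /setU /= !in_itv /=.
  by case: (ltP x ((2 * k + 1)%:~R / 2 ^+ n.+1)) => h /andP[-> ->]; [left|right].
by move=> [/andP[a b]|/andP[a b]]; apply/andP; split; lra.
Qed.

Lemma dyadic_disjoint n k l : k != l -> dyadic n k `&` dyadic n l = set0.
Proof.
move=> kl; rewrite -subset0 => x [/dyadicP e1 /dyadicP e2].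
by move: kl; rewrite -e1 -e2 eqxx.
Qed.

Lemma cint_cst (E : set R) (z : C) : measurable E ->
  cint E (fun=> z) = creal (fine (mu E)) * z.
Proof.
move=> mE; apply: complex_ext; rewrite ?cReMr ?cImMr /= Rintegral_cst//=; exact: mulrC.
Qed.

Lemma cint_setU (A B : set R) (f : R -> C) : measurable A -> measurable B ->
  A `&` B = set0 -> mu.-integrable (A `|` B) (EFin \o (cRe \o f)) ->
  mu.-integrable (A `|` B) (EFin \o (cIm \o f)) ->
  cint (A `|` B) f = cint A f + cint B f.
Proof.
move=> mA mB AB fr fi; have dAB : [disjoint A & B] by apply/disj_set2P.
by apply: complex_ext; rewrite ?cReD ?cImD /= Rintegral_setU.
Qed.

Definition cell n x : set R := dyadic n (dyadic_index n x).

(* Conditional expectation onto the dyadic intervals of length [2^-n] in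
   [[-2^n, 2^n)]. *)
Definition dyadic_avg n (f : R -> C) (x : R) : C :=
  creal (2 ^+ n * \1_(window n) x) * cint (cell n x) f.

Lemma dyadic_avg_cell n f x y : dyadic_index n x = dyadic_index n y ->
  dyadic_avg n f x = dyadic_avg n f y.
Proof.
move=> xy; rewrite /dyadic_avg /cell xy !indicE; congr (creal (_ * (nat_of_bool _)%:R) * _).
by apply/idP/idP => /[!inE]; exact: window_dyadic.
Qed.

(** Exhibits the average as a finite rank operator. At each point at most one summand survives;
    subtracting [4 ^ n] turns ordinals into cell indices of the window. *)
Lemma dyadic_avg_sum n f : dyadic_avg n f = fun x => \sum_(j < (2 * 4 ^ n)%N)
  creal (2 ^+ n) * cint (dyadic n (j%:Z - (4 ^ n)%N%:Z)) f *
    creal (\1_(dyadic n (j%:Z - (4 ^ n)%N%:Z)) x).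
Proof.
apply/funext => x; rewrite /dyadic_avg.
have [wx|wx] := pselect (window n x); last first.
  rewrite indicE memNset// mulr0 creal0 mul0r big1// => j _.
  rewrite indicE memNset ?creal0 ?mulr0// => /dyadicP xj; apply: wx.
  by apply/window_index; rewrite xj; move: (ltn_ord j); lia.
have /window_index wi := wx.
pose j0 := absz (dyadic_index n x + (4 ^ n)%N%:Z).
have j0E : j0%:Z = dyadic_index n x + (4 ^ n)%N%:Z by rewrite /j0; lia.
have j0lt : (j0 < 2 * 4 ^ n)%N by lia.
rewrite (bigD1 (Ordinal j0lt))//= big1 => [|j jj0].
  rewrite j0E addrK indicE mem_set// indicE mem_set; last exact: dyadic_mem.
  by rewrite /= creal1 addr0 !mulr1.
rewrite [in X in _ * X]indicE memNset ?creal0 ?mulr0// => /dyadicP xj.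
by move/eqP: jj0; apply; apply: val_inj => /=; lia.
Qed.

End dyadic.

Section dyadic_averages.
Context {R : realType} (rho : (R -> R) -> \bar R).
Hypothesis rhoP : banach_function_norm rho.
Local Notation C := (R[i]).
Local Notation mu := (@lebesgue_measure R).
Local Notation inX := (inX rho).
Local Notation Xnorm := (Xnorm rho).
Local Notation ae_eq := (@Defs.ae_eq R).

Let mD (n : nat) (k : int) := @measurable_dyadic R n k.
Let fD (n : nat) (k : int) := @mu_dyadic_fin R n k.

Lemma inX_indicZ (E : set R) (z : C) : measurable E -> (mu E < +oo)%E ->
  inX (fun x => z * creal (\1_E x)).
Proof. by move=> mE Efin; case: (inXZ rhoP z (inX_indic rhoP mE Efin)). Qed.

Lemma inX_dyadic_avg n f : inX f -> inX (dyadic_avg n f).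
Proof.
move=> fX; rewrite dyadic_avg_sum; apply: inX_sum => // j.
by apply: inX_indicZ; [exact: mD|exact: fD].
Qed.

Lemma dyadic_avg_lin n (al : C) f g : inX f -> inX g ->
  dyadic_avg n (fun x => al * f x + g x) =
  (fun x => al * dyadic_avg n f x + dyadic_avg n g x).
Proof.
move=> fX gX; apply/funext => x; rewrite /dyadic_avg (cint_lin rhoP)//; first by ring.
- exact: mD.
- exact: fD.
Qed.

Lemma dyadic_avg_bounded : maximal_bounded rho -> exists2 c : R, 0 <= c &
  forall n f, inX f -> Xnorm (dyadic_avg n f) <= c * Xnorm f.
Proof.
(* The closed cell around [x] competes in the supremum defining [maximal f x]; the 2 is that of
   [cnorm_cint_le]. *)
move=> /(maximal_dominated rhoP)[c c0 cP]; exists (2 * c); first by rewrite mulr_ge0.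
move=> n f fX; have [] // := cP f (dyadic_avg n f) 2 fX.
  by case: (inX_dyadic_avg n fX).
move=> x Mfin; rewrite /dyadic_avg cnormM cnorm_creal.
have [_ _ fi] := inX_integrable rhoP (mD n (dyadic_index n x)) (fD n (dyadic_index n x)) fX.
have h1 := cnorm_cint_le (mD n (dyadic_index n x)) fX.1 fi.
have /andP[xa xb] : dyadic n (dyadic_index n x) x by exact: dyadic_mem.
have h2 := maximal_avg_le (mD n (dyadic_index n x)) fX.1
  (dyadic_lt n (dyadic_index n x)) (a := (dyadic_index n x)%:~R / 2 ^+ n) (x := x) _ _ Mfin.
rewrite dyadic_width in h2.
have {}h2 : Rintegral mu (cell n x) (cnorm \o f) <= (2 ^+ n)^-1 * fine (maximal f x).
  apply: h2; first by move: (dyadic_mem n x); rewrite /dyadic /= in_itv /= => /andP[-> /ltW ->].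
  by move=> y; rewrite /dyadic /= !in_itv /= => /andP[-> /ltW ->].
have p2 : 0 < 2 ^+ n :> R by rewrite exprn_gt0.
apply: (@le_trans _ _ (2 ^+ n * (2 * ((2 ^+ n)^-1 * fine (maximal f x))))).
  apply: ler_pM => //; first exact: cnorm_ge0.
    rewrite normrM indicE (ger0_norm (ltW p2)).
    by case: (x \in _); rewrite ?normr1 ?normr0 ?mulr1 ?mulr0//; exact: ltW.
  by apply: le_trans h1 _; rewrite ler_pM2l.
by rewrite mulrCA mulVKf// gt_eqF.
Qed.

(** An average of generation [n] is constant on the finer cells, and it already vanishes off the
    larger window. *)
Lemma dyadic_avg_refine n d (f : R -> C) :
  dyadic_avg (n + d) (dyadic_avg n f) = dyadic_avg n f.
Proof.
apply/funext => x; rewrite {1}/dyadic_avg.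
rewrite (@eq_cint _ _ _ (fun=> dyadic_avg n f x)); last first.
  by move=> y /dyadicP xy; apply: dyadic_avg_cell; exact: (dyadic_index_le xy).
rewrite cint_cst; last exact: mD.
have [wx|wx] := pselect (window (n + d) x); last first.
  rewrite indicE memNset// mulr0 creal0 mul0r /dyadic_avg indicE memNset ?mulr0 ?creal0 ?mul0r//.
  by move=> wnx; apply: wx; apply: window_le wnx; rewrite leq_addr.
rewrite indicE mem_set// mulr1 mulrA -crealM /cell mu_dyadic /= mulfV ?creal1 ?mul1r//.
Qed.

(** Induction on [d]: halving the interval moves one unit from [d] to [n], until the interval is
    itself a cell of the averaging generation. *)
Lemma cint_dyadic_avg d n k (f : R -> C) : inX f ->
  (dyadic n k : set R) `<=` window (n + d) ->
  cint (dyadic n k) (dyadic_avg (n + d) f) = cint (dyadic n k) f.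
Proof.
move=> fX; elim: d n k => [|d ih] n k kw.
  rewrite addn0 in kw *.
  rewrite (@eq_cint _ _ _ (fun=> creal (2 ^+ n) * cint (dyadic n k) f)); last first.
    move=> x kx; rewrite /dyadic_avg indicE mem_set; last exact: kw.
    by rewrite mulr1 /cell; move/dyadicP: kx => ->.
  rewrite cint_cst; last exact: mD.
  by rewrite mu_dyadic /= mulrA -crealM mulVf ?creal1 ?mul1r// gt_eqF// exprn_gt0.
have dis : dyadic n.+1 (2 * k) `&` dyadic n.+1 (2 * k + 1) = set0 :> set R.
  by apply: dyadic_disjoint; apply/eqP; lia.
have spl g : inX g -> cint (dyadic n k) g =
    cint (dyadic n.+1 (2 * k)) g + cint (dyadic n.+1 (2 * k + 1)) g.
  move=> gX; have [gr gi _] := inX_integrable rhoP (mD n k) (fD n k) gX.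
  by rewrite dyadic_split in gr gi *; apply: cint_setU => //; exact: mD.
rewrite addnS -addSn spl; last exact: inX_dyadic_avg.
rewrite [RHS]spl// !ih//.
  by rewrite addSnnS; apply: subset_trans kw; rewrite (dyadic_split n k); exact: subsetUr.
by rewrite addSnnS; apply: subset_trans kw; rewrite (dyadic_split n k); exact: subsetUl.
Qed.

Lemma dyadic_avg_coarsen n d f : inX f ->
  dyadic_avg n (dyadic_avg (n + d) f) = dyadic_avg n f.
Proof.
move=> fX; apply/funext => x; rewrite {1 3}/dyadic_avg.
have [wx|wx] := pselect (window n x); last first.
  by rewrite indicE memNset// mulr0 creal0 !mul0r.
rewrite cint_dyadic_avg// => y /dyadicP yx.
apply: (window_le (leq_addr d n)); apply: window_dyadic wx; exact/esym.
Qed.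

Definition dyadic_functionals : set ((R -> C) -> C) :=
  [set psi | exists n k, psi = cint (dyadic n k)].

Lemma dyadic_functionals_dual : dyadic_functionals `<=` dual_elt rho.
Proof. by move=> _ [n [k ->]]; apply: dual_cint => //; exact: fD. Qed.

(** The sequence is eventually constant: the generation must be at least that of the interval, and
    the window must contain it. *)
Lemma dyadic_avg_cvg psi f : dyadic_functionals psi -> inX f ->
  forall e, 0 < e -> exists N, forall n, (N <= n)%N ->
    cnorm (psi (dyadic_avg n f) - psi f) <= e.
Proof.
move=> [n [k ->]] fX e e0; have [m mP] := @dyadic_window R n k.
exists (n + m)%N => n' nn'.
have -> : n' = (n + (n' - n))%N by rewrite subnKC// (leq_trans _ nn')// leq_addr.
rewrite cint_dyadic_avg// ?subrr ?cnorm0 ?ltW//.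
by apply: mP; lia.
Qed.

(** The cell lies in the ball of radius 2^-n around [x], whose measure is twice that of the cell;
    this is the constant 2 of the witness. *)
Let cell_shrinking (x : R) : nicely_shrinking x (fun n => cell n x).
Proof.
split; first by move=> n; exact: mD.
have p2 n : 0 < (2 ^+ n)^-1 :> R by rewrite invr_gt0 exprn_gt0.
exists (2, fun n => PosNum (p2 n)); split => //=.
- rewrite (_ : (fun n => _) = (fun n => 2^-1 ^+ n)).
    by apply: cvg_expr; rewrite ger0_norm// invf_lt1// ltr1n.
  by apply/funext => n; rewrite exprVn.
- move=> n y yx; have := dyadic_mem n x; move: yx.
  have := @dyadic_width R n (dyadic_index n x).
  rewrite /cell /dyadic /ball /= !in_itv /= ltr_norml.
  by move=> h /andP[a b] /andP[e f]; apply/andP; split; lra.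
- move=> n; rewrite lebesgue_measure_ball; last exact: ltW.
  by rewrite /cell mu_dyadic -EFinM lee_fin mulr_natl.
Qed.

(** At a Lebesgue point the averages over the shrinking cells converge to the value of [r], and they
    are all zero. *)
Lemma dyadic_separation (r : R -> R) : locally_integrable setT r ->
  (forall n k, Rintegral mu (dyadic n k) r = 0) -> {ae mu, forall x, r x = 0}.
Proof.
move=> locr r0; have := lebesgue_differentiation locr; apply: aeS => x xr.
have := nice_lebesgue_differentiation cell_shrinking locr xr.
rewrite (_ : (fun n => _) = cst 0%E); last first.
  apply/funext => n; rewrite /cell.
  have : Rintegral mu (dyadic n (dyadic_index n x)) r = 0 by exact: r0.
  rewrite /Rintegral => h.
  (* [Rintegral] also returns 0 on an infinite integral, so finiteness must be known before the
     extended integral can be called zero. *)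
  have fn : (\int[mu]_(y in dyadic n (dyadic_index n x)) (r y)%:E)%E \is a fin_num.
    apply: integrable_fin_num; first exact: mD.
    have [mr _ cr] := locr.
    apply/integrableP; split; first by apply/measurable_EFinP; exact: measurable_funTS.
    apply: le_lt_trans (cr `[(dyadic_index n x)%:~R / 2 ^+ n,
      (dyadic_index n x + 1)%:~R / 2 ^+ n]%classic _ _) => //; last exact: segment_compact.
    apply: ge0_subset_integral => //.
    - exact: mD.
    - by apply/measurable_EFinP; apply: measurableT_comp => //; exact: measurable_funTS.
    - by move=> y; rewrite /dyadic /= !in_itv /= => /andP[-> /ltW ->].
  by rewrite -(fineK fn) h mule0.
by move=> /(cvg_lim (@ereal_hausdorff R)); rewrite lim_cst// => -[].
Qed.

Lemma inX_locally_integrable f : inX f ->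
  locally_integrable setT (cRe \o f) /\ locally_integrable setT (cIm \o f).
Proof.
move=> fX; have [[mr mi] _] := fX.
split; split => //; try exact: openT.
  move=> K _ cK; have mK := compact_measurable cK; have fK := compact_finite_measure cK.
  by have [/integrableP[]] := inX_integrable rhoP mK fK fX.
move=> K _ cK; have mK := compact_measurable cK; have fK := compact_finite_measure cK.
by have [_ /integrableP[]] := inX_integrable rhoP mK fK fX.
Qed.

Lemma dyadic_functionals_sep f g : inX f -> inX g ->
  (forall psi, dyadic_functionals psi -> psi f = psi g) -> ae_eq f g.
Proof.
move=> fX gX fg; have hX := (inXB rhoP fX gX).1.
have h0 n k : cint (dyadic n k) (fun x => f x - g x) = 0.
  have psi : dyadic_functionals (cint (dyadic n k)) by exists n, k.
  by rewrite (dualB (dyadic_functionals_dual psi) fX gX) fg// subrr.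
have [lr li] := inX_locally_integrable hX.
have hr := dyadic_separation lr (fun n k => congr1 (@cRe R) (h0 n k)).
have hi := dyadic_separation li (fun n k => congr1 (@cIm R) (h0 n k)).
by move: hr hi; apply: aeS2 => x /= a b; apply/eqP; rewrite -subr_eq0; apply/eqP;
  exact: complex_ext.
Qed.

End dyadic_averages.

(** * The Fejer kernel and its Fourier transform *)

Section fejer_kernel.
Context {R : realType}.
Local Notation mu := (@lebesgue_measure R).
Implicit Types (d t u v : R).

Lemma Rintegral_FTC (F f : R -> R) (a b : R) : a < b -> continuous f ->
  (forall x : R, is_derive x (1 : R) F (f x)) -> Rintegral mu `[a, b] f = F b - F a.
Proof.
move=> ab cf dF; rewrite /Rintegral (@continuous_FTC2 _ f F a b ab) //.
- exact: continuous_subspaceT.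
- have cF : continuous F.
    move=> x; apply: differentiable_continuous; apply/derivable1_diffP.
    by have [] := dF x.
  split; first by move=> x _; have [] := dF x.
    exact: cvg_at_right_filter (cF a).
  exact: cvg_at_left_filter (cF b).
- by move=> x _; rewrite derive1E; have [_ ->] := dF x.
Qed.

(** Iterated from |cos| <= 1, this climbs to bounds on sin v, 1 - cos v, v - sin v and v^2 - 2 (1 -
    cos v), each gaining one power of v, with constants that are not sharp. *)
Lemma mean_value_bound (f f' : R -> R) v (B : R) : (forall x : R, is_derive x (1 : R) f (f' x)) ->
  f 0 = 0 -> (forall x, `|x| <= `|v| -> `|f' x| <= B) -> `|f v| <= B * `|v|.
Proof.
move=> df f0 f'B.
have cf : continuous f.
  by move=> x; apply: differentiable_continuous; apply/derivable1_diffP; have [] := df x.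
have [v0|v0] := leP 0 v.
  have [|x /[!in_itv] /= /andP[x0 xv]] := @MVT_segment R f f' 0 v v0 _.
  - exact: continuous_subspaceT.
  - rewrite f0 !subr0 => ->; rewrite normrM ler_wpM2r// f'B//.
    by rewrite !ger0_norm.
have [|x /[!in_itv] /= /andP[x0 xv]] := @MVT_segment R f f' v 0 (ltW v0) _.
- exact: continuous_subspaceT.
- rewrite f0 sub0r => h; rewrite -normrN h normrM sub0r normrN ler_wpM2r// f'B//.
  by rewrite !ler0_norm ?lerN2// ltW.
Qed.

Lemma normr_sin_le v : `|sin v| <= `|v|.
Proof.
rewrite -[leRHS]mul1r; apply: (@mean_value_bound sin cos).
- exact: sin0.
- by move=> x _; rewrite ler_norml cos_geN1 cos_le1.
Qed.

Lemma normr_1Bcos_le v : `|1 - cos v| <= v ^+ 2.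
Proof.
have -> : v ^+ 2 = `|v| * `|v| by rewrite -normrM ger0_norm ?sqr_ge0// expr2.
apply: (@mean_value_bound (fun x => 1 - cos x) sin).
- move=> x; by apply: is_derive_eq; ring.
- by rewrite cos0 subrr.
- by move=> x xv; apply: le_trans (normr_sin_le _) xv.
Qed.

Lemma normr_subr_sin_le v : `|v - sin v| <= `|v| ^+ 3.
Proof.
rewrite exprSr; apply: (@mean_value_bound (fun x => x - sin x) (fun x => 1 - cos x)).
- by rewrite sin0 subrr.
- move=> x xv; apply: le_trans (normr_1Bcos_le _) _.
  by rewrite -real_normK ?num_real// lerXn2r ?nnegrE.
Qed.

(** With v = d u this is the numerator of [1 - fejer d u] over the denominator v^2. *)
Lemma normr_cos_expansion_le v : `|v ^+ 2 - 2 * (1 - cos v)| <= 2 * v ^+ 4.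
Proof.
have -> : 2 * v ^+ 4 = (2 * `|v| ^+ 3) * `|v|.
  by rewrite -mulrA -exprSr -normrX ger0_norm// -[4%N]/(2 * 2)%N exprM sqr_ge0.
apply: (@mean_value_bound (fun x => x ^+ 2 - 2 * (1 - cos x)) (fun x => 2 * (x - sin x))).
- move=> x; apply: is_derive_eq.
  by rewrite /GRing.scale /= ?expr1 ?mulr1 ?sub0r ?opprK; ring.
- by rewrite cos0 subrr mulr0 expr0n subr0.
- move=> x xv; rewrite normrM ger0_norm// ler_pM2l//.
  apply: le_trans (normr_subr_sin_le _) _.
  by rewrite lerXn2r ?nnegrE.
Qed.

(* The symbol [fejer_symbol d] is a triangle function supported in [[-d, d]]
   and [fejer d] is [(2 pi)^-1] times its Fourier transform. *)
Definition fejer_symbol d t : R := 2 * pi / d * Num.max 0 (1 - `|t| / d).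
Definition fejer d u : R := if u == 0 then 1 else 2 * (1 - cos (d * u)) / (d * u) ^+ 2.

Lemma fejerN d u : fejer d (- u) = fejer d u.
Proof. by rewrite /fejer oppr_eq0 mulrN cosN sqrrN. Qed.

Lemma fejer_le2 d u : 0 < d -> `|fejer d u| <= 2.
Proof.
move=> d0; rewrite /fejer; case: eqVneq => [_|u0]; first by rewrite normr1 ler1n.
have du : 0 < (d * u) ^+ 2 by rewrite exprn_even_gt0//= mulf_neq0// gt_eqF.
rewrite normrM [X in _ * X]gtr0_norm ?invr_gt0// ler_pdivrMr//.
by rewrite normrM ger0_norm// ler_pM2l// normr_1Bcos_le.
Qed.

(** The numerator is at most 4. Together with [fejer_le2] this is the integrable majorant of the
    kernel. *)
Lemma fejer_decay d u : 0 < d -> `|fejer d u| * u ^+ 2 <= 4 / d ^+ 2.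
Proof.
move=> d0; have d2 : 0 < d ^+ 2 by rewrite exprn_gt0.
rewrite /fejer; case: eqVneq => [->|u0].
  by rewrite expr0n mulr0 divr_ge0// ltW.
have u2 : 0 < u ^+ 2 by rewrite exprn_even_gt0.
have du : 0 < (d ^+ 2 * u ^+ 2)^-1 by rewrite invr_gt0; exact: mulr_gt0.
rewrite exprMn !normrM (gtr0_norm du).
rewrite [X in X <= _](_ : _ = `|2| * `|1 - cos (d * u)| / d ^+ 2); last first.
  by field; rewrite u0 gt_eqF.
rewrite ler_pM2r ?invr_gt0//.
rewrite ger0_norm//; have h : `|1 - cos (d * u)| <= 2.
  by have := cos_geN1 (d * u); have := cos_le1 (d * u); rewrite ler_norml => *; lra.
by move: h; lra.
Qed.

(** Gives the convergence of the kernel to 1, uniform on bounded sets, as [d] tends to 0. *)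
Lemma fejer_near1 d u : 0 < d -> `|1 - fejer d u| <= 2 * (d * u) ^+ 2.
Proof.
move=> d0; rewrite /fejer; case: eqVneq => [->|u0].
  by rewrite subrr normr0 mulr0 expr0n mulr0.
have du : 0 < (d * u) ^+ 2 by rewrite exprn_even_gt0//= mulf_neq0// gt_eqF.
rewrite -(ler_pM2r du) -[X in _ * X <= _]gtr0_norm// -normrM mulrBl mul1r divfK ?gt_eqF//.
apply: le_trans (normr_cos_expansion_le _) _.
by rewrite -mulrA -expr2 -exprM.
Qed.

Lemma measurable_fejer d : 0 < d -> measurable_fun setT (fejer d).
Proof.
move=> d0.
(* The shifted denominator makes the fraction continuous; the fraction is 0 at the origin, where the
   last term restores the value 1. *)
pose g n u : R := 2 * (1 - cos (d * u)) / ((d * u) ^+ 2 + n.+1%:R^-1) + (u == 0)%:R.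
have gm n : measurable_fun setT (g n).
  apply: measurable_funD.
    apply: continuous_measurable => x; apply: cvgM.
      apply: cvgMr; apply: cvgB; first exact: cvg_cst.
      by apply: continuous_comp; [exact: mulrl_continuous|exact: continuous_cos].
    apply: cvgV.
      by rewrite gt_eqF// ltr_wpDl ?sqr_ge0// invr_gt0.
    apply: cvgD; last exact: cvg_cst.
    by apply: (@continuous_comp _ _ _ (fun u => d * u) (fun v => v ^+ 2)); [exact: mulrl_continuous|exact: exprn_continuous].
  rewrite (_ : (fun u => _) = \1_[set 0]); first exact: measurable_indic.
  by apply/funext => u; rewrite indicE in_set1.
apply: (@measurable_fun_cvg _ _ R setT g) => // u _; rewrite /fejer /g.
case: eqVneq => [->|u0].
  rewrite mulr0 cos0 subrr mulr0 (_ : (fun _ => _) = cst 1); first exact: cvg_cst.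
  by apply/funext => n; rewrite mul0r add0r.
rewrite -[X in _ --> X]addr0; apply: cvgD; last exact: cvg_cst.
apply: cvgMr; apply: cvgV; first by rewrite sqrf_eq0 mulf_neq0// gt_eqF.
rewrite -[X in _ --> X]addr0; apply: cvgD; [exact: cvg_cst|].
exact: cvg_harmonic.
Qed.

Lemma continuous_fejer_symbol d : continuous (fejer_symbol d).
Proof.
move=> x; apply: cvgMr; apply: (@continuous_comp _ _ _ (fun t => 1 - `|t| / d) (fun s => Num.max 0 s)).
  apply: cvgB; first exact: cvg_cst.
  by apply: cvgMl; exact: norm_continuous.
by apply: continuous_max; [exact: cst_continuous|].
Qed.

Lemma fejer_symbol_ge0 d t : 0 < d -> 0 <= fejer_symbol d t.
Proof.
move=> d0; rewrite /fejer_symbol; apply: mulr_ge0; last by rewrite le_max lexx.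
by rewrite !mulr_ge0 ?invr_ge0 ?pi_ge0// ltW.
Qed.

Lemma fejer_symbol_le d t : 0 < d -> fejer_symbol d t <= 2 * pi / d.
Proof.
move=> d0; rewrite -[leRHS]mulr1 ler_wpM2l//.
  by rewrite !mulr_ge0 ?invr_ge0 ?pi_ge0// ltW.
by rewrite ge_max ler01 /= lerBlDr lerDl divr_ge0// ltW.
Qed.

Lemma fejer_symbol_out d t : 0 < d -> d <= `|t| -> fejer_symbol d t = 0.
Proof.
move=> d0 dt; rewrite /fejer_symbol max_l ?mulr0// subr_le0.
by rewrite ler_pdivlMr// mul1r.
Qed.

(** Cutting at the kink of the triangle leaves an affine function times [T] on each half, which has
    an explicit primitive for cosine and sine. *)
Let trig_integral (T : R -> R) d u : 0 < d -> continuous T ->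
  Rintegral mu `[- d, d] (fun t => fejer_symbol d t * T (t * u)) =
  Rintegral mu `[- d, 0] (fun t => 2 * pi / d * ((1 + d^-1 * t) * T (t * u))) +
  Rintegral mu `[0, d] (fun t => 2 * pi / d * ((1 + - d^-1 * t) * T (t * u))).
Proof.
move=> d0 cT.
have cf : continuous (fun t => fejer_symbol d t * T (t * u)).
  move=> x; apply: cvgM; first exact: continuous_fejer_symbol.
  by apply: (@continuous_comp _ _ _ (fun t => t * u) T); [exact: mulrr_continuous|exact: cT].
have fi : mu.-integrable `[- d, d] (EFin \o (fun t => fejer_symbol d t * T (t * u))).
  apply: continuous_compact_integrable; first exact: segment_compact.
  exact: continuous_subspaceT.
have h := @Rintegral_itvB R (fun t => fejer_symbol d t * T (t * u)) (BLeft (- d)) (BRight d) 0 fi.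
have {}h := h (ltac:(rewrite bnd_simp; lra)) (ltac:(rewrite bnd_simp; lra)).
rewrite -(subrK (Rintegral mu `[- d, 0] (fun t => fejer_symbol d t * T (t * u)))
  (Rintegral mu `[- d, d] _)) h addrC; congr (_ + _).
  apply: eq_Rintegral => t /[!inE] /= /[!in_itv] /= /andP[t1 t2].
  have e : 1 - `|t| / d = 1 + d^-1 * t by rewrite ler0_norm// mulNr opprK mulrC.
  rewrite /fejer_symbol e max_r -?mulrA//.
  by rewrite -(ler_pM2l d0) mulr0 mulrDr mulr1 mulVKf ?gt_eqF//; lra.
rewrite Rintegral_itv_obnd_cbnd.
  apply: eq_Rintegral => t /[!inE] /= /[!in_itv] /= /andP[t1 t2].
  have e : 1 - `|t| / d = 1 + - d^-1 * t by rewrite ger0_norm// mulNr mulrC.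
  rewrite /fejer_symbol e max_r -?mulrA//.
  by rewrite -(ler_pM2l d0) mulr0 mulrDr mulr1 mulNr mulrN mulVKf ?gt_eqF//; lra.
apply: integrableS fi => //.
by move=> t /=; rewrite !in_itv /= => /andP[a b]; apply/andP; split; lra.
Qed.

Let is_derive_sinM (u x : R) : is_derive x (1 : R) (fun t : R => sin (t * u)) (cos (x * u) * u).
Proof.
have h1 : is_derive x (1 : R) (fun t : R => t * u) u.
  by apply: is_derive_eq; rewrite /GRing.scale /= mulr0 add0r mulr1.
exact: (@is_derive1_comp R sin (fun t => t * u)).
Qed.

Let is_derive_cosM (u x : R) : is_derive x (1 : R) (fun t : R => cos (t * u)) (- sin (x * u) * u).
Proof.
have h1 : is_derive x (1 : R) (fun t : R => t * u) u.
  by apply: is_derive_eq; rewrite /GRing.scale /= mulr0 add0r mulr1.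
exact: (@is_derive1_comp R cos (fun t => t * u)).
Qed.

Let affine_trig_continuous (T : R -> R) (a b u : R) : continuous T ->
  continuous (fun t => a * ((1 + b * t) * T (t * u))).
Proof.
move=> cT x; apply: cvgMr; apply: cvgM.
  by apply: cvgD; [exact: cvg_cst|exact: mulrl_continuous].
by apply: (@continuous_comp _ _ _ (fun t => t * u) T); [exact: mulrr_continuous|exact: cT].
Qed.

Let affine_cos (a b u p q : R) : p < q -> u != 0 ->
  Rintegral mu `[p, q] (fun t => a * ((1 + b * t) * cos (t * u))) =
  a * ((1 + b * q) * sin (q * u) / u + b * cos (q * u) / u ^+ 2) -
  a * ((1 + b * p) * sin (p * u) / u + b * cos (p * u) / u ^+ 2).
Proof.
move=> pq u0; apply: (@Rintegral_FTC (fun t => a * ((1 + b * t) * sin (t * u) / u + b * cos (t * u) / u ^+ 2))) => //.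
  exact/affine_trig_continuous/continuous_cos.
move=> x; have h1 := is_derive_sinM u x; have h2 := is_derive_cosM u x.
by apply: is_derive_eq; rewrite /GRing.scale /=; field.
Qed.

Let affine_sin (a b u p q : R) : p < q -> u != 0 ->
  Rintegral mu `[p, q] (fun t => a * ((1 + b * t) * sin (t * u))) =
  a * (- (1 + b * q) * cos (q * u) / u + b * sin (q * u) / u ^+ 2) -
  a * (- (1 + b * p) * cos (p * u) / u + b * sin (p * u) / u ^+ 2).
Proof.
move=> pq u0; apply: (@Rintegral_FTC (fun t => a * (- (1 + b * t) * cos (t * u) / u + b * sin (t * u) / u ^+ 2))) => //.
  exact/affine_trig_continuous/continuous_sin.
move=> x; have h1 := is_derive_sinM u x; have h2 := is_derive_cosM u x.
by apply: is_derive_eq; rewrite /GRing.scale /=; field.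
Qed.

(** The frequency 0, where the primitives dividing by [u] fail; [t * 0] is kept so as to match
    [trig_integral]. *)
Let affine_integral (a b p q : R) : p < q ->
  Rintegral mu `[p, q] (fun t => a * ((1 + b * t) * cos (t * 0))) =
  a * (q + b / 2 * q ^+ 2) - a * (p + b / 2 * p ^+ 2).
Proof.
move=> pq; apply: (@Rintegral_FTC (fun t => a * (t + b / 2 * t ^+ 2))) => //.
  exact/affine_trig_continuous/continuous_cos.
by move=> x; apply: is_derive_eq; rewrite /GRing.scale /= mulr0 cos0; field.
Qed.

Lemma fejer_symbol_cos d u : 0 < d ->
  Rintegral mu `[- d, d] (fun t => fejer_symbol d t * cos (t * u)) = 2 * pi * fejer d u.
Proof.
move=> d0; rewrite trig_integral//; last exact: continuous_cos.
have d0' : d != 0 by rewrite gt_eqF.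
have [->|u0] := eqVneq u 0.
  rewrite !affine_integral ?oppr_lt0// /fejer eqxx; field; exact: d0'.
rewrite !affine_cos ?oppr_lt0// /fejer (negbTE u0) !mul0r sin0 cos0 (mulNr d u) cosN sinN.
by field; rewrite d0' u0.
Qed.

Lemma fejer_symbol_sin d u : 0 < d ->
  Rintegral mu `[- d, d] (fun t => fejer_symbol d t * sin (t * u)) = 0.
Proof.
move=> d0; rewrite trig_integral//; last exact: continuous_sin.
have d0' : d != 0 by rewrite gt_eqF.
have [->|u0] := eqVneq u 0.
  under eq_Rintegral do rewrite mulr0 sin0 !mulr0.
  under [X in _ + X]eq_Rintegral do rewrite mulr0 sin0 !mulr0.
  by rewrite !Rintegral_cst// !mul0r addr0.
rewrite !affine_sin ?oppr_lt0// !mul0r sin0 cos0 (mulNr d u) cosN sinN.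
by field; rewrite d0' u0.
Qed.

End fejer_kernel.

(** * Measurability of parameter integrals and Fubini for real integrands *)

Section parametric_integrals.
Context {R : realType}.
Local Notation mu := (@lebesgue_measure R).

(** Tonelli measurability concerns nonnegative integrands, so positive and negative parts are
    integrated separately and [fine] is applied to their difference. *)
Lemma measurable_param_Rintegral (F : R * R -> R) : measurable_fun setT F ->
  measurable_fun setT (fun x => Rintegral mu setT (fun y => F (x, y))).
Proof.
move=> mF; have mEF : measurable_fun setT (EFin \o F) by exact/measurable_EFinP.
have mp : measurable_fun setT (fun x => \int[mu]_y (EFin \o F)^\+%E (x, y))%E.
  apply: (measurable_fun_fubini_tonelli_F (m2 := mu) (EFin \o F)^\+%E) => //.
  exact: measurable_funepos.
have mn : measurable_fun setT (fun x => \int[mu]_y (EFin \o F)^\-%E (x, y))%E.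
  apply: (measurable_fun_fubini_tonelli_F (m2 := mu) (EFin \o F)^\-%E) => //.
  exact: measurable_funeneg.
rewrite (_ : (fun x => _) = fine \o (fun x =>
    \int[mu]_y (EFin \o F)^\+%E (x, y) - \int[mu]_y (EFin \o F)^\-%E (x, y))%E).
  by apply: measurableT_comp => //; exact: emeasurable_funB.
apply/funext => x /=; rewrite /Rintegral; congr fine.
rewrite integralE; congr (_ - _)%E; apply: eq_integral => y _.
  by rewrite !funeposE.
by rewrite !funenegE.
Qed.

(** The majorant depends on [s] alone, so integrability on the product follows from the finite
    measure of [E1]. The cut-off [G] moves everything to the whole plane. *)
Lemma Rintegral_Fubini (F : R * R -> R) (g : R -> R) (E1 E2 : set R) :
  measurable E1 -> measurable E2 -> (mu E1 < +oo)%E ->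
  measurable_fun setT F -> mu.-integrable E2 (EFin \o g) ->
  (forall t s, E1 t -> E2 s -> `|F (t, s)| <= g s) ->
  Rintegral mu E1 (fun t => Rintegral mu E2 (fun s => F (t, s))) =
  Rintegral mu E2 (fun s => Rintegral mu E1 (fun t => F (t, s))).
Proof.
move=> mE1 mE2 E1fin mF gi Fg.
pose G (z : R * R) : R := \1_E1 z.1 * (\1_E2 z.2 * F z).
have mG : measurable_fun setT G.
  apply: measurable_funM.
    by apply: measurableT_comp (measurable_fst); exact: measurable_indic.
  apply: measurable_funM => //.
  by apply: measurableT_comp (measurable_snd); exact: measurable_indic.
have mEG : measurable_fun setT (EFin \o G) by exact/measurable_EFinP.
have G1 t s : E1 t -> E2 s -> G (t, s) = F (t, s).
  by move=> Et Es; rewrite /G /= !indicE !mem_set// !mul1r.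
have G0l t s : ~ E1 t -> G (t, s) = 0 by move=> Et; rewrite /G /= indicE memNset// mul0r.
have G0r t s : ~ E2 s -> G (t, s) = 0.
  by move=> Es; rewrite /G /= [X in _ * (X * _)]indicE memNset// mul0r mulr0.
have patch1 t : E1 t -> (fun s => (G (t, s))%:E) = ((fun s => (F (t, s))%:E) \_ E2)%E.
  move=> Et; apply/funext => s; rewrite patchE.
  by have [Es|Es] := pselect (E2 s); [rewrite mem_set// G1|rewrite memNset// G0r].
have patch2 s : E2 s -> (fun t => (G (t, s))%:E) = ((fun t => (F (t, s))%:E) \_ E1)%E.
  move=> Es; apply/funext => t; rewrite patchE.
  by have [Et|Et] := pselect (E1 t); [rewrite mem_set// G1|rewrite memNset// G0l].
have mF1 t : measurable_fun setT (fun s => F (t, s)).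
  exact: (measurableT_comp mF (pair1_measurable t)).
have mF2 s : measurable_fun setT (fun t => F (t, s)).
  exact: (measurableT_comp mF (pair2_measurable s)).
have i1 t : E1 t -> mu.-integrable E2 (EFin \o (fun s => F (t, s))).
  by move=> Et; refine (integrable_le mE2 (mF1 t) gi _) => s; exact: Fg.
have i2 s : E2 s -> mu.-integrable E1 (EFin \o (fun t => F (t, s))).
  move=> Es; have ci : mu.-integrable E1 (EFin \o cst (g s)).
    apply: measurable_bounded_integrable => //.
    by exists `|g s|; split => // y gy t _ /=; exact: ltW.
  by refine (integrable_le mE1 (mF2 s) ci _) => t Et; exact: Fg.
have in1 t : (\int[mu]_s (G (t, s))%:E)%E =
    (\1_E1 t * Rintegral mu E2 (fun s => F (t, s)))%:E.
  have [Et|Et] := pselect (E1 t).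
    rewrite indicE mem_set// mul1r fineK; last by apply: integrable_fin_num => //; exact: i1.
    by rewrite patch1// -integral_mkcond.
  rewrite indicE memNset// mul0r; under eq_integral do rewrite G0l//.
  by rewrite integral0.
have in2 s : (\int[mu]_t (G (t, s))%:E)%E =
    (\1_E2 s * Rintegral mu E1 (fun t => F (t, s)))%:E.
  have [Es|Es] := pselect (E2 s).
    rewrite indicE mem_set// mul1r fineK; last by apply: integrable_fin_num => //; exact: i2.
    by rewrite patch2// -integral_mkcond.
  rewrite indicE memNset// mul0r; under eq_integral do rewrite G0r//.
  by rewrite integral0.
have e1 : (\int[mu]_t \int[mu]_s (EFin \o G) (t, s))%E =
    (\int[mu]_(t in E1) (Rintegral mu E2 (fun s => F (t, s)))%:E)%E.
  rewrite [RHS]integral_mkcond; apply: eq_integral => t _ /=; rewrite in1 patchE.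
  by rewrite indicE; case: (t \in E1); rewrite ?mul1r ?mul0r.
have e2 : (\int[mu]_s \int[mu]_t (EFin \o G) (t, s))%E =
    (\int[mu]_(s in E2) (Rintegral mu E1 (fun t => F (t, s)))%:E)%E.
  rewrite [RHS]integral_mkcond; apply: eq_integral => t _ /=; rewrite in2 patchE.
  by rewrite indicE; case: (t \in E2); rewrite ?mul1r ?mul0r.
have gfin : (\int[mu]_(s in E2) `|(g s)%:E| < +oo)%E by case/integrableP : gi.
have Gi : (mu \x mu)%E.-integrable setT (EFin \o G).
  apply/(@integrable12ltyP _ _ _ _ R mu mu (EFin \o G) mEG).
  apply: (@le_lt_trans _ _ (\int[mu]_t (\1_E1 t)%:E * \int[mu]_(s in E2) `|(g s)%:E|)%E).
    rewrite -ge0_integralZr//; last 2 first.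
    - by apply/measurable_EFinP; exact: measurable_indic.
    - exact: integral_ge0.
    apply: ge0_le_integral => //.
    - by move=> t _; exact: integral_ge0.
    - apply: (measurable_fun_fubini_tonelli_F (m2 := mu) (abse \o (EFin \o G))) => //.
        exact: measurableT_comp.
      by move=> z; exact: abse_ge0.
    - apply: emeasurable_funM => //.
      by apply/measurable_EFinP; exact: measurable_indic.
    move=> t _; have [Et|Et] := pselect (E1 t); last first.
      rewrite indicE memNset// mul0e.
      by under eq_integral do rewrite /= G0l// normr0; rewrite integral0.
    rewrite indicE mem_set// mul1e [leRHS]integral_mkcond.
    apply: ge0_le_integral => //.
    - by apply: measurableT_comp => //; apply: measurableT_comp.
    - have mg : measurable_fun E2 (fun x => `|(g x)%:E|%E).
        by apply: measurableT_comp => //; case/integrableP : gi.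
      exact: ((measurable_restrictT _ mE2).1 mg).
    move=> s _; rewrite patchE; have [Es|Es] := pselect (E2 s).
      by rewrite mem_set//= lee_fin G1//; apply: le_trans (Fg _ _ Et Es) (ler_norm _).
    by rewrite memNset//= G0r// normr0.
  rewrite integral_indic// setIT lte_mul_pinfty//.
  by rewrite ge0_fin_numE.
rewrite /Rintegral -[in LHS]e1 -[in RHS]e2; congr fine.
exact: (Fubini (m1 := mu) (m2 := mu) Gi).
Qed.

End parametric_integrals.

(** * Domination of the Fejer convolution by the maximal function *)

Section fejer_convolution.
Context {R : realType}.
Local Notation C := (R[i]).
Local Notation mu := (@lebesgue_measure R).
Implicit Types (f g h : R -> C) (d t u x : R).

(** An integral over the whole line, which converges absolutely wherever [maximal f x] is finite.
    For [f] in X this is almost everywhere, so the operator is given directly on X. *)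
Definition fejer_conv d f x : C := cint setT (fun y => creal (fejer d (x - y)) * f y).

Lemma measurable_fejerB d x : 0 < d -> measurable_fun setT (fun y : R => fejer d (x - y)).
Proof.
move=> d0; apply: measurableT_comp; first exact: measurable_fejer.
by apply: measurable_funB => //; exact: measurable_cst.
Qed.

Lemma cmeasurable_fejer_conv d f : 0 < d -> cmeasurable f -> cmeasurable (fejer_conv d f).
Proof.
move=> d0 [fr fi].
have h (r : R -> R) : measurable_fun setT r ->
    measurable_fun setT (fun x => Rintegral mu setT (fun y => fejer d (x - y) * r y)).
  move=> mr; apply: (@measurable_param_Rintegral R (fun z => fejer d (z.1 - z.2) * r z.2)).
  apply: measurable_funM; last exact: (measurableT_comp mr (measurable_snd)).
  apply: measurableT_comp; first exact: measurable_fejer.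
  by apply: measurable_funB; [exact: measurable_fst|exact: measurable_snd].
split.
  rewrite (_ : _ \o _ = (fun x => Rintegral mu setT (fun y => fejer d (x - y) * (cRe \o f) y))).
    exact: h.
  by apply/funext => x /=; apply: eq_Rintegral => y _ /=; rewrite cReMr.
rewrite (_ : _ \o _ = (fun x => Rintegral mu setT (fun y => fejer d (x - y) * (cIm \o f) y))).
  exact: h.
by apply/funext => x /=; apply: eq_Rintegral => y _ /=; rewrite cImMr.
Qed.

Let ball_itv x n : set R := `[x - 2 ^+ n, x + 2 ^+ n]%classic.

Let ball_itv_le x : nondecreasing_seq (ball_itv x).
Proof.
move=> n m nm; rewrite subsetEset => y; rewrite /ball_itv /= !in_itv /= => /andP[a b].
have le : 2 ^+ n <= 2 ^+ m :> R by rewrite ler_eXn2l ?ltr1n.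
by apply/andP; split; lra.
Qed.

Let bigcup_ball_itv x : \bigcup_n ball_itv x n = setT.
Proof.
apply/seteqP; split => // y _.
have lt2 m : m%:R < 2 ^+ m :> R by rewrite -natrX ltr_nat ltn_expl.
pose n := Num.bound (`|x - y|).
have nP : `|x - y| < n%:R by exact: archi_boundP.
have := lt_trans nP (lt2 n); rewrite ltr_norml => /andP[a b].
by exists n => //; rewrite /ball_itv /= in_itv /=; apply/andP; split; lra.
Qed.

(* Dyadic annuli around [x]: on the n-th one the kernel is at most [C 4^-n],
   so the contributions are dominated by a geometric series times [M f x]. *)
Let fejer_annuli d (D : R) f x n : 0 < d -> cmeasurable f ->
  (forall u, `|fejer d u| <= D) -> (forall u, `|fejer d u| * u ^+ 2 <= D) ->
  (maximal f x < +oo)%E ->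
  (\int[mu]_(y in ball_itv x n) (`|fejer d (x - y)| * cnorm (f y))%:E <=
   (D * fine (maximal f x) * (10 - 8 / 2 ^+ n))%:E)%E.
Proof.
move=> d0 mf kD kD2 Mfin.
have D0 : 0 <= D by apply: le_trans (kD 0); exact: normr_ge0.
have M0 : 0 <= fine (maximal f x) by rewrite fine_ge0// maximal_ge0.
have p2 m : 0 < 2 ^+ m :> R by rewrite exprn_gt0.
have mn : measurable_fun setT (cnorm \o f) by case: (nonneg_mfun_cnorm mf).
have mw : measurable_fun setT (fun y : R => (`|fejer d (x - y)| * cnorm (f y))%:E).
  apply/measurable_EFinP; apply: measurable_funM => //.
  by apply: measurableT_comp => //; exact: measurable_fejerB.
have w0 y : (0 <= (`|fejer d (x - y)| * cnorm (f y))%:E)%E.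
  by rewrite lee_fin mulr_ge0 ?cnorm_ge0.
have xb m : x - 2 ^+ m <= x <= x + 2 ^+ m by have := p2 m; move=> h; apply/andP; split; lra.
have bb m : x - 2 ^+ m < x + 2 ^+ m by have := p2 m; lra.
(* A kernel bound on a piece of the m-th interval costs the length [2 * 2 ^+ m] of that interval
   times M f x. *)
have step (E : set R) (B : R) m : measurable E -> 0 <= B -> E `<=` ball_itv x m ->
    (forall y, E y -> `|fejer d (x - y)| <= B) ->
    (\int[mu]_(y in E) (`|fejer d (x - y)| * cnorm (f y))%:E <=
    (B * (2 * 2 ^+ m * fine (maximal f x)))%:E)%E.
  move=> mE B0 Em EB.
  apply: (@le_trans _ _ (\int[mu]_(y in E) (B%:E * (cnorm (f y))%:E))%E).
    apply: ge0_le_integral => //.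
    - exact: measurable_funTS.
    - by apply: measurable_funeM; apply/measurable_EFinP; exact: measurable_funTS.
    - by move=> y Ey; rewrite -EFinM lee_fin ler_wpM2r ?cnorm_ge0 ?EB.
  rewrite ge0_integralZl_EFin//; last 2 first.
  - by move=> y _; rewrite lee_fin cnorm_ge0.
  - by apply/measurable_EFinP; exact: measurable_funTS.
  rewrite EFinM lee_wpmul2l//.
  have := maximal_integral_le mE mf (bb m) (xb m) Em Mfin.
  by rewrite (_ : _ - _ = 2 * 2 ^+ m)//; ring.
(* Up to the factor D M f x, the first interval contributes 2 and the n-th annulus 4^-n * 2 *
   2^(n+1) = 4 / 2^n. The partial sums are 10 - 8 / 2^n. *)
elim: n => [|n ih].
  apply: le_trans (step _ D 0%N _ D0 _ _) _ => //.
  - exact: measurable_itv.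
  - by rewrite lee_fin expr0; lra.
have mb m : measurable (ball_itv x m) by exact: measurable_itv.
have bS : ball_itv x n.+1 = ball_itv x n `|` (ball_itv x n.+1 `\` ball_itv x n).
  by rewrite setDUK// -subsetEset; exact: ball_itv_le.
rewrite bS ge0_integral_setU//; last 4 first.
- exact: mb.
- by apply: measurableD; exact: mb.
- exact: measurable_funTS.
- by apply/disj_set2P; rewrite setDE setICA setICr setI0.
have B0 : 0 <= D / (2 ^+ n * 2 ^+ n) by rewrite divr_ge0// mulr_ge0// ltW.
have out y : (ball_itv x n.+1 `\` ball_itv x n) y ->
    `|fejer d (x - y)| <= D / (2 ^+ n * 2 ^+ n).
  move=> [_ nb]; rewrite ler_pdivlMr ?mulr_gt0//.
  apply: le_trans (kD2 (x - y)); rewrite ler_wpM2l//.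
  rewrite -(real_normK (num_real (x - y))) expr2.
  have le : 2 ^+ n <= `|x - y|.
    rewrite leNgt; apply/negP => lt; apply: nb; rewrite /ball_itv /= in_itv /=.
    by move: lt; rewrite ltr_norml => /andP[a b]; apply/andP; split; lra.
  by rewrite ler_pM// ltW.
apply: le_trans (leeD ih (step _ _ n.+1 _ B0 _ out)) _.
- by apply: measurableD; exact: mb.
- exact: subDsetl.
rewrite -EFinD lee_fin exprS.
rewrite (_ : D / _ * _ = D * fine (maximal f x) * (4 / 2 ^+ n)); last by field; rewrite gt_eqF.
rewrite -mulrDr (_ : 8 / (2 * 2 ^+ n) = 4 / 2 ^+ n); last by field; rewrite gt_eqF.
by rewrite ler_wpM2l ?mulr_ge0//; lra.
Qed.

(** Monotone convergence over the intervals of [fejer_annuli], whose bounds stay below 10 D M f x;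
    [cnorm_cint_le] adds a factor 2. *)
Lemma fejer_conv_maximal d : 0 < d -> exists2 A : R, 0 <= A & forall f x,
  cmeasurable f -> (maximal f x < +oo)%E ->
  mu.-integrable setT (EFin \o (fun y => `|fejer d (x - y)| * cnorm (f y))) /\
  cnorm (fejer_conv d f x) <= A * fine (maximal f x).
Proof.
(* A single constant dominating both the size bound [fejer_le2] and the decay bound
   [fejer_decay]. *)
move=> d0; pose D : R := 2 + 4 / d ^+ 2.
have D4 : 0 <= 4 / d ^+ 2 by rewrite divr_ge0// exprn_ge0// ltW.
have D0 : 0 <= D by rewrite addr_ge0.
have kD u : `|fejer d u| <= D by apply: le_trans (fejer_le2 u d0) _; rewrite lerDl.
have kD2 u : `|fejer d u| * u ^+ 2 <= D.
  by apply: le_trans (fejer_decay u d0) _; rewrite lerDr.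
exists (2 * (D * 10)); first by rewrite !mulr_ge0.
move=> f x mf Mfin.
have M0 : 0 <= fine (maximal f x) by rewrite fine_ge0// maximal_ge0.
have mn : measurable_fun setT (cnorm \o f) by case: (nonneg_mfun_cnorm mf).
have mw : measurable_fun setT (fun y : R => `|fejer d (x - y)| * cnorm (f y)).
  apply: measurable_funM => //.
  by apply: measurableT_comp => //; exact: measurable_fejerB.
have w0 y : (0 <= (`|fejer d (x - y)| * cnorm (f y))%:E)%E.
  by rewrite lee_fin mulr_ge0 ?cnorm_ge0.
have bound : (\int[mu]_y (`|fejer d (x - y)| * cnorm (f y))%:E <=
    (D * 10 * fine (maximal f x))%:E)%E.
  rewrite -(bigcup_ball_itv x).
  have cv : (\int[mu]_(y in ball_itv x n) (`|fejer d (x - y)| * cnorm (f y))%:E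
      @[n --> \oo] --> \int[mu]_(y in \bigcup_n ball_itv x n)
      (`|fejer d (x - y)| * cnorm (f y))%:E)%E.
    apply: ge0_nondecreasing_set_cvg_integral => //.
    - by move=> n; exact: measurable_itv.
    - by move=> n; apply/measurable_EFinP; exact: measurable_funTS.
  apply: (cvge_to_le cv).
  - apply: nearW => n; apply: le_trans (fejer_annuli n d0 mf kD kD2 Mfin) _.
    rewrite lee_fin [leRHS]mulrAC ler_wpM2l ?mulr_ge0//.
    by rewrite gerBl divr_ge0// exprn_ge0.
have wi : mu.-integrable setT (EFin \o (fun y => `|fejer d (x - y)| * cnorm (f y))).
  apply/integrableP; split; first exact/measurable_EFinP.
  under eq_integral do rewrite /= ger0_norm ?mulr_ge0 ?cnorm_ge0//.
  by apply: le_lt_trans bound _; rewrite ltry.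
split => //.
have e : (cnorm \o (fun y => creal (fejer d (x - y)) * f y)) =
    (fun y => `|fejer d (x - y)| * cnorm (f y)).
  by apply/funext => y /=; rewrite cnormM cnorm_creal.
apply: le_trans (cnorm_cint_le measurableT _ _) _.
- by apply: cmeasurableM => //; apply: cmeasurable_creal; exact: measurable_fejerB.
- by rewrite e.
rewrite -mulrA ler_pM2l// e -lee_fin /Rintegral fineK//.
exact: integrable_fin_num.
Qed.

Lemma fejer_conv_integrable d f x : 0 < d -> cmeasurable f -> (maximal f x < +oo)%E ->
  cintegrable setT (fun y => creal (fejer d (x - y)) * f y).
Proof.
move=> d0 mf Mfin; have [A _ /(_ f x mf Mfin)[wi _]] := fejer_conv_maximal d0.
apply: (cintegrable_le _ _ wi) => //.
  by apply: cmeasurableM => //; apply: cmeasurable_creal; exact: measurable_fejerB.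
by move=> y _; rewrite cnormM cnorm_creal.
Qed.

End fejer_convolution.

(** * The Fourier convolution with the triangle symbol is the Fejer convolution *)

Section fourier_fejer.
Context {R : realType}.
Local Notation C := (R[i]).
Local Notation mu := (@lebesgue_measure R).
Local Notation ae_eq := (@Defs.ae_eq R).
Implicit Types (f g h : R -> C) (d t u x s : R).

Lemma cnorm_cexpi s : cnorm (cexpi s) = 1.
Proof. by rewrite /cnorm /= cos2Dsin2 sqrtr1. Qed.

Lemma cexpiD s t : cexpi (s + t) = cexpi s * cexpi t.
Proof. by apply: complex_ext; rewrite ?cReM ?cImM /= ?cosD ?sinD//; ring. Qed.

Lemma cmeasurable_cexpi (F : R -> R) : measurable_fun setT F ->
  cmeasurable (fun x => cexpi (F x)).
Proof.
move=> mF; split; apply: measurableT_comp => //; apply: continuous_measurable.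
  exact: continuous_cos.
exact: continuous_sin.
Qed.

Definition cfejer d t : C := creal (fejer_symbol d t).

Lemma cmeasurable_cfejer d : cmeasurable (cfejer d).
Proof.
apply: cmeasurable_creal; apply: continuous_measurable; exact: continuous_fejer_symbol.
Qed.

Lemma cnorm_cfejer_le d t : 0 < d -> cnorm (cfejer d t) <= 2 * pi / d.
Proof.
move=> d0; rewrite /cfejer cnorm_creal ger0_norm ?fejer_symbol_le//.
exact: fejer_symbol_ge0.
Qed.

Lemma mu_itv_fin (a b : R) : (mu `[a, b]%classic < +oo)%E.
Proof. by rewrite lebesgue_measure_itv /=; case: ifP => // _; rewrite -EFinB ltry. Qed.

Lemma integrable_cst_itv (a b r : R) : mu.-integrable `[a, b] (EFin \o (fun=> r)).
Proof.
apply: measurable_bounded_integrable => //; first exact: mu_itv_fin.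
by exists `|r|; split => // y gy t _ /=; exact: ltW.
Qed.

(** For [d <= 1] the symbol is supported in the fixed interval from -1 to 1, so truncation at 1 of
    the inverse transform is already exact. *)
Lemma cint_cfejer d u : 0 < d -> d <= 1 ->
  cint `[- 1, 1] (fun t => cfejer d t * cexpi (t * u)) = creal (2 * pi * fejer d u).
Proof.
move=> d0 d1; rewrite (@cint_support _ `[- d, d]%classic).
- apply: complex_ext.
    rewrite /= -fejer_symbol_cos//; apply: eq_Rintegral => t _ /=.
    by rewrite mul0r subr0.
  rewrite /= -(fejer_symbol_sin u d0); apply: eq_Rintegral => t _ /=.
  by rewrite mul0r addr0.
- by move=> t /=; rewrite !in_itv /= => /andP[a b]; apply/andP; split; lra.
move=> t _ /=; rewrite in_itv /= -ler_norml => /negP; rewrite -ltNge => /ltW dt.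
by rewrite /cfejer fejer_symbol_out// creal0 mul0r.
Qed.

Lemma measurable_param_Rintegral_on (E : set R) (F : R * R -> R) : measurable E ->
  measurable_fun setT F -> measurable_fun setT (fun x => Rintegral mu E (fun y => F (x, y))).
Proof.
move=> mE mF.
rewrite (_ : (fun x => _) = fun x => Rintegral mu setT (fun y => \1_E y * F (x, y))).
  apply: (@measurable_param_Rintegral R (fun z => \1_E z.2 * F z)).
  apply: measurable_funM => //.
  by apply: measurableT_comp (measurable_snd); exact: measurable_indic.
apply/funext => x; rewrite Rintegral_mkcond; apply: eq_Rintegral => y _.
by rewrite patchE indicE; case: (y \in E); rewrite ?mul1r ?mul0r.
Qed.

Let cmeas2 (F : R * R -> C) := measurable_fun setT (cRe \o F) /\ measurable_fun setT (cIm \o F).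

Let cmeas2M F G : cmeas2 F -> cmeas2 G -> cmeas2 (fun z => F z * G z).
Proof.
move=> [Fr Fi] [Gr Gi]; split.
  rewrite (_ : _ \o _ = (fun x : R * R => (cRe \o F) x * (cRe \o G) x
    - (cIm \o F) x * (cIm \o G) x)); last by apply/funext => x /=; rewrite cReM.
  by apply: measurable_funB; apply: measurable_funM.
rewrite (_ : _ \o _ = (fun x : R * R => (cRe \o F) x * (cIm \o G) x
    + (cIm \o F) x * (cRe \o G) x)); last by apply/funext => x /=; rewrite cImM.
by apply: measurable_funD; apply: measurable_funM.
Qed.

Let cmeas2_snd f : cmeasurable f -> cmeas2 (fun z => f z.2).
Proof. by move=> [fr fi]; split; [exact: (measurableT_comp fr (measurable_snd))|exact: (measurableT_comp fi (measurable_snd))]. Qed.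

Let cmeas2_fst f : cmeasurable f -> cmeas2 (fun z => f z.1).
Proof. by move=> [fr fi]; split; [exact: (measurableT_comp fr (measurable_fst))|exact: (measurableT_comp fi (measurable_fst))]. Qed.

Let cmeas2_cexpi : cmeas2 (fun z => cexpi (z.2 * z.1)).
Proof.
have m : measurable_fun setT (fun z : R * R => z.2 * z.1).
  by apply: measurable_funM; [exact: measurable_snd|exact: measurable_fst].
split; apply: measurableT_comp => //; apply: continuous_measurable.
  exact: continuous_cos.
exact: continuous_sin.
Qed.

Lemma cint_Fubini (F : R * R -> C) (g : R -> R) (E1 E2 : set R) :
  measurable E1 -> measurable E2 -> (mu E1 < +oo)%E -> cmeas2 F ->
  mu.-integrable E2 (EFin \o g) ->
  (forall t s, E1 t -> E2 s -> cnorm (F (t, s)) <= g s) ->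
  cint E1 (fun t => cint E2 (fun s => F (t, s))) =
  cint E2 (fun s => cint E1 (fun t => F (t, s))).
Proof.
move=> mE1 mE2 E1f [Fr Fi] gi Fg; apply: complex_ext.
  apply: (@Rintegral_Fubini R (cRe \o F) g) => // t s Et Es.
  exact: le_trans (normr_cRe _) (Fg _ _ Et Es).
apply: (@Rintegral_Fubini R (cIm \o F) g) => // t s Et Es.
exact: le_trans (normr_cIm _) (Fg _ _ Et Es).
Qed.

Section truncated_transforms.
Variables (f : R -> C) (d : R).
Hypothesis mf : cmeasurable f.
Hypothesis fi : forall N : nat, mu.-integrable `[- N%:R, N%:R] (EFin \o (cnorm \o f)).
Hypothesis d0 : 0 < d.
Hypothesis d1 : d <= 1.

Let mE (a b : R) : measurable (`[a, b]%classic : set R).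
Proof. exact: measurable_itv. Qed.

Lemma cmeasurable_fourier_trunc N : cmeasurable (fourier_trunc f N).
Proof.
have [h1 h2] := cmeas2M (cmeas2_snd mf) cmeas2_cexpi.
by split; [exact: (measurable_param_Rintegral_on _ h1)|exact: (measurable_param_Rintegral_on _ h2)].
Qed.

Let fexp_integrable N t : cintegrable `[- N%:R, N%:R] (fun s => f s * cexpi (s * t)).
Proof.
apply: (cintegrable_le _ _ (fi N)) => //.
  apply: cmeasurableM => //; apply: cmeasurable_cexpi.
  by apply: measurable_funM => //; exact: measurable_cst.
by move=> s _; rewrite cnormM cnorm_cexpi mulr1.
Qed.

Lemma fourier_trunc_bounded N t : cnorm (fourier_trunc f N t) <=
  2 * Rintegral mu `[- N%:R, N%:R] (cnorm \o f).
Proof.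
have mg : cmeasurable (fun s => f s * cexpi (s * t)).
  apply: cmeasurableM => //; apply: cmeasurable_cexpi.
  by apply: measurable_funM => //; exact: measurable_cst.
have e : cnorm \o (fun s => f s * cexpi (s * t)) = cnorm \o f.
  by apply/funext => s /=; rewrite cnormM cnorm_cexpi mulr1.
have := cnorm_cint_le (mE (- N%:R) N%:R) mg; rewrite e => h; exact: h (fi N).
Qed.

(** Both variables range over bounded intervals, so Fubini applies. The frequency integral yields 2
    pi times the kernel, and 2 pi cancels against the factor of the inverse transform. *)
Lemma invfourier_fejer_trunc N x :
  invfourier_trunc (fun t => cfejer d t * fourier_trunc f N t) 1 x =
  cint `[- N%:R, N%:R] (fun s => creal (fejer d (x - s)) * f s).
Proof.
pose Psi (z : R * R) : C := cfejer d z.1 * cexpi (- (z.1 * x)) * (f z.2 * cexpi (z.2 * z.1)).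
rewrite /invfourier_trunc; set E := `[- N%:R, N%:R]%classic.
have -> : cint `[- 1%:R, 1%:R] (fun t => cfejer d t * fourier_trunc f N t * cexpi (- (t * x))) =
    cint `[- 1%:R, 1%:R] (fun t => cint E (fun s => Psi (t, s))).
  apply: eq_cint => t _; by rewrite mulrAC /fourier_trunc -cintZ.
have mxp : cmeasurable (fun t => cexpi (- (t * x))).
  apply: cmeasurable_cexpi; apply: (@measurableT_comp _ _ _ _ _ _ (fun y : R => - y)).
    by apply: continuous_measurable => y; exact: opp_continuous.
  by apply: measurable_funM => //; exact: measurable_cst.
have mPsi : cmeas2 Psi.
  apply: (@cmeas2M (fun z => cfejer d z.1 * cexpi (- (z.1 * x)))).
    apply: (@cmeas2_fst (fun t => cfejer d t * cexpi (- (t * x)))).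
    by apply: cmeasurableM => //; exact: cmeasurable_cfejer.
  exact: cmeas2M (cmeas2_snd mf) cmeas2_cexpi.
have ig : mu.-integrable E (EFin \o (fun s => 2 * pi / d * cnorm (f s))).
  exact: (integrableZl (mu := mu) (mE _ _) (2 * pi / d) (fi N)).
rewrite (cint_Fubini (g := fun s => 2 * pi / d * cnorm (f s)))//; last 3 first.
- exact: mE.
- exact: mu_itv_fin.
- move=> t s _ _; rewrite /Psi /= !cnormM !cnorm_cexpi !mulr1 ler_wpM2r ?cnorm_ge0//.
  exact: cnorm_cfejer_le.
(* The two exponentials combine to the frequency integral at [s - x]; the kernel is even. *)
have inner s : cint `[- 1%:R, 1%:R] (fun t => Psi (t, s)) = creal (2 * pi * fejer d (x - s)) * f s.
  rewrite (@eq_cint _ _ _ (fun t => f s * (cfejer d t * cexpi (t * (s - x))))).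
    rewrite cintZ//; first by rewrite cint_cfejer// mulrC -fejerN opprB.
    apply: (cintegrable_le _ _ (integrable_cst_itv _ _ (2 * pi / d))) => //.
      apply: cmeasurableM; first exact: cmeasurable_cfejer.
      by apply: cmeasurable_cexpi; apply: measurable_funM => //; exact: measurable_cst.
    by move=> t _; rewrite cnormM cnorm_cexpi mulr1 cnorm_cfejer_le.
  move=> t _; rewrite /Psi /= mulrBr cexpiD (mulrC s t); ring.
have i2 : cintegrable E (fun s => creal (2 * pi * fejer d (x - s)) * f s).
  apply: (cintegrable_le _ _ (integrableZl (mu := mu) (mE _ _) (2 * pi * 2) (fi N))) => //.
    apply: cmeasurableM => //; apply: cmeasurable_creal.
    by apply: measurable_funM; [exact: measurable_cst|exact: measurable_fejerB].
  move=> s _; rewrite cnormM cnorm_creal normrM ler_wpM2r ?cnorm_ge0//.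
  by rewrite ger0_norm ?mulr_ge0 ?pi_ge0// ler_wpM2l ?mulr_ge0 ?pi_ge0// fejer_le2.
rewrite (eq_cint (fun s _ => inner s)) -(cintZ _ (mE _ _) i2).
apply: eq_cint => s _; rewrite mulrA -crealM mulrA mulVf ?mul1r//.
by rewrite mulf_neq0// gt_eqF// pi_gt0.
Qed.

Lemma L2_limP (hN : nat -> R -> C) h : L2_lim hN h -> forall e, 0 < e ->
  exists N0, forall N, (N0 <= N)%N ->
    (\int[mu]_x ((cnorm (hN N x - h x)) ^+ 2)%:E <= e%:E)%E.
Proof.
move=> [_ /fine_cvgP[fin /cvgrPdist_le cv]] e e0.
have [N1 _ h1] := fin; have [N2 _ h2] := cv e e0.
exists (maxn N1 N2) => N; rewrite geq_max => /andP[/h1 /= fN /h2 /=].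
rewrite sub0r normrN => le; rewrite -(fineK fN) lee_fin.
exact: le_trans (ler_norm _) le.
Qed.

(** In place of Cauchy-Schwarz: w <= e + w^2 / e since (w - e)^2 >= 0, and integrating over length 2
    gives 2 e + e. *)
Let L1_bound (w : R -> R) (e : R) : 0 < e -> measurable_fun setT w ->
  (forall x, 0 <= w x) -> (\int[mu]_x (w x ^+ 2)%:E <= (e ^+ 2)%:E)%E ->
  mu.-integrable `[- 1, 1] (EFin \o w) /\ Rintegral mu `[- 1, 1] w <= 3 * e.
Proof.
move=> e0 mw w0 we.
have mw2 : measurable_fun setT (fun x => w x ^+ 2) by apply: measurable_funX.
have le : (\int[mu]_(x in `[(- 1)%R, 1%R]) (w x)%:E <= (3 * e)%:E)%E.
  apply: (@le_trans _ _ (\int[mu]_(x in `[(- 1)%R, 1%R]) (e%:E + (e^-1)%:E * (w x ^+ 2)%:E))%E).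
    apply: ge0_le_integral => //.
    - by move=> x _; rewrite lee_fin.
    - by apply/measurable_EFinP; exact: measurable_funTS.
    - apply: emeasurable_funD; first exact: measurable_cst.
      by apply: measurable_funeM; apply/measurable_EFinP; exact: measurable_funTS.
    move=> x _; rewrite -EFinM -EFinD lee_fin -(ler_pM2l e0) mulrDr mulVKf ?gt_eqF//.
    by have := sqr_ge0 (w x - e); have := w0 x; rewrite sqrrB !expr2; nra.
  rewrite ge0_integralD//; last 3 first.
  - by move=> x _; rewrite lee_fin ltW.
  - by move=> x _; rewrite -EFinM lee_fin mulr_ge0 ?invr_ge0 ?sqr_ge0// ltW.
  - by apply: measurable_funeM; apply/measurable_EFinP; exact: measurable_funTS.
  rewrite integral_cst//= lebesgue_measure_itv /= lte_fin ifT; last by lra.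
  rewrite ge0_integralZl_EFin ?invr_ge0 ?(ltW e0)//; last 2 first.
  - by move=> x _; rewrite lee_fin sqr_ge0.
  - by apply/measurable_EFinP; exact: measurable_funTS.
  rewrite (_ : (3 * e)%:E = (e * 2)%:E + (e^-1)%:E * (e ^+ 2)%:E)%E; last first.
    by rewrite -EFinM -EFinD; congr EFin; field; rewrite gt_eqF.
  apply: leeD; first by rewrite -EFinD -EFinM lee_fin ler_wpM2l ?(ltW e0)//; lra.
  apply: lee_wpmul2l; first by rewrite lee_fin invr_ge0 ltW.
  apply: le_trans we; apply: ge0_subset_integral => //.
  - exact/measurable_EFinP.
  - by move=> x _; rewrite lee_fin sqr_ge0.
have iw : mu.-integrable `[- 1, 1] (EFin \o w).
  apply/integrableP; split; first by apply/measurable_EFinP; exact: measurable_funTS.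
  under eq_integral do rewrite /= ger0_norm//.
  by apply: le_lt_trans le _; rewrite ltry.
by split => //; rewrite -lee_fin fineK//; exact: integrable_fin_num.
Qed.

(** Convergence in L^2 gives convergence in L^1 on the support of the bounded symbol, hence
    pointwise convergence of the inverse transforms at every [x]. *)
Lemma invfourier_fejer_cvg h x : L2_lim (fourier_trunc f) h -> forall e, 0 < e ->
  exists N0, forall N, (N0 <= N)%N ->
    cnorm (cint `[- N%:R, N%:R] (fun s => creal (fejer d (x - s)) * f s) -
      invfourier_trunc (fun t => cfejer d t * h t) 1 x) <= e.
Proof.
move=> hh e e0; have mh : cmeasurable h by case: hh.
have pi2 : 0 < 2 * pi :> R by rewrite mulr_gt0 ?pi_gt0.
have K0 : 0 < 2 * pi / d by rewrite divr_gt0.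
(* The final bound is (2 pi)^-1 * 2 * (2 pi / d) * 3 e' = (6 / d) e'. *)
pose e' := e / (6 / d).
have e'0 : 0 < e' by rewrite !divr_gt0.
have e'2 : 0 < e' ^+ 2 by rewrite exprn_gt0.
have [N0 NP] := L2_limP hh e'2; exists N0 => N /NP {}NP.
rewrite -invfourier_fejer_trunc /invfourier_trunc.
have mF := cmeasurable_fourier_trunc N.
have mu_ := cmeasurableB mF mh.
have [mw w0] := nonneg_mfun_cnorm mu_.
have [wi wle] := L1_bound e'0 mw w0 NP.
have mxp : cmeasurable (fun t => cexpi (- (t * x))).
  apply: cmeasurable_cexpi; apply: (@measurableT_comp _ _ _ _ _ _ (fun y : R => - y)).
    by apply: continuous_measurable => y; exact: opp_continuous.
  by apply: measurable_funM => //; exact: measurable_cst.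
have mG k : cmeasurable k -> cmeasurable (fun t => cfejer d t * k t * cexpi (- (t * x))).
  move=> mk; apply: cmeasurableM => //; apply: cmeasurableM => //; exact: cmeasurable_cfejer.
have nG (k : R -> C) t : cnorm (cfejer d t * k t * cexpi (- (t * x))) <= 2 * pi / d * cnorm (k t).
  by rewrite !cnormM cnorm_cexpi mulr1 ler_wpM2r ?cnorm_ge0 ?cnorm_cfejer_le.
pose B := 2 * Rintegral mu `[- N%:R, N%:R] (cnorm \o f).
have iF : cintegrable `[- 1, 1] (fun t => cfejer d t * fourier_trunc f N t * cexpi (- (t * x))).
  apply: (cintegrable_le _ _ (integrable_cst_itv _ _ (2 * pi / d * B))) => //; first exact: mG.
  move=> t _; apply: le_trans (nG _ _) _; rewrite ler_wpM2l ?(ltW K0)//.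
  exact: fourier_trunc_bounded.
have iH : cintegrable `[- 1, 1] (fun t => cfejer d t * h t * cexpi (- (t * x))).
  have ib := integrable_lin (2 * pi / d) (2 * pi / d * B) (mE (- 1) 1) wi
    (integrable_cst_itv (- 1) 1 1).
  apply: (cintegrable_le _ _ ib) => //; first exact: mG.
  move=> t _; apply: le_trans (nG _ _) _; rewrite mulr1 -mulrDr ler_wpM2l ?(ltW K0)//.
  rewrite (_ : h t = - (fourier_trunc f N t - h t) + fourier_trunc f N t); last by rewrite opprB subrK.
  apply: le_trans (cnormD _ _) _; rewrite cnormN lerD//; exact: fourier_trunc_bounded.
rewrite -mulrBr -cintB//.
rewrite (@eq_cint _ _ _ (fun t => cfejer d t * (fourier_trunc f N t - h t) * cexpi (- (t * x)))); last first.
  by move=> t _; ring.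
have pi2i : 0 <= (2 * pi)^-1 :> R by rewrite invr_ge0 ltW.
rewrite cnormM cnorm_creal (ger0_norm pi2i) mulrC ler_pdivrMr//.
have wi2 : mu.-integrable `[- 1, 1] (EFin \o (cnorm \o (fun t =>
    cfejer d t * (fourier_trunc f N t - h t) * cexpi (- (t * x))))).
  refine (integrable_le (mE _ _) _ (integrableZl (mu := mu) (mE _ _) (2 * pi / d) wi) _).
    by case: (nonneg_mfun_cnorm (mG _ mu_)).
  by move=> t _ /=; rewrite ger0_norm ?cnorm_ge0//; exact: (nG (fun t => fourier_trunc f N t - h t)).
apply: le_trans (cnorm_cint_le (mE _ _) (mG _ mu_) wi2) _.
apply: (@le_trans _ _ (2 * (2 * pi / d * (3 * e')))).
  rewrite ler_pM2l//; apply: (@le_trans _ _ (2 * pi / d * Rintegral mu `[- 1, 1] (fun x => cnorm (fourier_trunc f N x - h x)))).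
    rewrite -RintegralZl//; apply: le_Rintegral => //.
      exact: (integrableZl (mu := mu) (mE _ _) (2 * pi / d) wi).
    by move=> t _; exact: (nG (fun t => fourier_trunc f N t - h t)).
  by rewrite ler_wpM2l ?(ltW K0).
by rewrite /e' le_eqVlt; apply/orP; left; apply/eqP; field; rewrite gt_eqF.
Qed.

End truncated_transforms.

Lemma eventually_cst_lim (u : nat -> \bar R) (a b : \bar R) :
  u @ \oo --> a -> (forall N, (1 <= N)%N -> u N = b) -> b = a.
Proof.
move=> ua ub; apply: (cvg_unique (@ereal_hausdorff R) _ ua).
by apply: cvg_near_cst; exists 1%N => // N /= /ub ->.
Qed.

Lemma Rintegral_itv_cvg (r : R -> R) : mu.-integrable setT (EFin \o r) ->
  Rintegral mu `[- N%:R, N%:R] r @[N --> \oo] --> Rintegral mu setT r.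
Proof.
move=> ri; have mr : measurable_fun setT r by apply/measurable_EFinP; case/integrableP : ri.
have mI (N : nat) : measurable (`[- N%:R, N%:R]%classic : set R) by exact: measurable_itv.
have [] := @dominated_convergence _ _ R mu setT measurableT
   (fun N => EFin \o (r \_ `[- N%:R, N%:R])) (EFin \o r) (abse \o (EFin \o r)) _ _ _ _ _.
- move=> N; apply/measurable_EFinP.
  by apply/(measurable_restrictT _ (mI N)); exact: measurable_funTS.
- exact/measurable_EFinP.
- apply: aeW => x _; apply/fine_cvgP; split; first exact: nearW.
  apply: (@cvg_near_cst _ R^o) .
  exists (Num.bound `|x|) => // N /= hN; rewrite patchE mem_set//= in_itv /= -ler_norml.
  by apply: ltW; apply: lt_le_trans (archi_boundP (normr_ge0 x)) _; rewrite ler_nat.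
- exact: integrable_abse.
- apply: aeW => x N _ /=; rewrite lee_fin patchE; case: ifP => // _.
  by rewrite normr0.
move=> _ _ cv; apply: fine_cvg; rewrite fineK; last exact: integrable_fin_num.
apply: cvg_trans cv; apply: near_eq_cvg; apply: nearW => N /=.
rewrite [RHS]integral_mkcond; apply: eq_integral => x _ /=.
by rewrite !patchE; case: ifP.
Qed.

Lemma cint_itv_cvg (p : R -> C) : cintegrable setT p -> forall e, 0 < e ->
  exists N0, forall N, (N0 <= N)%N -> cnorm (cint `[- N%:R, N%:R] p - cint setT p) <= e.
Proof.
move=> [/Rintegral_itv_cvg/cvgrPdist_le pr /Rintegral_itv_cvg/cvgrPdist_le pi] e e0.
have [N1 _ h1] := pr _ (divr2_gt0 e0); have [N2 _ h2] := pi _ (divr2_gt0 e0).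
exists (maxn N1 N2) => N; rewrite geq_max => /andP[/h1 /= {}h1 /h2 /= {}h2].
rewrite cnormB; apply: le_trans (cnorm_le _) _; rewrite cReD cReN cImD cImN /=.
by rewrite (splitr e) lerD.
Qed.

(* [fejer_symbol] has compact support, so the inverse transform of
   [fejer_symbol * F f] is an absolutely convergent integral over [[-1, 1]], and
   Fubini turns it into the convolution with [fejer]; no Plancherel needed. *)
Lemma W0_cfejer d f g : 0 < d -> d <= 1 -> cmeasurable f ->
  (forall N : nat, mu.-integrable `[- N%:R, N%:R] (EFin \o (cnorm \o f))) ->
  {ae mu, forall x, (maximal f x < +oo)%E} ->
  W0 (cfejer d) f g -> ae_eq g (fejer_conv d f).
Proof.
move=> d0 d1 mf fi Mfin [h [hh gg]].
pose G := invfourier_trunc (fun t => cfejer d t * h t) 1.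
have GN N : (1 <= N)%N -> invfourier_trunc (fun t => cfejer d t * h t) N = G.
  move=> N1; apply/funext => x; rewrite /G /invfourier_trunc; congr (_ * _).
  apply: cint_support.
    move=> t /=; rewrite !in_itv /= => /andP[a b].
    have N1' : 1 <= N%:R :> R by rewrite ler1n.
    by apply/andP; split; lra.
  move=> t _ /=; rewrite in_itv /= -ler_norml => /negP; rewrite -ltNge => /ltW dt.
  by rewrite /cfejer fejer_symbol_out ?creal0 ?mul0r//; apply: le_trans d1 dt.
have Gcv x := @invfourier_fejer_cvg f d mf fi d0 d1 h x hh.
have mA N : cmeasurable (fun x => cint `[- N%:R, N%:R] (fun s => creal (fejer d (x - s)) * f s)).
  (* The truncated convolution is the convolution of the truncated function, whose measurability is
     known. *)
  rewrite (_ : (fun x => _) = fejer_conv d (fun s => creal (\1_(`[- N%:R, N%:R]%classic) s) * f s)).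
    apply: cmeasurable_fejer_conv => //; apply: cmeasurableM => //.
    by apply: cmeasurable_creal; apply: measurable_indic; exact: measurable_itv.
  apply/funext => x; rewrite /fejer_conv [RHS](@cint_support _ `[- N%:R, N%:R]%classic)//.
    by apply: eq_cint => s Es; rewrite indicE mem_set// creal1 mul1r.
  by move=> s _ Es; rewrite indicE memNset// creal0 mul0r mulr0.
have mG : cmeasurable G.
  split.
    apply: (@measurable_fun_cvg _ _ R setT (fun N => cRe \o (fun x =>
      cint `[- N%:R, N%:R] (fun s => creal (fejer d (x - s)) * f s)))) => //.
      by move=> N; case: (mA N).
    move=> x _; apply/cvgrPdist_le => e /(Gcv x)[N0 NP]; exists N0 => // N /= /NP; apply: le_trans.
    by rewrite cnormB; apply: le_trans (normr_cRe _); rewrite cReD cReN.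
  apply: (@measurable_fun_cvg _ _ R setT (fun N => cIm \o (fun x =>
    cint `[- N%:R, N%:R] (fun s => creal (fejer d (x - s)) * f s)))) => //.
    by move=> N; case: (mA N).
  move=> x _; apply/cvgrPdist_le => e /(Gcv x)[N0 NP]; exists N0 => // N /= /NP; apply: le_trans.
  by rewrite cnormB; apply: le_trans (normr_cIm _); rewrite cImD cImN.
(* The inverse truncations are constantly [G] for N >= 1 and converge to [g] in L^2, so G - g has
   zero L^2 norm. *)
have Gg : ae_eq G g.
  have [mg cg] := gg.
  have J0 : (\int[mu]_x ((cnorm (G x - g x)) ^+ 2)%:E = 0)%E.
    have e N : (1 <= N)%N -> (\int[mu]_x ((cnorm (invfourier_trunc
        (fun t => cfejer d t * h t)%R N x - g x)) ^+ 2)%:E)%E =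
        (\int[mu]_x ((cnorm (G x - g x)) ^+ 2)%:E)%E.
      by move=> N1; rewrite (GN N N1).
    exact: (eventually_cst_lim cg e).
  have [mn _] := nonneg_mfun_cnorm (cmeasurableB mG mg).
  have m2 : measurable_fun setT (fun x => ((cnorm (G x - g x)) ^+ 2)%:E).
    by apply/measurable_EFinP; apply: measurable_funX.
  have := (ae_eq_integral_abs mu measurableT m2).1.
  under eq_integral do rewrite /= ger0_norm ?sqr_ge0//.
  move=> /(_ J0); apply: aeS => x /(_ I) /= [] /eqP; rewrite sqrf_eq0 => /eqP.
  by move=> /cnorm0_eq0/eqP; rewrite subr_eq0 => /eqP.
(* Where M f is finite, the truncated convolutions converge both to [G x] and to the absolutely
   convergent integral [fejer_conv d f x]. *)
move: Gg Mfin; apply: aeS2 => x <- Mx.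
apply/eqP; rewrite -subr_eq0; apply/eqP/cnorm0_eq0/eqP.
rewrite eq_le cnorm_ge0 andbT; apply/ler_addgt0Pl => e e0; rewrite addr0.
have [N1 h1] := Gcv x _ (divr2_gt0 e0).
have [N2 h2] := cint_itv_cvg (fejer_conv_integrable d0 mf Mx) (divr2_gt0 e0).
have {}h1 := h1 _ (leq_maxl N1 N2); have {}h2 := h2 _ (leq_maxr N1 N2).
rewrite (splitr e); apply: le_trans (lerD h1 h2); rewrite [X in _ <= X + _]cnormB.
apply: le_trans (cnormD _ _); rewrite /G /fejer_conv addrA subrK lexx//.
Qed.

End fourier_fejer.

(** * Rank one operators in the algebra *)

Section symbols.
Context {R : realType}.
Local Notation C := (R[i]).

Lemma Cdot_compact_support (p : R -> R) (L : R) : continuous p ->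
  (forall x, L < `|x| -> p x = 0) -> Cdot (fun x => creal (p x)).
Proof.
move=> cp p0; split => //; split; first by move=> x; exact: cvg_cst.
have pp : p x @[x --> +oo%R] --> (0 : R).
  apply: cvg_near_cst; exists `|L|; split; first exact: num_real.
  by move=> x Lx; apply: p0; apply: le_lt_trans (ler_norm L) _; apply: lt_le_trans Lx (ler_norm x).
have pn : p x @[x --> -oo%R] --> (0 : R).
  apply: cvg_near_cst; exists (- `|L|); split; first exact: num_real.
  move=> x; rewrite ltrNr => Lx; apply: p0; apply: le_lt_trans (ler_norm L) _.
  by apply: lt_le_trans Lx _; rewrite -normrN ler_norm.
by exists 0; do !split => //; exact: cvg_cst.
Qed.

Lemma Cdot_cfejer d : 0 < d -> Cdot (cfejer d : R -> C).
Proof.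
move=> d0; apply: (@Cdot_compact_support _ d); first exact: continuous_fejer_symbol.
by move=> x /ltW; exact: fejer_symbol_out.
Qed.

(** Monotone reparametrisation of the triangle: its profile is 1 - |clamp y|. *)
Let clamp (y : R) := Num.max (- 1) (Num.min 1 y).

Let clamp_bounds y : - 1 <= clamp y <= 1.
Proof. by rewrite /clamp le_max lexx /= ge_max ge_min lexx /= andbT; lra. Qed.

Let clamp_le x y : x <= y -> clamp x <= clamp y.
Proof.
move=> xy; rewrite /clamp ge_max !le_max lexx /= ge_min le_min ge_min lexx /=.
by rewrite ge_min xy !orbT.
Qed.

Let max_clamp y : Num.max 0 (1 - `|y|) = 1 - `|clamp y|.
Proof.
rewrite /clamp; case: (leP 1 y) => h1.
  rewrite (max_r (_ : -1 <= 1 :> R)) ?normr1 ?ger0_norm ?max_l; lra.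
case: (leP (-1) y) => h2; last first.
  by rewrite normrN1 ltr0_norm ?max_l; lra.
by rewrite max_r// subr_ge0 ler_norml h2 ltW.
Qed.

(** The absolute value is 1-Lipschitz, so each increment is at most [K] times that of the monotone
    [clamp]. These telescope to at most 2. *)
Lemma bounded_variation_cfejer d : 0 < d -> Defs.bounded_variation (cfejer d : R -> C).
Proof.
move=> d0; pose K : R := 2 * pi / d.
have K0 : 0 <= K by rewrite !mulr_ge0 ?pi_ge0 ?invr_ge0// ltW.
exists (K * 2) => s sS; pose u i := K * clamp (nth 0 s i / d).
apply: (@le_trans _ _ (\sum_(i < (size s).-1) (u i.+1 - u i))).
  apply: ler_sum => i _; rewrite /cfejer -crealN -crealD cnorm_creal.
  have le : nth 0 s i <= nth 0 s i.+1.
    by apply: (sortedP _ sS); rewrite -ltn_predRL.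
  have sE t : fejer_symbol d t = K * (1 - `|clamp (t / d)|).
    by rewrite /fejer_symbol -max_clamp normrM normfV (gtr0_norm d0).
  rewrite !sE -mulrBr normrM (ger0_norm K0).
  rewrite /u -mulrBr ler_wpM2l// (_ : _ - _ - _ = `|clamp (nth 0 s i / d)| - `|clamp (nth 0 s i.+1 / d)|); last by ring.
  apply: le_trans (ler_dist_dist _ _) _; rewrite distrC ger0_norm// subr_ge0.
  by apply: clamp_le; rewrite ler_pM2r ?invr_gt0.
rewrite -(big_mkord xpredT (fun i => u i.+1 - u i)) telescope_sumr// /u -mulrBr ler_wpM2l//.
have /andP[_ h1] := clamp_bounds (nth 0 s (size s).-1 / d).
by have /andP[h2 _] := clamp_bounds (nth 0 s 0 / d); lra.
Qed.

End symbols.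

(** * Rank one operators with continuous data *)

Section compact_operators.
Context {R : realType} (rho : (R -> R) -> \bar R).
Hypothesis rhoP : banach_function_norm rho.
Hypothesis rho_maximal : maximal_bounded rho.
Local Notation C := (R[i]).
Local Notation mu := (@lebesgue_measure R).
Local Notation inX := (inX rho).
Local Notation Xnorm := (Xnorm rho).
Local Notation ae_eq := (@Defs.ae_eq R).
Local Notation dual := (dual_elt rho).
Local Notation dual_norm := (dual_norm rho).

Lemma maximal_ae_fin f : inX f -> {ae mu, forall x, (maximal f x < +oo)%E}.
Proof. by case: rho_maximal => c h /h[_ []]. Qed.

Lemma fejer_conv_bounded d : 0 < d -> exists2 c : R, 0 <= c & forall f, inX f ->
  inX (fejer_conv d f) /\ Xnorm (fejer_conv d f) <= c * Xnorm f.
Proof.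
move=> d0; have [A A0 AP] := @fejer_conv_maximal R d d0.
have [c c0 cP] := maximal_dominated rhoP rho_maximal.
exists (A * c); first exact: mulr_ge0.
move=> f fX; have [mf _] := fX; apply: (cP f (fejer_conv d f) A fX _ A0).
  exact: cmeasurable_fejer_conv.
by move=> x /(AP f x mf)[].
Qed.

Lemma bounded_op_fejer_conv d : 0 < d -> bounded_op rho (fejer_conv d).
Proof.
move=> d0; have [c c0 cP] := fejer_conv_bounded d0.
split; first by move=> f /cP[].
split; last by exists c => f /cP[].
move=> al f g fX gX; have [mf _] := fX; have [mg _] := gX.
move: (maximal_ae_fin fX) (maximal_ae_fin gX); apply: aeS2 => x Mf Mg.
rewrite /fejer_conv -cint_linear//.
- by apply: eq_cint => y _; ring.
- exact: fejer_conv_integrable.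
- exact: fejer_conv_integrable.
Qed.

Lemma inX_itv_integrable f (N : nat) : inX f ->
  mu.-integrable `[- N%:R, N%:R] (EFin \o (cnorm \o f)).
Proof.
move=> fX; have mI : measurable (`[- N%:R, N%:R]%classic : set R) by exact: measurable_itv.
by have [] := inX_integrable rhoP mI (mu_itv_fin _ _) fX.
Qed.

Lemma W0_cfejer_inX d f g : 0 < d -> d <= 1 -> inX f -> W0 (cfejer d) f g ->
  ae_eq g (fejer_conv d f).
Proof.
move=> d0 d1 fX; have [mf _] := fX; apply: W0_cfejer => //.
  by move=> N; exact: inX_itv_integrable.
exact: maximal_ae_fin.
Qed.

Lemma W0_cmeasurable (a f g : R -> C) : W0 a f g -> cmeasurable g.
Proof. by move=> [h [_ []]]. Qed.

Lemma multiplier_cfejer d : 0 < d -> d <= 1 -> multiplier rho (cfejer d).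
Proof.
move=> d0 d1; have [c c0 cP] := fejer_conv_bounded d0.
split.
  split; first exact: cmeasurable_cfejer.
  by exists (2 * pi / d); apply: aeW => x; exact: cnorm_cfejer_le.
have h f g : inX f -> W0 (cfejer d) f g -> inX g /\ Xnorm g = Xnorm (fejer_conv d f).
  move=> fX Wg.
  exact: (inX_ae_eq rhoP (W0_cmeasurable Wg) (cP _ fX).1 (W0_cfejer_inX d0 d1 fX Wg)).
split; first by move=> f g _ fX /(h _ _ fX)[].
by exists c => f g _ fX /(h _ _ fX)[_ ->]; exact: (cP _ fX).2.
Qed.

(** The symbol is continuous of bounded variation and serves as its own approximation. What is left
    is to see that the zero symbol has multiplier norm 0. *)
Lemma CX_cfejer d : 0 < d -> d <= 1 -> CX rho (cfejer d).
Proof.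
move=> d0 d1; split; first exact: multiplier_cfejer.
move=> e e0; exists (cfejer d); split; first exact: Cdot_cfejer.
split; first exact: bounded_variation_cfejer.
split; first exact: multiplier_cfejer.
move=> f g _ fX [h [_ [mg cg]]].
(* Every truncated inverse transform of the zero symbol is 0, so its L^2 limit [g] has norm 0. *)
have g0 : (\int[mu]_x ((cnorm (0 - g x)) ^+ 2)%:E = 0)%E.
  apply: (eventually_cst_lim cg) => N _; apply: eq_integral => x _.
  congr ((cnorm (_ - _)) ^+ 2)%:E; rewrite /invfourier_trunc.
  rewrite (@eq_cint _ _ _ (fun=> 0)); first by rewrite cint0 mulr0.
  by move=> t _; rewrite subrr !mul0r.
have gae : ae_eq g (fun=> 0).
  have [mn _] := nonneg_mfun_cnorm (cmeasurableB (cmeasurable_cst 0) mg).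
  have m2 : measurable_fun setT (fun x => ((cnorm (0 - g x)) ^+ 2)%:E).
    by apply/measurable_EFinP; apply: measurable_funX.
  have := (ae_eq_integral_abs mu measurableT m2).1.
  under eq_integral do rewrite /= ger0_norm ?sqr_ge0//.
  move=> /(_ g0); apply: aeS => x /(_ I) /= [] /eqP; rewrite sqrf_eq0 => /eqP.
  by move=> /cnorm0_eq0/eqP; rewrite sub0r oppr_eq0 => /eqP.
have [_ ->] := inX_ae_eq rhoP mg (inX0 rhoP).1 gae.
by rewrite (inX0 rhoP).2 mulr_ge0// ?(Xnorm_ge0 rhoP fX.1)// ltW.
Qed.

Lemma alg_generator_fejer_conv d : 0 < d -> d <= 1 -> alg_generator rho (fejer_conv d).
Proof.
move=> d0 d1; right; exists (cfejer d); split; first exact: CX_cfejer.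
split; first exact: bounded_op_fejer_conv.
move=> f g _ fX Wg; have := W0_cfejer_inX d0 d1 fX Wg.
by apply: aeS => x ->.
Qed.

Definition rank_one (a : R -> C) (phi : (R -> C) -> C) : op := fun f x => phi f * a x.

Lemma bounded_op_rank_one a phi : inX a -> dual phi -> bounded_op rho (rank_one a phi).
Proof.
move=> aX dphi; split; first by move=> f fX; case: (inXZ rhoP (phi f) aX).
split.
  by move=> al f g fX gX; apply: aeW => x; rewrite /rank_one dphi.1//; ring.
exists (dual_norm phi * Xnorm a) => f fX; apply: le_trans (inXZ rhoP (phi f) aX).2 _.
rewrite mulrAC ler_wpM2r ?(Xnorm_ge0 rhoP aX.1)//; exact: dual_normP.
Qed.

(** Split the difference as phin (x) (an - a) + (phin - phi) (x) a. *)
Lemma rank_one_cvg (an : nat -> R -> C) a (phin : nat -> (R -> C) -> C) phi :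
  inX a -> (forall n, inX (an n)) -> dual phi ->
  (forall e, 0 < e -> exists N, forall n, (N <= n)%N -> Xnorm (fun x => an n x - a x) <= e) ->
  (forall e, 0 < e -> exists N, forall n, (N <= n)%N -> forall f, inX f ->
    cnorm (phin n f - phi f) <= e * Xnorm f) ->
  op_cvg rho (fun n => rank_one (an n) (phin n)) (rank_one a phi).
Proof.
move=> aX anX dphi ana phinphi e e0.
have a0 := Xnorm_ge0 rhoP aX.1; have p0 := dual_norm_ge0 rhoP dphi.
pose K := dual_norm phi + 1 + Xnorm a + 1.
have K0 : 0 < K by rewrite /K; lra.
(* The bound by 1 keeps the norm of [phin n] below [dual_norm phi + 1]; the other makes the two
   error terms add up to at most [e]. *)
pose e1 := Num.min 1 (e / K).
have e10 : 0 < e1 by rewrite lt_min ltr01 divr_gt0.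
have [N1 h1] := ana e1 e10; have [N2 h2] := phinphi e1 e10.
exists (maxn N1 N2) => n; rewrite geq_max => /andP[/h1 {}h1 /h2 {}h2] f fX.
have f0 := Xnorm_ge0 rhoP fX.1.
have dX := (inXB rhoP (anX n) aX).1.
rewrite (_ : (fun x => _) = (fun x => phin n f * (an n x - a x) + (phin n f - phi f) * a x)); last first.
  by apply/funext => x; rewrite /rank_one; ring.
have h4 := inXZ rhoP (phin n f) dX; have h5 := inXZ rhoP (phin n f - phi f) aX.
apply: le_trans (inXD rhoP h4.1 h5.1).2 _.
apply: le_trans (lerD h4.2 h5.2) _.
have b1 : cnorm (phin n f) <= (dual_norm phi + 1) * Xnorm f.
  rewrite (_ : phin n f = (phin n f - phi f) + phi f); last by rewrite subrK.
  apply: le_trans (cnormD _ _) _; rewrite addrC mulrDl lerD ?dual_normP//.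
  by apply: le_trans (h2 _ fX) _; rewrite ler_wpM2r// ge_min lexx.
have e1K : e1 * K <= e by rewrite -ler_pdivlMr// ge_min lexx orbT.
apply: (@le_trans _ _ ((dual_norm phi + 1) * Xnorm f * e1 + e1 * Xnorm f * Xnorm a)).
  apply: lerD; last by rewrite ler_wpM2r ?h2.
  by apply: ler_pM => //; [exact: cnorm_ge0|exact: (Xnorm_ge0 rhoP dX.1)].
apply: le_trans (ler_wpM2r f0 e1K); rewrite /K.
by have := mulr_ge0 (ltW e10) f0; nra.
Qed.

Section algebra.
Variable S : set (op (R := R)).
Hypothesis SG : alg_generator rho `<=` S.
Hypothesis SC : alg_closed rho S.

(** The closure conditions do not list the zero operator; it arises as 0 times a generator. *)
Lemma alg_closed_zero : S (fun _ _ => 0).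
Proof.
have [_ [SZ _]] := SC; have := SZ 0 _ (SG (alg_generator_fejer_conv ltr01 (lexx 1))).
by rewrite (_ : (fun _ _ => _) = fun _ _ => 0)//; apply/funext => f; apply/funext => x; rewrite mul0r.
Qed.

Lemma alg_closed_sum n (F : 'I_n -> op) (c : 'I_n -> C) : (forall i, S (F i)) ->
  S (fun f x => \sum_(i < n) c i * F i f x).
Proof.
move=> SF; have [SD [SZ _]] := SC; elim: n => [|n ih] in F c SF *.
  rewrite (_ : (fun _ _ => _) = fun _ _ => 0); first exact: alg_closed_zero.
  by apply/funext => f; apply/funext => x; rewrite big_ord0.
rewrite (_ : (fun _ _ => _) = (fun f x => (fun f x => c ord0 * F ord0 f x) f x +
    (fun f x => \sum_(i < n) c (lift ord0 i) * F (lift ord0 i) f x) f x)).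
  by apply: SD; [exact: SZ|exact: ih].
by apply/funext => f; apply/funext => x; rewrite big_ord_recl.
Qed.

Lemma alg_closed_cvg Tn T : (forall n, S (Tn n)) -> bounded_op rho T ->
  op_cvg rho Tn T -> S T.
Proof. by case: SC => _ [_ [_ h]]; exact: h. Qed.

Lemma alg_closed_cont_rank_one (a b : R -> R) (L : R) : 0 < L ->
  continuous a -> continuous b -> (forall x, 0 <= a x <= 1) -> (forall x, 0 <= b x <= 1) ->
  (forall x, L < `|x| -> a x = 0) -> (forall x, L < `|x| -> b x = 0) ->
  S (rank_one (fun x => creal (a x)) (fun f => cint `[- L, L] (fun y => creal (b y) * f y))).
Proof.
move=> L0 ca cb a01 b01 aL bL; set E := `[- L, L]%classic.
have mE : measurable (E : set R) by exact: measurable_itv.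
have fE : (mu E < +oo)%E by exact: mu_itv_fin.
have ma := cmeasurable_creal (continuous_measurable ca).
have mb := cmeasurable_creal (continuous_measurable cb).
have iE := inX_indic rhoP mE fE.
have [c c0 cP] := inX_Rintegral_le rhoP mE fE.
have aX : inX (fun x => creal (a x)).
  have [] // := @inX_le _ _ rhoP 1 (fun x => creal (a x)) _ ma iE ler01.
  apply: aeW => x; rewrite mul1r !cnorm_creal.
  have [Ex|Ex] := pselect (E x).
    rewrite indicE mem_set// normr1 ger0_norm; first by have /andP[] := a01 x.
    by have /andP[] := a01 x.
  rewrite aL ?normr0//; move: Ex; rewrite /E /= in_itv /= -ler_norml => /negP.
  by rewrite -ltNge.
have bX f : inX f -> inX (fun y => creal (b y) * f y) /\
    forall y, cnorm (creal (b y) * f y) <= cnorm (f y).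
  move=> fX; have le y : cnorm (creal (b y) * f y) <= cnorm (f y).
    rewrite cnormM cnorm_creal ler_piMl ?cnorm_ge0//; have /andP[b0 b1] := b01 y.
    by rewrite ger0_norm.
  split => //; have [] // := @inX_le _ _ rhoP 1 (fun y => creal (b y) * f y) _ _ fX ler01.
    by apply: cmeasurableM => //; case: fX.
  by apply: aeW => y; rewrite mul1r.
have dpsi : dual (fun f => cint E (fun y => creal (b y) * f y)).
  split.
    move=> al f g fX gX; rewrite -(cint_lin rhoP al mE fE (bX _ fX).1 (bX _ gX).1).
    by congr cint; apply/funext => y; ring.
  exists (2 * c) => f fX; have bfX := (bX _ fX).1.
  have [_ _ bi] := inX_integrable rhoP mE fE bfX; have [_ _ fi] := inX_integrable rhoP mE fE fX.
  apply: le_trans (cnorm_cint_le mE bfX.1 bi) _; rewrite -mulrA ler_pM2l//.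
  apply: le_trans (cP _ fX); apply: le_Rintegral => // y _; exact: (bX _ fX).2.
pose d n : R := n.+1%:R^-1.
have d0 n : 0 < d n by rewrite invr_gt0.
have d1 n : d n <= 1 by rewrite invf_le1// ler1n.
pose T n : op := fun f => mulop (fun x => creal (a x)) (fejer_conv (d n) (mulop (fun x => creal (b x)) f)).
apply: (@alg_closed_cvg T).
- move=> n; have [_ [_ [SM _]]] := SC.
  apply: (SM (mulop (fun x => creal (a x))) (fun f => fejer_conv (d n) (mulop (fun x => creal (b x)) f))).
    by apply: SG; left; eexists; split => //; exact: Cdot_compact_support aL.
  apply: (SM (fejer_conv (d n))); first exact/SG/alg_generator_fejer_conv.
  by apply: SG; left; eexists; split => //; exact: Cdot_compact_support bL.
- exact: bounded_op_rank_one.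
(* On the square |x - y| <= 2 L, so [fejer_near1] gives 2 d^2 (2 L)^2 <= 8 L^2 d as d <= 1.
   [cnorm_cint_le] doubles this, [c] bounds the integral over [E] by the norm, and the last factor
   turns a pointwise bound on [E] into one in X. *)
move=> e e0; pose K := 16 * L ^+ 2 * c * Xnorm (fun x => creal (\1_E x)).
have X0 : 0 <= Xnorm (fun x => creal (\1_E x)) by exact: (Xnorm_ge0 rhoP iE.1).
have K0 : 0 <= K by do 3 apply: mulr_ge0 => //; exact: sqr_ge0.
exists (Num.bound (K / e)) => n hn f fX.
have f0 := Xnorm_ge0 rhoP fX.1.
have [bfX bfle] := bX _ fX.
have [_ _ bi] := inX_integrable rhoP mE fE bfX; have [_ _ fi] := inX_integrable rhoP mE fE fX.
have Kd : K * d n <= e.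
  rewrite ler_pdivrMr// -ler_pdivrMl// mulrC; apply: le_trans (ltW (archi_boundP _)) _.
    by rewrite divr_ge0// ltW.
  by rewrite ler_nat (leq_trans hn).
pose G : R := 16 * L ^+ 2 * d n * (c * Xnorm f).
have G0 : 0 <= G by rewrite /G !mulr_ge0 ?sqr_ge0// ltW.
have [cnvX _] : inX (fejer_conv (d n) (mulop (fun x => creal (b x)) f)) /\ True.
  by split => //; case: (bounded_op_fejer_conv (d0 n)) => h _; exact: h.
have [||_ le] := @inX_le _ _ rhoP G (fun x => T n f x - rank_one (fun x => creal (a x))
    (fun f => cint E (fun y => creal (b y) * f y)) f x) _ _ iE G0.
- apply: cmeasurableB; first by apply: cmeasurableM => //; case: cnvX.
  by apply: cmeasurableM => //; exact: cmeasurable_cst.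
- apply: aeW => x; rewrite cnorm_creal.
  have [Ex|Ex] := pselect (E x); last first.
    rewrite indicE memNset// normr0 mulr0 /T /mulop /rank_one aL ?creal0 ?mul0r ?mulr0 ?subr0 ?cnorm0//.
    by move: Ex; rewrite /E /= in_itv /= -ler_norml => /negP; rewrite -ltNge.
  rewrite indicE mem_set// normr1 mulr1 /T /mulop /rank_one [_ * creal (a x)]mulrC -mulrBr.
  rewrite cnormM cnorm_creal; apply: (@le_trans _ _ (cnorm (fejer_conv (d n)
      (fun y => creal (b y) * f y) x - cint E (fun y => creal (b y) * f y)))).
    rewrite ler_piMl ?cnorm_ge0//; have /andP[a0 a1] := a01 x; by rewrite ger0_norm.
  rewrite /fejer_conv (@cint_support _ E setT)//; last first.
    move=> y _; rewrite /E /= in_itv /= -ler_norml => /negP; rewrite -ltNge => /bL ->.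
    by rewrite creal0 mul0r mulr0.
  have mk : cmeasurable (fun y => creal (fejer (d n) (x - y)) * (creal (b y) * f y)).
    apply: cmeasurableM; last by case: bfX.
    by apply: cmeasurable_creal; exact: measurable_fejerB.
  have ik : cintegrable E (fun y => creal (fejer (d n) (x - y)) * (creal (b y) * f y)).
    apply: (cintegrable_le _ mk (integrableZl (mu := mu) mE 2 fi)) => // y _.
    rewrite cnormM cnorm_creal; apply: ler_pM => //; first exact: cnorm_ge0.
    exact: fejer_le2.
  have ib : cintegrable E (fun y => creal (b y) * f y).
    by apply: (cintegrable_le _ bfX.1 bi).
  rewrite -cintB//.
  have mD := cmeasurableB mk bfX.1.
  have dle y : E y -> cnorm (creal (fejer (d n) (x - y)) * (creal (b y) * f y) -
      creal (b y) * f y) <= 8 * L ^+ 2 * d n * cnorm (f y).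
    move=> Ey; rewrite -{2}[creal (b y) * f y]mul1r -creal1 -mulrBl -crealN -crealD cnormM cnorm_creal.
    apply: ler_pM => //; first exact: cnorm_ge0.
    rewrite distrC; apply: le_trans (fejer_near1 _ (d0 n)) _.
    have xy : (x - y) ^+ 2 <= 4 * L ^+ 2.
      move: Ex Ey; rewrite /E /= !in_itv /= => /andP[x1 x2] /andP[y1 y2].
      have h : `|x - y| <= 2 * L by rewrite ler_norml; apply/andP; split; lra.
      rewrite -real_normK ?num_real// (_ : 4 * L ^+ 2 = (2 * L) ^+ 2); last by ring.
      by rewrite lerXn2r ?nnegrE// mulr_ge0// ltW.
    have dd : d n ^+ 2 <= d n by rewrite expr2 ler_piMl// ltW.
    rewrite exprMn; have := mulr_ge0 (sqr_ge0 (d n)) (_ : 0 <= 4 * L ^+ 2 - (x - y) ^+ 2).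
    rewrite subr_ge0 => /(_ xy).
    have := mulr_ge0 (sqr_ge0 L) (_ : 0 <= d n - d n ^+ 2); rewrite subr_ge0 => /(_ dd).
    by lra.
  have iDn : mu.-integrable E (EFin \o (cnorm \o (fun y =>
      creal (fejer (d n) (x - y)) * (creal (b y) * f y) - creal (b y) * f y))).
    refine (integrable_le mE _ (integrableZl (mu := mu) mE (8 * L ^+ 2 * d n) fi) _).
      by case: (nonneg_mfun_cnorm mD).
    by move=> y Ey /=; rewrite ger0_norm ?cnorm_ge0//; exact: dle.
  apply: le_trans (cnorm_cint_le mE mD iDn) _.
  apply: (@le_trans _ _ (2 * (8 * L ^+ 2 * d n * Rintegral mu E (cnorm \o f)))).
    rewrite ler_pM2l// -RintegralZl//; apply: le_Rintegral => //.
    exact: (integrableZl (mu := mu) mE (8 * L ^+ 2 * d n) fi).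
  rewrite /G mulrA (_ : 2 * (8 * L ^+ 2 * d n) = 16 * L ^+ 2 * d n); last by ring.
  by rewrite ler_wpM2l ?cP// !mulr_ge0 ?sqr_ge0// ltW.
apply: le_trans le _; rewrite (_ : G * _ = K * d n * Xnorm f); last by rewrite /G /K; ring.
by rewrite ler_wpM2r.
Qed.

End algebra.

End compact_operators.

(** * Smoothing of indicator functions *)

Section tent.
Context {R : realType} (a b : R) (ab : a < b).
Local Notation C := (R[i]).
Local Notation mu := (@lebesgue_measure R).
Implicit Types (n m : nat) (x : R).

Let I : set R := `[a, b[%classic.

(** With q = (x - a) (b - x), the value is 0 where 2^n q <= 1 and 1 where 2^n q >= 2. *)
Definition tent n x : R := Num.min 1 (Num.max 0 (2 ^+ n * ((x - a) * (b - x)) - 1)).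

Lemma tent_ge0_le1 n x : 0 <= tent n x <= 1.
Proof. by rewrite /tent le_min ler01 le_max lexx /= ge_min lexx. Qed.

Lemma tent_out n x : ~ I x -> tent n x = 0.
Proof.
rewrite /I /= in_itv /= => /negP; rewrite negb_and -ltNge -leNgt => xab.
have u0 : (x - a) * (b - x) <= 0.
  move: xab => /orP[xa|bx].
    by apply: mulr_le0_ge0; rewrite ?subr_le0 ?subr_ge0 ltW// (lt_trans xa).
  by apply: mulr_ge0_le0; rewrite ?subr_le0 ?subr_ge0// (le_trans (ltW ab)).
have p0 : 0 < 2 ^+ n :> R by rewrite exprn_gt0.
by rewrite /tent (max_l (_ : _ <= 0)) ?min_r//; nra.
Qed.

Lemma continuous_tent n : continuous (tent n).
Proof.
move=> x; apply: (@continuous_comp _ _ _ (fun t => 2 ^+ n * ((t - a) * (b - t)) - 1)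
    (fun s => Num.min 1 (Num.max 0 s))).
  apply: cvgB; last exact: cvg_cst.
  by apply: cvgMr; apply: cvgM; apply: cvgB; (exact: cvg_cst || exact: cvg_id).
apply: continuous_min; first exact: cst_continuous.
by apply: continuous_max; [exact: cst_continuous|].
Qed.

(** The scale doubles at each step: where [tent n] is nonzero, 2^n q > 1, hence 2^m q >= 2 and
    [tent m] is 1. This yields the absorption identities of the approximation principle. *)
Lemma tent_absorb n m x : (n < m)%N -> tent m x * tent n x = tent n x.
Proof.
move=> nm; set u := (x - a) * (b - x).
have p0 : 0 < 2 ^+ n :> R by rewrite exprn_gt0.
have [le|gt] := leP (2 ^+ n * u) 1.
  have -> : tent n x = 0 by rewrite /tent -/u (max_l (_ : _ <= 0)) ?min_r//; lra.
  by rewrite mulr0.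
suff -> : tent m x = 1 by rewrite mul1r.
have pm : 2 ^+ n * 2 <= 2 ^+ m :> R by rewrite -exprSr ler_eXn2l ?ltr1n.
have u0 : 0 < u by rewrite -(pmulr_rgt0 _ p0); lra.
have h : 2 <= 2 ^+ m * u by have := ler_wpM2r (ltW u0) pm; lra.
by rewrite /tent -/u max_r ?min_l//; lra.
Qed.

(** The left endpoint belongs to the half-open interval although every tent vanishes there; it is a
    null set. *)
Lemma tent_near1 x : I x -> x != a -> exists N, forall n, (N <= n)%N -> tent n x = 1.
Proof.
rewrite /I /= in_itv /= => /andP[ax xb] xa; set u := (x - a) * (b - x).
have u0 : 0 < u by rewrite mulr_gt0 ?subr_gt0// lt_def xa.
exists (Num.bound (2 / u)) => n Nn.
have h : 2 <= 2 ^+ n * u.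
  rewrite -ler_pdivrMr//; apply: ltW; apply: lt_trans (archi_boundP _) _.
    by rewrite divr_ge0// ltW.
  by rewrite -natrX ltr_nat (leq_ltn_trans Nn)// ltn_expl.
by rewrite /tent -/u max_r ?min_l//; lra.
Qed.

(* Multiplication by a function equal to 1 off [[a, b)] which replaces the
   indicator of [[a, b)] by the continuous [tent n]. *)
Definition smoothing n : op := fun f x => creal (1 - \1_I x + tent n x) * f x.

Lemma tent_indic n x : \1_I x * tent n x = tent n x.
Proof.
rewrite indicE; have [Ix|Ix] := pselect (I x); first by rewrite mem_set ?mul1r.
by rewrite memNset ?mul0r ?tent_out.
Qed.

(** Turns strong convergence of the smoothings, applied to the indicator, into convergence of the
    tents to it in X. *)
Lemma smoothing_indic n : smoothing n (fun x => creal (\1_I x)) = (fun x => creal (tent n x)).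
Proof.
apply/funext => x; rewrite /smoothing -crealM mulrDl [tent n x * _]mulrC tent_indic.
by rewrite indicE; case: (x \in I); congr creal => /=; ring.
Qed.

Lemma smoothing_symbol n x : 0 <= 1 - \1_I x + tent n x <= 1.
Proof.
have /andP[t0 t1] := tent_ge0_le1 n x; rewrite indicE.
have [Ix|Ix] := pselect (I x); first by rewrite mem_set//=; lra.
by rewrite memNset ?tent_out//=; lra.
Qed.

Lemma smoothing_absorb n m f : (n < m)%N -> smoothing m (smoothing n f) = smoothing n f.
Proof.
move=> nm; apply/funext => x; rewrite /smoothing mulrA -crealM; congr (creal _ * _).
have h := tent_absorb x nm; rewrite indicE.
have [Ix|Ix] := pselect (I x); first by rewrite mem_set//= subrr !add0r.
by rewrite memNset ?tent_out//= subr0 addr0 mulr1.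
Qed.

Lemma smoothingC n m f : smoothing n (smoothing m f) = smoothing m (smoothing n f).
Proof. by apply/funext => x; rewrite /smoothing mulrCA. Qed.

Context (rho : (R -> R) -> \bar R) (rhoP : banach_function_norm rho).
Local Notation inX := (inX rho).
Local Notation Xnorm := (Xnorm rho).

Let mI : measurable I. Proof. exact: measurable_itv. Qed.

Let measurable_symbol n : measurable_fun setT (fun x : R => 1 - \1_I x + tent n x).
Proof.
apply: measurable_funD; last exact: continuous_measurable (@continuous_tent n).
by apply: measurable_funB; [exact: measurable_cst|exact: measurable_indic].
Qed.

Lemma inX_smoothing n f : inX f -> inX (smoothing n f) /\ Xnorm (smoothing n f) <= 1 * Xnorm f.
Proof.
move=> fX; apply: inX_le => //.
  by apply: cmeasurableM; [exact: cmeasurable_creal|case: fX].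
apply: aeW => x; rewrite mul1r cnormM cnorm_creal ler_piMl ?cnorm_ge0//.
by have /andP[s0 s1] := smoothing_symbol n x; rewrite ger0_norm.
Qed.

Lemma smoothing_lin n (al : C) f g :
  smoothing n (fun x => al * f x + g x) = (fun x => al * smoothing n f x + smoothing n g x).
Proof. by apply/funext => x; rewrite /smoothing; ring. Qed.

(** Dominated convergence on the dyadic interval with majorant |f|: the multipliers are eventually 1
    at every point except [a]. *)
Lemma smoothing_cvg psi f : dyadic_functionals psi -> inX f -> forall e, 0 < e ->
  exists N, forall n, (N <= n)%N -> cnorm (psi (smoothing n f) - psi f) <= e.
Proof.
move=> [k [j ->]] fX e e0; set D := dyadic k j.
have mD : measurable D by exact: measurable_dyadic.
have fD : (mu D < +oo)%E by exact: mu_dyadic_fin.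
have [_ _ fi] := inX_integrable rhoP mD fD fX.
pose w n x := (1 - (1 - \1_I x + tent n x)) * cnorm (f x).
have w0 n x : 0 <= w n x <= cnorm (f x).
  have /andP[s0 s1] := smoothing_symbol n x; have c0 := cnorm_ge0 (f x).
  by rewrite /w; apply/andP; split; [rewrite mulr_ge0//|rewrite ler_piMl//]; lra.
have mw n : measurable_fun setT (w n).
  apply: measurable_funM; last by case: (nonneg_mfun_cnorm fX.1).
  by apply: measurable_funB; [exact: measurable_cst|exact: measurable_symbol].
have wi n : mu.-integrable D (EFin \o w n).
  by refine (integrable_le mD (mw n) fi _) => x _ /=; have /andP[? ?] := w0 n x; rewrite ger0_norm.
have xa : {ae mu, forall x, x != a}.
  exists [set a]; split => //; first exact: lebesgue_measure_set1.
  by move=> x /= /negP; rewrite negbK => /eqP.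
have cv : Rintegral mu D (w n) @[n --> \oo] --> (0 : R).
  have [] := @dominated_convergence _ _ R mu D mD (fun n => EFin \o w n) (cst 0%E)
      (EFin \o (cnorm \o f)).
  - by move=> n; apply/measurable_EFinP; apply: measurable_funTS; exact: mw.
  - exact: measurable_cst.
  - move: xa; apply: aeS => x xa _; apply: cvg_near_cst.
    have [Ix|Ix] := pselect (I x).
      have [N NP] := tent_near1 Ix xa; exists N => // n /= /NP h.
      by rewrite /w h indicE mem_set//= subrr add0r subrr mul0r.
    by apply: nearW => n; rewrite /= /w tent_out// indicE memNset//= subr0 addr0 subrr mul0r.
  - exact: fi.
  - by apply: aeW => x n _ /=; rewrite lee_fin; have /andP[? ?] := w0 n x; rewrite ger0_norm.
  move=> _ _; rewrite integral0 => cv.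
  by apply: fine_cvg.
move/cvgrPdist_le : cv => /(_ _ (divr2_gt0 e0))[N _ NP]; exists N => n /NP /=.
have sX := (inX_smoothing n fX).1.
rewrite -(dualB (dual_cint rhoP mD fD) sX fX) sub0r normrN => le.
have hX := (inXB rhoP sX fX).1.
have [_ _ hi] := inX_integrable rhoP mD fD hX.
apply: le_trans (cnorm_cint_le mD hX.1 hi) _.
rewrite mulrC -ler_pdivlMr//; apply: le_trans (le_trans (ler_norm _) le).
apply: le_Rintegral => //; first exact: wi.
move=> x _ /=; rewrite /w /smoothing.
have /andP[s0 s1] := smoothing_symbol n x.
rewrite -{2}[f x]mul1r -creal1 -mulrBl -crealN -crealD cnormM cnorm_creal distrC ger0_norm//.
by rewrite subr_ge0.
Qed.

Hypothesis rho_reflexive : reflexive_space rho.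

Lemma smoothing_strong_cvg f : inX f -> forall e, 0 < e -> exists N,
  forall n, (N <= n)%N -> Xnorm (fun x => smoothing n f x - f x) <= e.
Proof.
move=> fX e e0.
refine (strong_cvg rhoP rho_reflexive (P := smoothing) _ ler01 _ _ _
  (dyadic_functionals_dual rhoP) (dyadic_functionals_sep rhoP) smoothing_cvg fX e0).
- by move=> n g /(inX_smoothing n)[].
- by move=> n g /(inX_smoothing n)[].
- by move=> *; exact: smoothing_lin.
- by move=> n m g nm _; apply: aeW => x; rewrite smoothing_absorb.
Qed.

Lemma smoothing_dual_strong_cvg phi : dual_elt rho phi -> forall e, 0 < e -> exists N,
  forall n, (N <= n)%N -> forall f, inX f ->
    cnorm (phi (smoothing n f) - phi f) <= e * Xnorm f.
Proof.
move=> dphi e e0.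
refine (dual_strong_cvg rhoP rho_reflexive (P := smoothing) _ ler01 _ _ _ _
  (dyadic_functionals_dual rhoP) (dyadic_functionals_sep rhoP) smoothing_cvg dphi e0).
- by move=> n g /(inX_smoothing n)[].
- by move=> n g /(inX_smoothing n)[].
- by move=> *; exact: smoothing_lin.
- by move=> n m g nm _; apply: aeW => x; rewrite smoothing_absorb.
- by move=> n m g nm _; apply: aeW => x; rewrite smoothingC smoothing_absorb.
Qed.

End tent.

(** * Compact operators *)

Section compact_in_algebra.
Context {R : realType} (rho : (R -> R) -> \bar R).
Hypothesis rhoP : banach_function_norm rho.
Hypothesis rho_reflexive : reflexive_space rho.
Hypothesis rho_maximal : maximal_bounded rho.
Local Notation C := (R[i]).
Local Notation mu := (@lebesgue_measure R).
Local Notation inX := (inX rho).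
Local Notation Xnorm := (Xnorm rho).
Local Notation ae_eq := (@Defs.ae_eq R).
Local Notation dual := (dual_elt rho).

Lemma dyadic_avg_ae_refine n m f : (n < m)%N -> inX f ->
  ae_eq (dyadic_avg m (dyadic_avg n f)) (dyadic_avg n f).
Proof.
move=> nm _; apply: aeW => x.
by rewrite -(subnKC (ltnW nm)) dyadic_avg_refine.
Qed.

Lemma dyadic_avg_ae_coarsen n m f : (n < m)%N -> inX f ->
  ae_eq (dyadic_avg n (dyadic_avg m f)) (dyadic_avg n f).
Proof.
move=> nm fX; apply: aeW => x.
by rewrite -(subnKC (ltnW nm)) (dyadic_avg_coarsen rhoP).
Qed.

Lemma dyadic_avg_strong_cvg f : inX f -> forall e, 0 < e -> exists N,
  forall n, (N <= n)%N -> Xnorm (fun x => dyadic_avg n f x - f x) <= e.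
Proof.
move=> fX e e0; have [c c0 cP] := dyadic_avg_bounded rhoP rho_maximal.
exact: (strong_cvg rhoP rho_reflexive (inX_dyadic_avg rhoP) c0 cP
  (dyadic_avg_lin rhoP) dyadic_avg_ae_refine (dyadic_functionals_dual rhoP)
  (dyadic_functionals_sep rhoP) (dyadic_avg_cvg rhoP) fX e0).
Qed.

Lemma dyadic_avg_dual_strong_cvg phi : dual phi -> forall e, 0 < e -> exists N,
  forall n, (N <= n)%N -> forall f, inX f ->
    cnorm (phi (dyadic_avg n f) - phi f) <= e * Xnorm f.
Proof.
move=> dphi e e0; have [c c0 cP] := dyadic_avg_bounded rhoP rho_maximal.
exact: (dual_strong_cvg rhoP rho_reflexive (inX_dyadic_avg rhoP) c0 cP
  (dyadic_avg_lin rhoP) dyadic_avg_ae_refine dyadic_avg_ae_coarsen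
  (dyadic_functionals_dual rhoP) (dyadic_functionals_sep rhoP)
  (dyadic_avg_cvg rhoP) dphi e0).
Qed.

Lemma dual_sum phi n (c : 'I_n -> C) (F : 'I_n -> R -> C) : dual phi ->
  (forall i, inX (F i)) ->
  phi (fun x => \sum_(i < n) c i * F i x) = \sum_(i < n) c i * phi (F i).
Proof.
move=> dphi; elim: n => [|n ih] in c F * => FX.
  rewrite big_ord0 -[RHS](dual0 rhoP dphi); congr phi.
  by apply/funext => x; rewrite big_ord0.
rewrite big_ord_recl -ih// -dphi.1//; last first.
  by apply: inX_sum => // i; case: (inXZ rhoP (c (lift ord0 i)) (FX (lift ord0 i))).
by congr phi; apply/funext => x; rewrite big_ord_recl.
Qed.

(** Compactness speaks of the unit ball while [op_cvg] wants a homogeneous estimate. Functions of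
    norm 0 cannot be rescaled and are handled by boundedness of [U]. *)
Lemma op_le_unit_ball (U : op) (e : R) : bounded_op rho U -> 0 <= e ->
  (forall f, inX f -> Xnorm f <= 1 -> Xnorm (U f) <= e) ->
  forall f, inX f -> Xnorm (U f) <= e * Xnorm f.
Proof.
move=> [UX [Ulin [c cP]]] e0 Ue f fX.
have r0 := Xnorm_ge0 rhoP fX.1.
have [r_eq0|r_neq0] := eqVneq (Xnorm f) 0.
  by have := cP _ fX; rewrite r_eq0 !mulr0.
have rgt : 0 < Xnorm f by rewrite lt_def r_neq0.
pose g x := creal (Xnorm f)^-1 * f x.
have [gX gle] : inX g /\ Xnorm g <= 1.
  have [gX gle] := inXZ rhoP (creal (Xnorm f)^-1) fX; split => //.
  by apply: le_trans gle _; rewrite cnorm_creal ger0_norm ?invr_ge0// mulVf.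
have [zX z0] := inX0 rhoP.
(* Linearity is available for [al * f + g] only, hence the summand 0; its image has norm 0 by
   boundedness. *)
have fE : f = fun x => creal (Xnorm f) * g x + 0.
  by apply/funext => x; rewrite /g mulrA -crealM mulfV// creal1 mul1r addr0.
have lin := Ulin (creal (Xnorm f)) _ _ gX zX; rewrite -fE in lin.
have [sX sle] := inX_lin rhoP (creal (Xnorm f)) (UX _ gX) (UX _ zX).
have [_ ->] := inX_ae_eq rhoP (UX _ fX).1 sX lin.
apply: le_trans sle _; have := cP _ zX; rewrite z0 mulr0 => U0.
rewrite cnorm_creal (ger0_norm r0) [e * _]mulrC -[leRHS]addr0.
by rewrite lerD// ler_wpM2l// Ue.
Qed.

Lemma bounded_op_avg_diff (T : op) n : bounded_op rho T ->
  bounded_op rho (fun f x => dyadic_avg n (T f) x - T f x).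
Proof.
move=> [TX [Tlin [c cP]]]; have [c1 c10 c1P] := dyadic_avg_bounded rhoP rho_maximal.
split; first by move=> f fX; case: (inXB rhoP (inX_dyadic_avg rhoP n (TX _ fX)) (TX _ fX)).
split.
  move=> al f g fX gX; have [fgX _] := inX_lin rhoP al fX gX.
  have [sX _] := inX_lin rhoP al (TX _ fX) (TX _ gX).
  have lin := Tlin al f g fX gX; move: (lin); apply: aeS => x ->.
  rewrite (_ : dyadic_avg n _ x = dyadic_avg n (fun x => al * T f x + T g x) x); last first.
    rewrite /dyadic_avg; congr (_ * _).
    apply: (dual_ae_eq rhoP _ (TX _ fgX) sX lin).
    by apply: dual_cint => //; [exact: measurable_dyadic|exact: mu_dyadic_fin].
  by rewrite (dyadic_avg_lin rhoP)//; [ring|exact: TX|exact: TX].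
exists ((c1 + 1) * c) => f fX; have TfX := TX _ fX.
apply: le_trans (inXB rhoP (inX_dyadic_avg rhoP n TfX) TfX).2 _.
rewrite -mulrA mulrDl mul1r; apply: lerD; last exact: cP.
by apply: le_trans (c1P _ _ TfX) _; rewrite ler_wpM2l// cP.
Qed.

(* The averages converge uniformly on the relatively compact image of the unit ball. *)
Lemma compact_op_avg_cvg (T : op) : compact_op rho T ->
  op_cvg rho (fun n f => dyadic_avg n (T f)) T.
Proof.
move=> [bT cT] e e0; have [TX _] := bT.
have [c c0 cP] := dyadic_avg_bounded rhoP rho_maximal.
suff [N NP] : exists N, forall n, (N <= n)%N -> forall f, inX f -> Xnorm f <= 1 ->
    Xnorm (fun x => dyadic_avg n (T f) x - T f x) <= e.
  exists N => n /NP {}NP; apply: (op_le_unit_ball (bounded_op_avg_diff n bT) (ltW e0)).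
  exact: NP.
apply: contrapT => nN.
(* By contradiction: choose bad pairs (n, f) with n >= N and extract a limit [g] of the images T f.
   Then (c + 1) |T f - g| + |E_n g - g| <= e contradicts the choice. *)
have {}nN N : exists nf : nat * (R -> C), [/\ (N <= nf.1)%N, inX nf.2, Xnorm nf.2 <= 1 &
    e < Xnorm (fun x => dyadic_avg nf.1 (T nf.2) x - T nf.2 x)].
  apply: contrapT => h; apply: nN; exists N => n Nn f fX f1.
  by rewrite leNgt; apply/negP => lt; apply: h; exists (n, f).
have [F FP] := choice nN.
have [|s [g [s_incr [gX /cvgrPdist_le gcv]]]] := cT (fun N => (F N).2).
  by move=> N; have [] := FP N.
(* Ensures that the generation attached to the [s k]-th bad pair is at least [k]. *)
have sk k : (k <= s k)%N.
  by elim: k => // k ih; exact: leq_ltn_trans ih (s_incr k).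
have c1 : 0 < c + 1 by rewrite ltr_wpDl.
have e2 := divr2_gt0 e0.
have [N1 h1] := dyadic_avg_strong_cvg gX e2.
have [N2 _ h2] := gcv _ (divr_gt0 e2 c1).
pose k := maxn N1 N2; have [kn fX f1] := FP (s k).
set n := (F (s k)).1 in kn *; set f := (F (s k)).2 in fX f1 *; have TfX := TX _ fX.
have {}h1 : Xnorm (fun x => dyadic_avg n g x - g x) <= e / 2.
  by apply: h1; rewrite (leq_trans (leq_maxl N1 N2))// (leq_trans (sk k)).
have dX := (inXB rhoP TfX gX).1.
have {}h2 : Xnorm (fun x => T f x - g x) * (c + 1) <= e / 2.
  rewrite -ler_pdivlMr//; have := h2 k (leq_maxr N1 N2); rewrite /= sub0r normrN.
  by apply: le_trans; exact: ler_norm.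
apply/negP; rewrite -leNgt.
apply: le_trans (Xnorm_triangle rhoP (inX_dyadic_avg rhoP n TfX) (inX_dyadic_avg rhoP n gX) TfX) _.
apply: le_trans (lerD (lexx _) (Xnorm_triangle rhoP (inX_dyadic_avg rhoP n gX) gX TfX)) _.
rewrite (XnormBC _ g (T f)); have := cP n _ dX.
rewrite (_ : dyadic_avg n (fun x => T f x - g x) =
    (fun x => dyadic_avg n (T f) x - dyadic_avg n g x)); first by lra.
rewrite (_ : (fun x => T f x - g x) = (fun x => (-1) * g x + T f x)).
  by rewrite (dyadic_avg_lin rhoP)//; apply/funext => x; rewrite mulN1r addrC.
by apply/funext => x; rewrite mulN1r addrC.
Qed.

Section algebra.
Variable S : set (op (R := R)).
Hypothesis SG : alg_generator rho `<=` S.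
Hypothesis SC : alg_closed rho S.

(** Both factors are limits of tents: the function through the smoothings on X, the functional
    through their adjoints on the dual. *)
Lemma alg_closed_indic_rank_one (a b a' b' : R) : a < b -> a' < b' ->
  S (rank_one (fun x => creal (\1_(`[a, b[%classic) x)) (cint `[a', b'[)).
Proof.
move=> ab ab'; pose L := 1 + `|a| + `|b| + `|a'| + `|b'|.
have L0 : 0 < L by rewrite /L; have := (normr_ge0 a, normr_ge0 b, normr_ge0 a', normr_ge0 b') => -[[[]]]; lra.
have La c d : `|c| + `|d| <= L -> forall x, L < `|x| -> ~ `[c, d[%classic x.
  move=> cdL x Lx /=; rewrite in_itv /= => /andP[cx xd]; move: Lx.
  apply/negP; rewrite -leNgt; apply: le_trans cdL; rewrite ler_norml.
  have := ler_norm d; have := ler_norm (- c); rewrite normrN => h1 h2.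
  by have := normr_ge0 c; have := normr_ge0 d; move=> h3 h4; apply/andP; split; lra.
have Lab : `|a| + `|b| <= L by rewrite /L; have := (normr_ge0 a', normr_ge0 b') => -[]; lra.
have Lab' : `|a'| + `|b'| <= L by rewrite /L; have := (normr_ge0 a, normr_ge0 b) => -[]; lra.
have mI (c d : R) : measurable (`[c, d[%classic : set R) by exact: measurable_itv.
have fI (c d : R) : (mu (`[c, d[%classic : set R) < +oo)%E.
  by rewrite lebesgue_measure_itv /=; case: ifP => _; rewrite ltry.
have iX := inX_indic rhoP (mI a b) (fI a b).
have dX := dual_cint rhoP (mI a' b') (fI a' b').
pose phi n f := cint `[- L, L] (fun y => creal (tent a' b' n y) * f y).
(* On the interval the smoothing symbol is exactly the tent, so integration against the tent is the
   integral functional composed with the smoothing. *)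
have phiE n f : phi n f = cint `[a', b'[ (smoothing a' b' n f).
  rewrite /phi (@cint_support _ `[a', b'[%classic)//.
  - by apply: eq_cint => y Iy; rewrite /smoothing indicE mem_set//= subrr add0r.
  - move=> y Iy; rewrite /= in_itv /= -ler_norml leNgt; apply/negP => Ly.
    exact: (La _ _ Lab' _ Ly).
  by move=> y _ Iy; rewrite tent_out// creal0 mul0r.
apply: (alg_closed_cvg SC (Tn := fun n => rank_one (fun x => creal (tent a b n x)) (phi n))).
- move=> n; apply: (alg_closed_cont_rank_one rhoP rho_maximal SG SC L0).
  + exact: continuous_tent.
  + exact: continuous_tent.
  + exact: tent_ge0_le1.
  + exact: tent_ge0_le1.
  + by move=> x /(La _ _ Lab) nI; exact: tent_out.
  + by move=> x /(La _ _ Lab') nI; exact: tent_out.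
- exact: bounded_op_rank_one.
apply: rank_one_cvg => //.
- move=> n; rewrite -smoothing_indic//.
  by case: (inX_smoothing ab rhoP n iX).
- move=> e e0; have [N NP] := smoothing_strong_cvg ab rhoP rho_reflexive iX e0.
  by exists N => n /NP; rewrite smoothing_indic.
- move=> e e0; have [N NP] := smoothing_dual_strong_cvg ab' rhoP rho_reflexive dX e0.
  by exists N => n /NP h f fX; rewrite phiE; exact: h.
Qed.

(** Any functional is the norm limit of phi o E_m, and each phi o E_m combines finitely many
    integrals over cells. *)
Lemma alg_closed_dyadic_rank_one n k phi : dual phi ->
  S (rank_one (fun x => creal (\1_(dyadic n k) x)) phi).
Proof.
move=> dphi; have mD m j : measurable (@dyadic R m j) by exact: measurable_dyadic.
have fD m j : (mu (@dyadic R m j) < +oo)%E by exact: mu_dyadic_fin.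
have iX m j := inX_indic rhoP (mD m j) (fD m j).
pose J m (j : 'I_(2 * 4 ^ m)) : set R := dyadic m (j%:Z - (4 ^ m)%N%:Z).
(* The coefficients of phi o E_m, read off by applying [phi] to [dyadic_avg_sum]. *)
pose c m j := creal (2 ^+ m) * phi (fun x => creal (\1_(J m j) x)).
apply: (alg_closed_cvg SC (Tn := fun m f x => \sum_j c m j *
  rank_one (fun x => creal (\1_(dyadic n k) x)) (cint (J m j)) f x)).
- move=> m; apply: (alg_closed_sum rhoP rho_maximal SG SC) => j.
  by apply: alg_closed_indic_rank_one; exact: dyadic_lt.
- exact: bounded_op_rank_one.
rewrite (_ : (fun m => _) = (fun m => rank_one (fun x => creal (\1_(dyadic n k) x))
    (fun f => \sum_j c m j * cint (J m j) f))); last first.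
  apply/funext => m; apply/funext => f; apply/funext => x; rewrite /rank_one mulr_suml.
  by apply: eq_bigr => j _; rewrite mulrA.
apply: rank_one_cvg => //.
  by move=> e e0; exists 0%N => m _; rewrite (_ : (fun x => _) = fun=> 0);
    [rewrite (inX0 rhoP).2 ltW|apply/funext => x; rewrite subrr].
move=> e e0; have [N NP] := dyadic_avg_dual_strong_cvg dphi e0.
exists N => m /NP h f fX; have := h f fX.
rewrite dyadic_avg_sum (dual_sum (fun j => creal (2 ^+ m) * cint (J m j) f) dphi)//.
by rewrite (eq_bigr (fun j => c m j * cint (J m j) f))// => j _; rewrite mulrAC.
Qed.

(** Absorbing [T] into the functionals, E_n T is the finite sum of 2^n chi_J (x) (int_J o T). *)
Lemma alg_closed_avg_comp (T : op) n : bounded_op rho T -> S (fun f => dyadic_avg n (T f)).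
Proof.
move=> [TX [Tlin [c cP]]].
pose J (j : 'I_(2 * 4 ^ n)) : set R := dyadic n (j%:Z - (4 ^ n)%N%:Z).
have dJ j : dual (fun f => cint (J j) (T f)).
  have dj : dual (cint (J j)).
    by apply: dual_cint => //; [exact: measurable_dyadic|exact: mu_dyadic_fin].
  split.
    move=> al f g fX gX; rewrite -dj.1; [|exact: TX|exact: TX].
    (* [T] is linear only up to null sets, which integration over the cell does not see. *)
    apply: (dual_ae_eq rhoP dj); first exact/TX/(inX_lin rhoP al fX gX).1.
      exact: (inX_lin rhoP al (TX _ fX) (TX _ gX)).1.
    exact: Tlin.
  exists (dual_norm rho (cint (J j)) * c) => f fX.
  apply: le_trans (dual_normP rhoP dj (TX _ fX)) _.
  by rewrite -mulrA ler_wpM2l ?cP// (dual_norm_ge0 rhoP).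
rewrite (_ : (fun f => _) = (fun f x => \sum_j creal (2 ^+ n) *
    rank_one (fun x => creal (\1_(J j) x)) (fun f => cint (J j) (T f)) f x)).
  by apply: (alg_closed_sum rhoP rho_maximal SG SC) => j; exact: alg_closed_dyadic_rank_one.
apply/funext => f; rewrite dyadic_avg_sum; apply/funext => x.
by apply: eq_bigr => j _; rewrite /rank_one mulrA.
Qed.

Lemma alg_closed_compact_op (T : op) : compact_op rho T -> S T.
Proof.
move=> cT; have [bT _] := cT.
apply: (alg_closed_cvg SC _ bT (compact_op_avg_cvg cT)).
by move=> n; exact: alg_closed_avg_comp.
Qed.

End algebra.

End compact_in_algebra.

Theorem theorem1p1 (R : realType) (rho : (R -> R) -> \bar R) :
  banach_function_norm rho ->
  reflexive_space rho ->
  maximal_bounded rho ->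
  maximal_bounded (assoc_norm rho) ->
  forall T : op, compact_op rho T -> A_X rho T.
Proof.
move=> rhoP rho_reflexive rho_maximal _ T cT; split; first by case: cT.
by move=> S SG SC; exact: (alg_closed_compact_op rhoP rho_reflexive rho_maximal SG SC cT).
Qed.
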